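(* For any integer $s\ge 0$, the knot group $G$ of the twisted torus knot $K(5,3;2,s)$ admits a generalized torsion element.
   Context: For coprime positive integers $P, Q \geq 2$ and an integer $s\ge 0$, the twisted torus knot $K(P,Q;2,s)$ is the knot obtained from the torus knot $T_{P,Q}$ by adding $s$ positive full twists to two adjacent parallel strands; it is the closure of the positive $P$-strand braid $(\sigma_1\sigma_2\cdots\sigma_{P-1})^{Q}\sigma_1^{2s}$, where $\sigma_i$ are the standard generators of the braid group. The knot group of a knot $K\subset S^3$ is $\pi_1(S^3-K)$. For a group $G$, a non-trivial element $g\in G$ is a generalized torsion element if some non-empty finite product of conjugates of $g$ equals the identity. *)

(* Defs.v *)
From HB Require Import structures.
From mathcomp Require Import all_boot all_order all_algebra.
From mathcomp Require Import all_classical all_reals all_analysis.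
From mathcomp Require Import homotopy ring lra.
Set Implicit Arguments.
Unset Strict Implicit.
Unset Printing Implicit Defensive.
Import Order.TTheory GRing.Theory Num.Theory.
Import numFieldNormedType.Exports.
Local Open Scope classical_set_scope.
Local Open Scope ring_scope.
Local Open Scope quotient_scope.

Definition generalized_torsion (G : groupType) (g : G) : Prop :=
  g <> 1%g /\
  exists2 hs : seq G, hs <> [::] & (\prod_(h <- hs) (g ^ h) = 1)%g.

Definition unit_interval (R : realType) : Type := set_type `[0 : R, 1]%classic.

HB.instance Definition _ (R : realType) := Topological.on (unit_interval R).

Section interval.
Context {R : realType}.
Implicit Types (r : R) (t : unit_interval R).

Definition clamp r : R := Num.max 0 (Num.min 1 r).

Lemma clamp_itv r : clamp r \in `[0 : R, 1]%classic.
Proof.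
rewrite inE /= in_itv /= /clamp le_max lexx /= ge_max ler01 /=.
by rewrite ge_min lexx.
Qed.

Definition to_itv r : unit_interval R := exist _ (clamp r) (clamp_itv r).

Definition of_itv t : R := \val t.

Lemma of_itvP t : 0 <= of_itv t <= 1.
Proof. by have := valP t; rewrite inE /= in_itv. Qed.

Lemma to_itvE r : 0 <= r <= 1 -> of_itv (to_itv r) = r.
Proof.
by move=> /andP[r0 r1]; rewrite /of_itv /= /clamp (min_r r1) (max_r r0).
Qed.

Lemma of_itv_inj : injective of_itv.
Proof. by move=> t u tu; exact: val_inj. Qed.

Lemma of_itvK : cancel of_itv to_itv.
Proof. by move=> t; apply: of_itv_inj; rewrite to_itvE ?of_itvP. Qed.

Lemma to_itv01 : to_itv 0 <> to_itv 1.
Proof.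
move=> /(congr1 of_itv); rewrite !to_itvE ?lexx ?ler01// => /eqP.
by rewrite eq_sym oner_eq0.
Qed.

HB.instance Definition _ :=
  isBiPointed.Build (unit_interval R) (introN eqP to_itv01).

Lemma of_itv0 : of_itv zero = 0.
Proof. by rewrite to_itvE// lexx ler01. Qed.

Lemma of_itv1 : of_itv one = 1.
Proof. by rewrite to_itvE// lexx ler01. Qed.

Lemma to_itv_le0 r : r <= 0 -> to_itv r = zero.
Proof.
move=> r0; apply: of_itv_inj; rewrite of_itv0 /of_itv /= /clamp.
by rewrite max_l// ge_min r0 orbT.
Qed.

Lemma to_itv_ge1 r : 1 <= r -> to_itv r = one.
Proof.
move=> r1; apply: of_itv_inj; rewrite of_itv1 /of_itv /= /clamp.
by rewrite min_l// max_r.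
Qed.

Lemma of_itv_continuous : continuous of_itv.
Proof. exact: initial_continuous. Qed.

Lemma to_itv_continuous : continuous to_itv.
Proof.
apply: continuous_comp_initial => r.
apply: (@continuous_max R R (cst 0) (fun x => Num.min 1 x)); first exact: cst_continuous.
apply: (@continuous_min R R (cst 1) id) => //; exact: cst_continuous.
Qed.

End interval.

Section continuity.
Context {R : realType} {X : topologicalType}.
Implicit Types (u v : X -> R).

Lemma ctsD u v :
  continuous u -> continuous v -> continuous (fun x => u x + v x).
Proof. by move=> cu cv x; apply: (@continuousD _ _ _ u v); [exact: cu|exact: cv]. Qed.

Lemma ctsB u v :
  continuous u -> continuous v -> continuous (fun x => u x - v x).
Proof. by move=> cu cv x; apply: (@continuousB _ _ _ u v); [exact: cu|exact: cv]. Qed.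

Lemma ctsM u v :
  continuous u -> continuous v -> continuous (fun x => u x * v x).
Proof. by move=> cu cv x; apply: (@continuousM _ _ u v); [exact: cu|exact: cv]. Qed.

Lemma cts_max u v :
  continuous u -> continuous v -> continuous (fun x => Num.max (u x) (v x)).
Proof. by move=> cu cv x; apply: (@continuous_max R X u v); [exact: cu|exact: cv]. Qed.

Lemma cts_min u v :
  continuous u -> continuous v -> continuous (fun x => Num.min (u x) (v x)).
Proof. by move=> cu cv x; apply: (@continuous_min R X u v); [exact: cu|exact: cv]. Qed.

Lemma cts_comp {Y Z : topologicalType} (f : X -> Y) (g : Y -> Z) :
  continuous g -> continuous f -> continuous (fun x => g (f x)).
Proof. by move=> cg cf x; apply: continuous_comp; [exact: cf|exact: cg]. Qed.

Lemma cts_pair {Y Z : topologicalType} (f : X -> Y) (g : X -> Z) :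
  continuous f -> continuous g -> continuous (fun x => (f x, g x)).
Proof. by move=> cf cg x; apply: cvg_pair; [exact: cf|exact: cg]. Qed.

End continuity.

Lemma cts_fst {X Y : topologicalType} : continuous (@fst X Y).
Proof. by move=> x; exact: cvg_fst. Qed.

Lemma cts_snd {X Y : topologicalType} : continuous (@snd X Y).
Proof. by move=> x; exact: cvg_snd. Qed.

Ltac cts := repeat first [ assumption | match goal with
  | |- continuous (fun x => ?c) => refine (fun x => @cst_continuous _ _ c x)
  | |- continuous (cst _) => exact: cst_continuous
  | |- continuous of_itv => exact: of_itv_continuous
  | |- continuous to_itv => exact: to_itv_continuous
  | |- continuous fst => exact: cts_fst
  | |- continuous snd => exact: cts_snd
  | |- continuous (fun x => x) => by move=> x; exact: cvg_id
  | |- continuous (fun x => @?u x - @?v x) => refine (@ctsB _ _ u v _ _)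
  | |- continuous (fun x => @?u x + @?v x) => refine (@ctsD _ _ u v _ _)
  | |- continuous (fun x => @?u x * @?v x) => refine (@ctsM _ _ u v _ _)
  | |- continuous (fun x => Num.max (@?u x) (@?v x)) =>
      refine (@cts_max _ _ u v _ _)
  | |- continuous (fun x => Num.min (@?u x) (@?v x)) =>
      refine (@cts_min _ _ u v _ _)
  | |- continuous (fun x => (@?u x, @?v x)) => refine (@cts_pair _ _ _ u v _ _)
  | |- continuous (fun x => fst (@?u x)) =>
      refine (@cts_comp _ _ _ u fst (@cts_fst _ _) _)
  | |- continuous (fun x => snd (@?u x)) =>
      refine (@cts_comp _ _ _ u snd (@cts_snd _ _) _)
  | |- continuous (fun x => of_itv (@?u x)) =>
      refine (@cts_comp _ _ _ u of_itv of_itv_continuous _)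
  | |- continuous (fun x => to_itv (@?u x)) =>
      refine (@cts_comp _ _ _ u to_itv to_itv_continuous _)
  | |- continuous (fun x => ?g (@?f x)) =>
      refine (@cts_comp _ _ _ f g _ _)
  end ].

Section pasting.
Context {R : realType} {X T : topologicalType}.

Lemma pasting_continuous (u v : X -> R) (f g : X -> T) :
  continuous u -> continuous v -> continuous f -> continuous g ->
  (forall x, u x = v x -> f x = g x) ->
  continuous (fun x => if u x <= v x then f x else g x).
Proof.
move=> cu cv cf cg fg.
have cuv : continuous (u \- v) by move=> x; apply: continuousB; [exact: cu|exact: cv].
apply/continuous_subspace_setT.
rewrite (_ : setT = [set x | (u \- v) x \in `]-oo, 0%R]%classic] `|`
                    [set x | (u \- v) x \in `[0%R, +oo[%classic]); last first.
  apply/seteqP; split => // x _ /=; rewrite !inE /= !in_itv /= andbT.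
  exact/orP/le_total.
apply: withinU_continuous.
- rewrite (_ : mkset _ = (u \- v) @^-1` `]-oo, 0%R]%classic); last first.
    by apply/seteqP; split => x /=; rewrite inE.
  by apply: closed_comp => [x _|]; [exact: cuv|exact: lray_closed].
- rewrite (_ : mkset _ = (u \- v) @^-1` `[0%R, +oo[%classic); last first.
    by apply/seteqP; split => x /=; rewrite inE.
  by apply: closed_comp => [x _|]; [exact: cuv|exact: rray_closed].
- apply: (@subspace_eq_continuous _ _ _ f); last exact: continuous_subspaceT.
  move=> x; rewrite !inE /= !inE /= in_itv /= subr_le0 => uv.
  by rewrite /from_subspace /= uv.
- apply: (@subspace_eq_continuous _ _ _ g); last exact: continuous_subspaceT.
  move=> x; rewrite !inE /= !inE /= in_itv /= andbT subr_ge0 => vu.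
  by rewrite /from_subspace /=; case: ifPn => // uv; apply/esym/fg/eqP; rewrite eq_le uv vu.
Qed.

End pasting.


Section path_homotopy.
Context {R : realType} {T : topologicalType}.
Local Notation I := (unit_interval R).
Implicit Types (f g h : I -> T).

(* Homotopy relative to the endpoints. *)
Definition path_homotopic f g : Prop :=
  exists H : I * I -> T,
    [/\ continuous H,
        (forall t, H (t, zero) = f t) /\ (forall t, H (t, one) = g t),
        forall s, H (zero, s) = f zero &
        forall s, H (one, s) = f one].

Definition path_cat f g (t : I) : T :=
  if of_itv t <= 2^-1 then f (to_itv (2 * of_itv t))
  else g (to_itv (2 * of_itv t - 1)).

Definition path_rev f (t : I) : T := f (to_itv (1 - of_itv t)).

Lemma path_homotopic_ends f g :
  path_homotopic f g -> f zero = g zero /\ f one = g one.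
Proof. by case=> H [_ [_ H1] H0s H1s]; rewrite -(H0s one) -(H1s one) !H1. Qed.

Lemma itv_comp_continuous {X : topologicalType} f (u : X -> R) :
  continuous f -> continuous u -> continuous (fun x => f (to_itv (u x))).
Proof.
by move=> cf cu; cts.
Qed.

Lemma path_reparam f (u v : I -> R) : continuous f ->
  continuous u -> continuous v -> u zero = v zero -> u one = v one ->
  path_homotopic (fun t => f (to_itv (u t))) (fun t => f (to_itv (v t))).
Proof.
move=> cf cu cv uv0 uv1.
exists (fun x => f (to_itv ((1 - of_itv x.2) * u x.1 + of_itv x.2 * v x.1))).
split.
- by cts.
- split=> t /=; rewrite ?of_itv0 ?of_itv1; congr (f (to_itv _)); lra.
- by move=> s /=; rewrite uv0; congr (f (to_itv _)); lra.
- by move=> s /=; rewrite uv1; congr (f (to_itv _)); lra.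
Qed.

Lemma path_homotopic_refl f : continuous f -> path_homotopic f f.
Proof.
move=> cf; exists (fun x => f x.1); split=> //.
by cts.
Qed.

Lemma path_homotopic_sym f g : path_homotopic f g -> path_homotopic g f.
Proof.
move=> fg; have [fg0 fg1] := path_homotopic_ends fg.
case: fg => H [cH [H0 H1] H0s H1s].
exists (fun x => H (x.1, to_itv (1 - of_itv x.2))); split.
- by cts.
- split=> t /=.
    by rewrite of_itv0 subr0 to_itv_ge1.
  by rewrite of_itv1 subrr to_itv_le0.
- by move=> s; rewrite H0s fg0.
- by move=> s; rewrite H1s fg1.
Qed.

Lemma path_homotopic_trans f g h :
  path_homotopic f g -> path_homotopic g h -> path_homotopic f h.
Proof.
move=> fg gh; have [fg0 fg1] := path_homotopic_ends fg.
case: fg gh => H [cH [H0 H1] H0s H1s] [K [cK [K0 K1] K0s K1s]].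
exists (fun x => if of_itv x.2 <= 2^-1 then H (x.1, to_itv (2 * of_itv x.2))
                 else K (x.1, to_itv (2 * of_itv x.2 - 1))).
split.
- apply: pasting_continuous; [by cts..|].
  move=> x -> /=; rewrite to_itv_ge1; last lra.
  by rewrite to_itv_le0; [rewrite H1 K0|lra].
- split=> t /=.
    by rewrite of_itv0 ifT; [rewrite to_itv_le0 ?H0//; lra|lra].
  rewrite of_itv1 ifF; last by apply/negbTE; rewrite -ltNge; lra.
  by rewrite to_itv_ge1 ?K1//; lra.
- by move=> s /=; case: ifP => _; rewrite ?H0s ?K0s ?fg0.
- by move=> s /=; case: ifP => _; rewrite ?H1s ?K1s ?fg1.
Qed.

Lemma path_cat0 f g : path_cat f g zero = f zero.
Proof. by rewrite /path_cat of_itv0 ifT; [rewrite to_itv_le0//; lra|lra]. Qed.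

Lemma path_cat1 f g : path_cat f g one = g one.
Proof.
rewrite /path_cat of_itv1 ifF; last by apply/negbTE; rewrite -ltNge; lra.
by rewrite to_itv_ge1//; lra.
Qed.

Lemma path_cat_continuous f g : continuous f -> continuous g ->
  f one = g zero -> continuous (path_cat f g).
Proof.
move=> cf cg fg; rewrite /path_cat.
apply: pasting_continuous; [by cts..|].
move=> x ->; rewrite to_itv_ge1 /=; last lra.
by rewrite to_itv_le0 //; lra.
Qed.

Lemma path_rev_continuous f : continuous f -> continuous (path_rev f).
Proof.
by move=> cf; rewrite /path_rev; cts.
Qed.

Lemma path_rev0 f : path_rev f zero = f one.
Proof. by rewrite /path_rev of_itv0 subr0 to_itv_ge1. Qed.

Lemma path_rev1 f : path_rev f one = f zero.
Proof. by rewrite /path_rev of_itv1 subrr to_itv_le0. Qed.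

Lemma path_cat_homotopic f f' g g' : f one = g zero ->
  path_homotopic f f' -> path_homotopic g g' ->
  path_homotopic (path_cat f g) (path_cat f' g').
Proof.
move=> fg [H [cH [H0 H1] H0s H1s]] [K [cK [K0 K1] K0s K1s]].
exists (fun x => if of_itv x.1 <= 2^-1 then H (to_itv (2 * of_itv x.1), x.2)
                 else K (to_itv (2 * of_itv x.1 - 1), x.2)).
split.
- apply: pasting_continuous; [by cts..|].
  move=> x -> /=; rewrite to_itv_ge1; last lra.
  by rewrite to_itv_le0; [rewrite H1s K0s|lra].
- by split=> t; rewrite /path_cat /= ?H0 ?H1 ?K0 ?K1.
- move=> s; rewrite path_cat0 /= of_itv0 ifT; last lra.
  by rewrite to_itv_le0 ?H0s//; lra.
- move=> s; rewrite path_cat1 /= of_itv1 ifF; last first.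
    by apply/negbTE; rewrite -ltNge; lra.
  by rewrite to_itv_ge1 ?K1s//; lra.
Qed.

Lemma path_rev_homotopic f g :
  path_homotopic f g -> path_homotopic (path_rev f) (path_rev g).
Proof.
move=> [H [cH [H0 H1] H0s H1s]].
exists (fun x => H (to_itv (1 - of_itv x.1), x.2)); split.
- by cts.
- by split=> t; rewrite /path_rev.
- by move=> s; rewrite path_rev0 /= of_itv0 subr0 to_itv_ge1.
- by move=> s; rewrite path_rev1 /= of_itv1 subrr to_itv_le0.
Qed.

Lemma path_homotopic_reparam f g (u v : I -> R) : continuous f ->
  continuous u -> continuous v -> u zero = v zero -> u one = v one ->
  (forall t, g t = f (to_itv (u t))) ->
  path_homotopic g (fun t => f (to_itv (v t))).
Proof.
by move=> cf cu cv uv0 uv1 /funext ->; exact: path_reparam.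
Qed.

Lemma path_catA f g h : continuous f -> continuous g -> continuous h ->
  f one = g zero -> g one = h zero ->
  path_homotopic (path_cat (path_cat f g) h) (path_cat f (path_cat g h)).
Proof.
move=> cf cg ch fg gh.
pose u t : R := Num.min (2 * of_itv t)
  (Num.min (of_itv t + 4^-1) (2^-1 * of_itv t + 2^-1)).
rewrite (_ : path_cat f (path_cat g h) = fun t => path_cat f (path_cat g h) (to_itv (of_itv t))); last first.
  by apply/funext => t; rewrite of_itvK.
apply: (path_homotopic_reparam (u := u)).
- by apply: path_cat_continuous => //; [exact: path_cat_continuous|rewrite path_cat0].
- by rewrite /u; cts.
- by cts.
- by rewrite /u of_itv0 mulr0 !add0r min_l// le_min; apply/andP; split; lra.
- rewrite /u of_itv1 (min_r (x := 1 + 4^-1)); last lra.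
  by rewrite min_r; lra.
move=> t; have /andP[t0 t1] := of_itvP t.
have [t4|t4] := leP (of_itv t) 4^-1.
  have -> : u t = 2 * of_itv t.
    by rewrite /u min_l// le_min; apply/andP; split; lra.
  rewrite /path_cat (to_itvE (r := 2 * of_itv t)); last by apply/andP; split; lra.
  by rewrite !ifT//; lra.
have [t2|t2] := leP (of_itv t) 2^-1.
  have -> : u t = of_itv t + 4^-1.
    rewrite /u (min_l (x := of_itv t + 4^-1)); last lra.
    by rewrite min_r//; lra.
  rewrite /path_cat (to_itvE (r := 2 * of_itv t)); last by apply/andP; split; lra.
  rewrite (to_itvE (r := of_itv t + 4^-1)); last by apply/andP; split; lra.
  rewrite ifT// ifF; last by apply/negbTE; rewrite -ltNge; lra.
  rewrite ifF; last by apply/negbTE; rewrite -ltNge; lra.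
  rewrite to_itvE; last by apply/andP; split; lra.
  by rewrite ifT; [congr (g (to_itv _)); lra|lra].
have -> : u t = 2^-1 * of_itv t + 2^-1.
  rewrite /u (min_r (x := of_itv t + 4^-1)); last lra.
  by rewrite min_r//; lra.
rewrite /path_cat (to_itvE (r := 2^-1 * of_itv t + 2^-1)); last by apply/andP; split; lra.
rewrite ifF; last by apply/negbTE; rewrite -ltNge; lra.
rewrite ifF; last by apply/negbTE; rewrite -ltNge; lra.
rewrite to_itvE; last by apply/andP; split; lra.
rewrite ifF; last by apply/negbTE; rewrite -ltNge; lra.
by congr (h (to_itv _)); lra.
Qed.

Lemma path_cat_cstl f : continuous f ->
  path_homotopic (path_cat (cst (f zero)) f) f.
Proof.
move=> cf; rewrite [X in path_homotopic _ X](_ : f = fun t => f (to_itv (of_itv t))); last first.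
  by apply/funext => t; rewrite of_itvK.
apply: (path_homotopic_reparam (u := fun t => Num.max 0 (2 * of_itv t - 1))) => //.
- by cts.
- by cts.
- by rewrite of_itv0 max_l//; lra.
- by rewrite of_itv1 max_r; lra.
move=> t; rewrite /path_cat; case: leP => t2.
  by rewrite max_l ?(to_itv_le0 (r := 0))//; lra.
by rewrite max_r//; lra.
Qed.

Lemma path_cat_cstr f : continuous f ->
  path_homotopic (path_cat f (cst (f one))) f.
Proof.
move=> cf; rewrite [X in path_homotopic _ X](_ : f = fun t => f (to_itv (of_itv t))); last first.
  by apply/funext => t; rewrite of_itvK.
apply: (path_homotopic_reparam (u := fun t => Num.min 1 (2 * of_itv t))) => //.
- by cts.
- by cts.
- by rewrite of_itv0 min_r//; lra.
- by rewrite of_itv1 min_l//; lra.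
move=> t; rewrite /path_cat; case: leP => t2.
  by rewrite min_r//; lra.
by rewrite min_l ?(to_itv_ge1 (r := 1))//; lra.
Qed.

Lemma path_cat_revr f : continuous f ->
  path_homotopic (path_cat f (path_rev f)) (cst (f zero)).
Proof.
move=> cf.
rewrite (_ : cst (f zero) = fun t : I => f (to_itv (cst 0 t))); last first.
  by apply/funext => t; rewrite to_itv_le0.
apply: (path_homotopic_reparam (u := fun t => Num.min (2 * of_itv t) (2 - 2 * of_itv t))) => //.
- by cts.
- by cts.
- by rewrite of_itv0 min_l//=; lra.
- by rewrite of_itv1 min_r//=; lra.
move=> t; have /andP[t0 t1] := of_itvP t.
rewrite /path_cat /path_rev; case: leP => t2.
  by rewrite min_l//; lra.
rewrite min_r; last lra.
by rewrite to_itvE; [congr (f (to_itv _)); lra|apply/andP; split; lra].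
Qed.

Lemma path_cat_revl f : continuous f ->
  path_homotopic (path_cat (path_rev f) f) (cst (f one)).
Proof.
move=> cf.
rewrite (_ : cst (f one) = fun t : I => f (to_itv (cst 1 t))); last first.
  by apply/funext => t; rewrite to_itv_ge1.
apply: (path_homotopic_reparam (u := fun t => Num.max (1 - 2 * of_itv t) (2 * of_itv t - 1))) => //.
- by cts.
- by cts.
- by rewrite of_itv0 max_l//=; lra.
- by rewrite of_itv1 max_r//=; lra.
move=> t; have /andP[t0 t1] := of_itvP t.
rewrite /path_cat /path_rev; case: leP => t2.
  rewrite max_l; last lra.
  by rewrite to_itvE //; apply/andP; split; lra.
by rewrite max_r//; lra.
Qed.

End path_homotopy.

Section fundamental_group.
Context (R : realType) (T : topologicalType) (x0 : T).
Local Notation I := (unit_interval R).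

Definition loop : Type := {path I from x0 to x0 in T}.

HB.instance Definition _ := Choice.on loop.

Definition loop_homotopic (p q : loop) : bool := `[< path_homotopic p q >].

Lemma loop_continuous (p : loop) : continuous p.
Proof. exact: cts_fun. Qed.

Lemma loop_homotopic_equiv : equiv_class_of loop_homotopic.
Proof.
split=> [p|p q|q p r].
- by apply/asboolP/path_homotopic_refl; exact: loop_continuous.
- by apply/asboolP/asboolP; exact: path_homotopic_sym.
- by move=> /asboolP pq /asboolP qr; exact/asboolP/(path_homotopic_trans pq qr).
Qed.

Canonical loop_homotopic_equiv_rel := EquivRelPack loop_homotopic_equiv.

Definition loop_cst : loop := cst x0.

Lemma loop_cat_continuous (p q : loop) : continuous (path_cat p q).
Proof.
by apply: path_cat_continuous; rewrite ?path_one ?path_zero //;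
  exact: loop_continuous.
Qed.

Lemma loop_cat0 (p q : loop) : path_cat p q zero = x0.
Proof. by rewrite path_cat0 path_zero. Qed.

Lemma loop_cat1 (p q : loop) : path_cat p q one = x0.
Proof. by rewrite path_cat1 path_one. Qed.

Definition loop_cat (p q : loop) : loop :=
  mk_path (@loop_cat_continuous p q) (loop_cat0 p q) (loop_cat1 p q).

Lemma loop_rev_continuous (p : loop) : continuous (path_rev p).
Proof. by apply: path_rev_continuous; exact: loop_continuous. Qed.

Lemma loop_rev0 (p : loop) : path_rev p zero = x0.
Proof. by rewrite path_rev0 path_one. Qed.

Lemma loop_rev1 (p : loop) : path_rev p one = x0.
Proof. by rewrite path_rev1 path_zero. Qed.

Definition loop_rev (p : loop) : loop :=
  mk_path (@loop_rev_continuous p) (loop_rev0 p) (loop_rev1 p).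

Definition fundamental_group : Type := {eq_quot loop_homotopic}.

HB.instance Definition _ := Choice.on fundamental_group.
HB.instance Definition _ := EqQuotient.on fundamental_group.

Definition homotopy_class (p : loop) : fundamental_group :=
  \pi_({eq_quot loop_homotopic}) p.

Lemma homotopy_classP (p q : loop) :
  homotopy_class p = homotopy_class q <-> path_homotopic p q.
Proof. by split=> [/eqmodP/asboolP|pq]; last exact/eqmodP/asboolP. Qed.

Lemma homotopy_class_surj (a : fundamental_group) :
  homotopy_class (repr (a : {eq_quot loop_homotopic})) = a.
Proof. exact: reprK. Qed.

Let rep (a : fundamental_group) : loop := repr (a : {eq_quot loop_homotopic}).

Definition fg_one : fundamental_group := homotopy_class loop_cst.
Definition fg_mul (a b : fundamental_group) : fundamental_group :=
  homotopy_class (loop_cat (rep a) (rep b)).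
Definition fg_inv (a : fundamental_group) : fundamental_group :=
  homotopy_class (loop_rev (rep a)).

Lemma loop_ends (p q : loop) : p one = q zero.
Proof. by rewrite path_one path_zero. Qed.

Lemma fg_mulE p q :
  fg_mul (homotopy_class p) (homotopy_class q) = homotopy_class (loop_cat p q).
Proof.
apply/homotopy_classP; apply: path_cat_homotopic; first exact: loop_ends.
  exact/homotopy_classP/homotopy_class_surj.
exact/homotopy_classP/homotopy_class_surj.
Qed.

Lemma fg_invE p : fg_inv (homotopy_class p) = homotopy_class (loop_rev p).
Proof.
apply/homotopy_classP; apply: path_rev_homotopic.
exact/homotopy_classP/homotopy_class_surj.
Qed.

Lemma fg_mulA : associative fg_mul.
Proof.
move=> a b c; rewrite -(homotopy_class_surj a) -(homotopy_class_surj b).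
rewrite -(homotopy_class_surj c) !fg_mulE; apply/homotopy_classP.
apply: path_homotopic_sym; apply: path_catA;
  by [exact: loop_continuous|exact: loop_ends].
Qed.

Lemma fg_mul1 : left_id fg_one fg_mul.
Proof.
move=> a; rewrite -(homotopy_class_surj a) fg_mulE; apply/homotopy_classP.
by have := path_cat_cstl (@loop_continuous (rep a)); rewrite path_zero.
Qed.

Lemma fg_mulr1 : right_id fg_one fg_mul.
Proof.
move=> a; rewrite -(homotopy_class_surj a) fg_mulE; apply/homotopy_classP.
by have := path_cat_cstr (@loop_continuous (rep a)); rewrite path_one.
Qed.

Lemma fg_mulV : left_inverse fg_one fg_inv fg_mul.
Proof.
move=> a; rewrite -(homotopy_class_surj a) fg_invE fg_mulE.
apply/homotopy_classP.
by have := path_cat_revl (@loop_continuous (rep a)); rewrite path_one.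
Qed.

Lemma fg_mulrV : right_inverse fg_one fg_inv fg_mul.
Proof.
move=> a; rewrite -(homotopy_class_surj a) fg_invE fg_mulE.
apply/homotopy_classP.
by have := path_cat_revr (@loop_continuous (rep a)); rewrite path_zero.
Qed.

HB.instance Definition _ :=
  isGroup.Build fundamental_group fg_mulA fg_mul1 fg_mulr1 fg_mulV fg_mulrV.

Lemma homotopy_class1 : homotopy_class loop_cst = 1%g.
Proof. by []. Qed.

Lemma homotopy_classM p q :
  homotopy_class (loop_cat p q) = (homotopy_class p * homotopy_class q)%g.
Proof. exact/esym/fg_mulE. Qed.

Lemma homotopy_classV p : homotopy_class (loop_rev p) = ((homotopy_class p)^-1)%g.
Proof. exact/esym/fg_invE. Qed.

End fundamental_group.

Section closed_braids.
Context (R : realType).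

(* S^3 is the unit sphere of C^2, a point (z, u) of C^2 being written
   ((Re z, Im z), (Re u, Im u)). *)
Definition S3 : set ((R * R) * (R * R)) :=
  [set p | p.1.1 ^+ 2 + p.1.2 ^+ 2 + p.2.1 ^+ 2 + p.2.2 ^+ 2 = 1].

(* The points of C occupied at time t by the strands of sigma_i, 1 <= i < n, on n
   strands; these start and end at the points 1, ..., n of the real axis, and
   the two strands at i and i + 1 make a counterclockwise half-turn about their
   midpoint. *)
Definition crossing (n i : nat) (t : R) : set (R * R) :=
  [set z | (exists2 j : nat, [&& 1 <= j, j <= n, j != i & j != i.+1]%N &
              z = (j%:R, 0)) \/
           z = (i%:R + 2^-1 + 2^-1 * cos (pi * t), 2^-1 * sin (pi * t)) \/
           z = (i%:R + 2^-1 - 2^-1 * cos (pi * t), - (2^-1 * sin (pi * t)))].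

(* The points occupied at time t in [0, 1] by the strands of the positive braid
   sigma_{i_1} ... sigma_{i_k} on n strands, w = [:: i_1; ...; i_k]; products of
   braids are juxtaposed in time. *)
Fixpoint geometric_braid (n : nat) (w : seq nat) (t : R) : set (R * R) :=
  if w is i :: w' then
    if t <= 2^-1 then crossing n i (2 * t)
    else geometric_braid n w' (2 * t - 1)
  else [set z | exists2 j : nat, (1 <= j <= n)%N & z = (j%:R, 0)].

(* Embeds the open solid torus C x S^1 in S^3; the complement of the image is the
   braid axis, the circle u = 0. *)
Definition solid_torus_embedding (z u : R * R) : (R * R) * (R * R) :=
  let r := Num.sqrt (1 + z.1 ^+ 2 + z.2 ^+ 2) in
  ((z.1 / r, z.2 / r), (u.1 / r, u.2 / r)).

Definition braid_closure (n : nat) (w : seq nat) : set ((R * R) * (R * R)) :=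
  [set p | exists t z, [/\ 0 <= t <= 1, geometric_braid n w t z &
     p = solid_torus_embedding z (cos (2 * pi * t), sin (2 * pi * t))]].

(* (sigma_1 ... sigma_{P-1})^Q sigma_1^{2s}, as a list of 1-based indices. *)
Definition twisted_torus_word (P Q s : nat) : seq nat :=
  flatten (nseq Q (iota 1 P.-1)) ++ nseq s.*2 1%N.

Definition twisted_torus_knot (P Q s : nat) : set ((R * R) * (R * R)) :=
  braid_closure P (twisted_torus_word P Q s).

Definition axis_point : (R * R) * (R * R) := ((1, 0), (0, 0)).

Lemma axis_point_complement n w : axis_point \in S3 `\` braid_closure n w.
Proof.
rewrite inE; split; first by rewrite /S3 /= expr1n expr0n /= !addr0.
move=> [t [z [_ _ [_ _ c0 s0]]]].
have r0 : Num.sqrt (1 + z.1 ^+ 2 + z.2 ^+ 2) != 0.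
  rewrite sqrtr_eq0 -ltNge; have := sqr_ge0 z.1; have := sqr_ge0 z.2.
  by move=> ? ?; lra.
have := cos2Dsin2 (2 * pi * t : R).
move/eqP: c0; rewrite eq_sym mulf_eq0 invr_eq0 (negbTE r0) orbF => /eqP ->.
move/eqP: s0; rewrite eq_sym mulf_eq0 invr_eq0 (negbTE r0) orbF => /eqP ->.
by rewrite expr0n /= addr0 => /eqP; rewrite eq_sym oner_eq0.
Qed.

Definition knot_group (K : set ((R * R) * (R * R))) (x : (S3 `\` K : Type)) :
  groupType := fundamental_group R x.

Definition twisted_torus_base (P Q s : nat) : S3 `\` twisted_torus_knot P Q s :=
  exist _ axis_point (axis_point_complement P (twisted_torus_word P Q s)).

Definition twisted_torus_knot_group (P Q s : nat) : groupType :=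
  knot_group (twisted_torus_base P Q s).

End closed_braids.

(* Main.v *)
(* Cutting the page of the braid axis at a given angle along vertical lines, the
   loops y_k (base point at +infinity, down to -i infinity, up through the gap to
   the right of the k-th strand, back from +i infinity) are elements of the knot group;
   a crossing sigma_i only changes y_i, into y_{i+1} y_i^-1 y_{i-1}.  The relation
   is seen by following, through the crossing, a lasso around the lower strand.
   Since the braid closes up, the y_k are fixed by the whole braid word.

   For (sigma_1 sigma_2 sigma_3 sigma_4)^3 sigma_1^{2s} this gives, with
   c = y_2 y_0^-1 and u = y_2 c^-(s+1),
       u^2 = c u c^{s+1} u c u c^{s+1} u c,
   a relation W = 1 where W = c u c^{s+1} u c u c^{s+1} u c u^-2 is positive in c.
   Hence 1 = [W, u] is a product of conjugates of g = [c, u].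

   That g is not trivial is detected by an affine representation: c acts as
   z |-> t^-2 z and u as z |-> t^(2s+5) z + 1, for a root t other than 1 and -1 of
   t^(2s+9) - t^(2s+7) + t^(2s+6) + t^3 - t^2 + 1.  It is realized as the holonomy
   of a local system on the complement, with three charts: the points with no
   strand below them (A), those with no strand above them (B), and, during a
   crossing, those at a height between the two crossing strands (C). *)

From HB Require Import structures.
From mathcomp Require Import all_boot all_order all_algebra all_field.
From mathcomp Require Import all_classical all_reals all_analysis.
From mathcomp Require Import zify homotopy ring lra.
Require Import Defs.
Set Implicit Arguments.
Unset Strict Implicit.
Unset Printing Implicit Defensive.

(** * Group theory *)

(** No presentation of the knot group is computed. A single relation, obtained from explicit
    homotopies, yields the product of conjugates; non-triviality needs a representation of the
    actual fundamental group, hence a local system on the complement itself. The exponents of t come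
    from abelianising the relator: with m = s + 1 it becomes c^(2m+3) u^2, and c = t^-2, u =
    t^(2m+3) is the general solution. Once these are the multipliers and c has no translation part,
    the relation is one scalar equation, the vanishing of the stated polynomial. The values 1 and -1
    of t are excluded because c would act trivially. Two obstacles shape the local system. The page
    angle is not a function on the complement: 0 and 1 coincide, and on the axis every angle is
    allowed. And in the middle of a crossing the two strands are aligned: the gap between them is
    closed, and a point between them has a strand above and a strand below, so that neither A nor B
    contains it. *)

Section free_reduction.
Local Open Scope group_scope.
Variable G : groupType.

(** Syntax for proving by computation the identities that hold in a free group: both sides are
    reduced to words in their atoms and compared. *)
Inductive gterm := GAtom of nat | GOne | GMul of gterm & gterm | GInv of gterm.

Fixpoint gterm_eval (e : seq G) t : G :=
  match t with
  | GAtom n => nth 1 e n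
  | GOne => 1
  | GMul a b => gterm_eval e a * gterm_eval e b
  | GInv a => (gterm_eval e a)^-1
  end.

Definition letter_eval (e : seq G) (l : bool * nat) : G :=
  if l.1 then (nth 1 e l.2)^-1 else nth 1 e l.2.

Fixpoint letters_eval (e : seq G) ls : G :=
  if ls is l :: ls' then letter_eval e l * letters_eval e ls' else 1.

Definition letter_cons (l : bool * nat) ls :=
  if ls is l' :: ls' then
    if (l'.2 == l.2) && (l'.1 != l.1) then ls' else l :: ls
  else [:: l].

(** [ls] accumulates the word to the right, and [inverse] tells whether the term or its inverse is
    being read; letters cancel as they are pushed. *)
Fixpoint free_reduce t (inverse : bool) ls : seq (bool * nat) :=
  match t with
  | GAtom n => letter_cons (inverse, n) ls
  | GOne => ls
  | GMul a b => if inverse then free_reduce b true (free_reduce a true ls)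
                else free_reduce a false (free_reduce b false ls)
  | GInv a => free_reduce a (~~ inverse) ls
  end.

Lemma letter_consE e l ls :
  letters_eval e (letter_cons l ls) = letter_eval e l * letters_eval e ls.
Proof.
case: ls => [|l' ls] //=; case: ifPn => // /andP[/eqP E1 E2].
move: E2; rewrite /letter_eval E1; case: (l'.1); case: (l.1) => //= _.
  by rewrite mulVKg.
by rewrite mulKg.
Qed.

Lemma free_reduceE e t b ls : letters_eval e (free_reduce t b ls) =
  (if b then (gterm_eval e t)^-1 else gterm_eval e t) * letters_eval e ls.
Proof.
elim: t b ls => [n|//|a IHa c IHc|a IHa] b ls /=.
- by rewrite letter_consE.
- by case: b; rewrite ?invg1 mul1g.
- by case: b; rewrite IHa IHc ?invgM mulgA || rewrite IHc IHa ?invgM mulgA.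
- by rewrite IHa; case: b => //=; rewrite invgK.
Qed.

Lemma free_reduceP e t1 t2 :
  free_reduce t1 false [::] = free_reduce t2 false [::] ->
  gterm_eval e t1 = gterm_eval e t2.
Proof.
move=> /(congr1 (letters_eval e)); rewrite !free_reduceE /=.
by rewrite !mulg1.
Qed.

End free_reduction.

Ltac env_index x e :=
  lazymatch e with
  | x :: _ => constr:(0%N)
  | _ :: ?e' => let n := env_index x e' in constr:(S n)
  end.

Ltac env_add x e :=
  match e with
  | _ => let n := env_index x e in e
  | _ => constr:(x :: e)
  end.

Ltac group_atoms x e :=
  lazymatch x with
  | (?a * ?b)%g => let e1 := group_atoms a e in group_atoms b e1
  | (?a ^-1)%g => group_atoms a e
  | 1%g => e
  | _ => env_add x e
  end.

Ltac group_reify x e :=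
  lazymatch x with
  | (?a * ?b)%g =>
      let ta := group_reify a e in let tb := group_reify b e in
      constr:(GMul ta tb)
  | (?a ^-1)%g => let ta := group_reify a e in constr:(GInv ta)
  | 1%g => constr:(GOne)
  | _ => let n := env_index x e in constr:(GAtom n)
  end.

(** Whatever is not a product, an inverse or 1 is an atom. Powers are therefore opaque, and are
    split or commuted by hand before each call. *)
Ltac group_word :=
  lazymatch goal with |- @eq ?G ?x ?y =>
    let T := type of x in
    let e := group_atoms x (@nil T) in
    let e := group_atoms y e in
    let tx := group_reify x e in
    let ty := group_reify y e in
    refine (@free_reduceP _ e tx ty _); vm_compute; exact: erefl
  end.

(** * The Artin action on gap loops, and the tuples fixed by the braid word *)

Section artin_action.
Local Open Scope group_scope.
Variable G : groupType.
Implicit Types (y : nat -> G) (w : seq nat).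

(** Expresses the gap loops before a crossing through those after it. The lower strand moves from
    place i to place i + 1 and keeps its lasso: y_i y_(i-1)^-1 before equals y_(i+1) y_i^-1 after,
    which is solved for y_i. Consequently [artin_word] is a right fold, the last letter acting
    first. *)
Definition artin (i : nat) y (k : nat) : G :=
  if k == i then y i.+1 * (y i)^-1 * y i.-1 else y k.

Definition artin_word w y : nat -> G := foldr artin y w.

Lemma artin_word_cat w1 w2 y :
  artin_word (w1 ++ w2) y = artin_word w1 (artin_word w2 y).
Proof. exact: foldr_cat. Qed.

(** Applying sigma_1 twice sends y_1 to (y_2 y_0^-1) y_1 (y_0^-1 y_2)^-1 and leaves y_0 and y_2
    alone, so the twists pile up as powers on the two sides. *)
Lemma artin_full_twists s y k : artin_word (nseq s.*2 1%N) y k =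
  if k == 1%N then (y 2 * (y 0)^-1) ^+ s * y 1%N * ((y 0)^-1 * y 2) ^- s else y k.
Proof.
elim: s k => [|s IH] k.
  by rewrite /artin_word /= !expg0 invg1 mulg1 mul1g; case: eqP => // ->.
rewrite doubleS -[nseq _.+2 _]/([:: 1; 1]%N ++ nseq s.*2 1%N) artin_word_cat.
case: (eqVneq k 1%N) => [->|k1]; last by rewrite /= /artin !ifN_eq// IH ifN_eq.
rewrite [LHS]/= /artin /= /artin /= !IH /= !(expgS _ s).
by move: (_ ^+ s) ((_ * _) ^+ s) => p q; group_word.
Qed.

(** One round of sigma_1 ... sigma_4 shifts the inner indices by one and multiplies on the left by
    z_5 z_4^-1; this keeps the threefold iterate short. *)
Lemma artin_iota z (z' := artin_word (iota 1 4) z) :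
  [/\ z' 0 = z 0, z' 1%N = z 5 * (z 4)^-1 * z 0, z' 2 = z 5 * (z 4)^-1 * z 1%N &
  [/\ z' 3 = z 5 * (z 4)^-1 * z 2, z' 4 = z 5 * (z 4)^-1 * z 3 & z' 5 = z 5]].
Proof. by split; last split; rewrite /z' /artin_word /= /artin /=; group_word. Qed.

Lemma artin_torus_word z : z 5 = 1 ->
  let z' := artin_word (flatten (nseq 3 (iota 1 4))) z in
  [/\ z' 0 = z 0, z' 1%N = (z 2)^-1 * z 3 * z 0, z' 2 = (z 2)^-1 * z 4 * z 0 &
  [/\ z' 3 = (z 2)^-1 * z 0, z' 4 = (z 2)^-1 * z 1%N & z' 5 = 1]].
Proof.
move=> z5 w'; rewrite {}/w' (_ : flatten _ = iota 1 4 ++ iota 1 4 ++ iota 1 4)//.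
rewrite !artin_word_cat.
have [] := artin_iota z; move: (artin_word _ z) => x.
move=> x0 x1 x2 [x3 x4 x5].
have [] := artin_iota x; move: (artin_word _ x) => y.
rewrite x0 x1 x2 x3 x4 x5 z5 => y0 y1 y2 [y3 y4 y5].
have [] := artin_iota y; move: (artin_word _ y) => z'.
rewrite y0 y1 y2 y3 y4 y5 => -> -> -> [-> -> ->].
by split; last split; group_word.
Qed.

(** With a = y_2 and b = y_0, the fixed-point equations at 1, 2 and 3 give y_1, y_4 and y_3 in terms
    of a and b. The one at 4, where alone the twists enter, is then a relation between a and b,
    rewritten by b = c^-1 a and a = u c^(s+1). *)
Lemma twisted_torus_relation s y : y 5 = 1 ->
  (forall k, (k <= 5)%N -> artin_word (twisted_torus_word 5 3 s) y k = y k) ->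
  let c := y 2 * (y 0)^-1 in let u := y 2 * c ^- s.+1 in
  u * u = c * u * c ^+ s.+1 * u * c * u * c ^+ s.+1 * u * c.
Proof.
move=> y5 yE c u; set E := c ^+ s.
have cE : c ^+ s.+1 = c * E by rewrite expgS.
have Ec : c * E = E * c by rewrite -expgS expgSr.
pose z := artin_word (nseq s.*2 1%N) y.
have zE k : k != 1%N -> z k = y k.
  by move=> k1; rewrite /z artin_full_twists ifN_eq.
have [] := artin_torus_word (z := z); first by rewrite zE.
rewrite /z -artin_word_cat !yE// -/z (zE 0)// (zE 2)// (zE 3)// (zE 4)// => _ y1 y2 [y3 y4 _].
have z1 : z 1%N = E * y 1%N * ((y 0)^-1 * y 2) ^- s.
  by rewrite /z artin_full_twists.
(* The right-hand twist factor y_0^-1 y_2 is the conjugate of [c] by y_0, so only powers of [c]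
   remain. *)
have dE : ((y 0)^-1 * y 2) ^+ s = (y 0)^-1 * E * y 0.
  rewrite (_ : (y 0)^-1 * y 2 = c ^ y 0) -?conjXg ?conjgE /c; last first.
    by group_word.
  by rewrite !mulgA.
have bE : y 0 = c^-1 * y 2 by rewrite /c; group_word.
have y4' : y 4 = y 2 * y 2 * (y 0)^-1.
  transitivity (y 2 * ((y 2)^-1 * y 4 * y 0) * (y 0)^-1); first by group_word.
  by rewrite -y2; group_word.
move: y4; rewrite z1 dE y1 y3 y4' bE => H.
have {}H : y 2 * y 2 =
    E * (y 2)^-1 * (y 2)^-1 * c^-1 * y 2 * E^-1 * c^-1 * y 2 * c^-1.
  transitivity (y 2 * (y 2 * y 2 * (c^-1 * y 2)^-1) * c^-1); first by group_word.
  by rewrite H; group_word.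
have aE : y 2 = u * c * E by rewrite /u cE; group_word.
have aE' : y 2 = u * E * c by rewrite aE -mulgA Ec mulgA.
have aaE : y 2 * y 2 * E^-1 = u * (c * E) * u * c.
  by rewrite [X in _ * X * _]aE [X in X * _ * _]aE; group_word.
have uuE : u * u = u * y 2 * c^-1 * E^-1 by rewrite aE'; group_word.
have uaE : u * y 2 = y 2 * E^-1 * c^-1 * y 2.
  by congr (_ * _); rewrite aE; group_word.
rewrite uuE uaE cE.
transitivity (c * y 2 * y 2 * E^-1 *
  (E * (y 2)^-1 * (y 2)^-1 * c^-1 * y 2 * E^-1 * c^-1 * y 2 * c^-1) * E^-1).
  by group_word.
rewrite -H; transitivity (c * (y 2 * y 2 * E^-1) * (y 2 * y 2 * E^-1)).
  by group_word.
by rewrite aaE; group_word.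
Qed.

(** The elimination run backwards: y_2 = a, y_0 = b, and the other entries are those forced by the
    fixed-point equations. It turns a pair satisfying the relation in any group into a tuple fixed
    by the braid word, the input of the local system. *)
Definition twisted_torus_solution (c u : G) s (k : nat) : G :=
  let a := u * c ^+ s.+1 in let b := c^-1 * a in
  nth 1 [:: b; a^-1 * a^-1 * b * b; a; a^-1 * b; a * a * b^-1; 1] k.

Lemma twisted_torus_solutionP s c u k :
  u * u = c * u * c ^+ s.+1 * u * c * u * c ^+ s.+1 * u * c -> (k <= 5)%N ->
  artin_word (twisted_torus_word 5 3 s) (twisted_torus_solution c u s) k =
  twisted_torus_solution c u s k.
Proof.
set y := twisted_torus_solution c u s => H k5.
pose z := artin_word (nseq s.*2 1%N) y.
have zE k' : k' != 1%N -> z k' = y k'.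
  by move=> k1; rewrite /z artin_full_twists ifN_eq.
have [] := artin_torus_word (z := z); first by rewrite zE.
rewrite /z -artin_word_cat -/z (zE 0)// (zE 2)// (zE 3)// (zE 4)//.
move=> y0 y1 y2 [y3 y4 y5].
set a := u * c ^+ s.+1; set b := c^-1 * a; set E := c ^+ s.
have cE : c ^+ s.+1 = c * E by rewrite expgS.
have Ec : c * E = E * c by rewrite -expgS expgSr.
have aE : a = u * c * E by rewrite /a cE mulgA.
have aE' : a = u * E * c by rewrite aE -mulgA Ec mulgA.
have z1 : z 1%N = E * (a^-1 * a^-1 * b * b) * (b^-1 * a) ^- s.
  rewrite /z artin_full_twists /= /y /twisted_torus_solution /= -/a -/b.
  by rewrite (_ : a / b = c)// /b; group_word.
have dE : (b^-1 * a) ^+ s = b^-1 * E * b.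
  rewrite (_ : b^-1 * a = c ^ b) -?conjXg ?conjgE; first by rewrite -/E !mulgA.
  by rewrite /b; group_word.
have {z1} z1 : z 1%N = a * a * a * b^-1.
  have aaE : a * a * E^-1 = u * (c * E) * u * c.
    by rewrite [X in _ * X * _]aE [X in X * _ * _]aE; group_word.
  have {}H : u * u = c * (a * a * E^-1) * (a * a * E^-1).
    by rewrite H cE aaE; group_word.
  have uuE : u * u = a * E^-1 * c^-1 * a * c^-1 * E^-1.
    by rewrite [X in X * _ * _ * _ * _ * _]aE [X in _ * X * _ * _]aE'; group_word.
  rewrite z1 dE /b.
  transitivity (E * a^-1 * a^-1 * c^-1 *
    (a * E^-1 * c^-1 * a * c^-1 * E^-1) * E * c); first by group_word.
  by rewrite -uuE H; group_word.
do 6?[case: k k5 => [|k] k5]; rewrite // ?y0 ?y1 ?y2 ?y3 ?y4 ?y5 ?z1;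
  try by rewrite /y /twisted_torus_solution /= -/a -/b; group_word.
Qed.

End artin_action.

(** * Commutators with a fixed element as products of conjugates *)

Section conjugate_products.
Local Open Scope group_scope.
Variables (G : groupType) (c u : G).

Definition conj_product (g x : G) : Prop :=
  exists hs : seq G, \prod_(h <- hs) (g ^ h) = x.

Lemma conj_productM g x y :
  conj_product g x -> conj_product g y -> conj_product g (x * y).
Proof.
by move=> [hs <-] [ks <-]; exists (hs ++ ks); rewrite big_cat.
Qed.

Lemma conj_productJ g x y : conj_product g x -> conj_product g (x ^ y).
Proof.
move=> [hs <-]; exists [seq h * y | h <- hs].
by rewrite big_map conjg_prod; apply: eq_bigr => h _; rewrite conjgM.
Qed.

Let R x := x * u * x^-1 * u^-1.

(** The map x -> [x, u] is a crossed homomorphism. Hence the x for which [x, u] is a product of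
    conjugates of [c, u] form a submonoid. It contains c, and also both u and u^-1, for which the
    product is empty. *)
Let R_mul x y : R (x * y) = R y ^ x^-1 * R x.
Proof. by rewrite /R conjgE; group_word. Qed.

Let posR x := conj_product (R c) (R x).

Let posRM x y : posR x -> posR y -> posR (x * y).
Proof. by move=> px py; rewrite /posR R_mul; exact/conj_productM/px/conj_productJ. Qed.

Let posRc : posR c.
Proof. by exists [:: 1]; rewrite big_seq1 conjg1. Qed.

Let posRu : posR u.
Proof. by exists [::]; rewrite big_nil /R; group_word. Qed.

Let posRuV : posR u^-1.
Proof. by exists [::]; rewrite big_nil /R; group_word. Qed.

Let posRcX m : posR (c ^+ m).
Proof.
elim: m => [|m IH]; last by rewrite expgS; exact: posRM.
by exists [::]; rewrite big_nil expg0 /R; group_word.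
Qed.

(* The relator, as a word in c and u, is positive in c: the commutator of the
   relator with u, which is trivial, is then a product of conjugates of the
   commutator of c and u. *)
Lemma positive_relation_torsion m :
  u * u = c * u * c ^+ m * u * c * u * c ^+ m * u * c ->
  c * u * c^-1 * u^-1 <> 1 -> generalized_torsion (c * u * c^-1 * u^-1).
Proof.
set k := c ^+ m => rel cu; split=> //; rewrite -/(R c).
pose x := u * k * u * c * u * k * u * c * u^-1 * u^-1.
have [hs hsE] : posR x by do ![apply: posRM => //]; exact: posRcX.
(* The relator is [c * x]; its leading letter contributes the last factor, with conjugator 1, which
   makes the list non-empty. *)
exists ([seq h * c^-1 | h <- hs] ++ [:: 1]); first by case: (hs).
rewrite big_cat big_seq1 conjg1 big_map.
under eq_bigr do rewrite conjgM.
rewrite -conjg_prod hsE; transitivity (R (c * x)); first by rewrite R_mul.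
rewrite (_ : c * x = 1); first by rewrite /R; group_word.
transitivity ((c * u * k * u * c * u * k * u * c) * u^-1 * u^-1).
  by rewrite /x; group_word.
by rewrite -rel; group_word.
Qed.

End conjugate_products.

(** * Affine maps and a representation of the relation *)

Section affine_group.
Import GRing.Theory.
Local Open Scope ring_scope.
Variable K : fieldType.

(* The pair (m, x) stands for the affine map z |-> m z + x. *)
Definition affine : Type := {p : K * K | p.1 != 0}.

HB.instance Definition _ := Choice.on affine.

Definition Affine (m x : K) (m0 : m != 0) : affine := exist _ (m, x) m0.

Definition affine_one : affine := Affine 0 (oner_neq0 K).
Definition affine_mul (f g : affine) : affine :=
  Affine ((val f).2 + (val f).1 * (val g).2) (mulf_neq0 (valP f) (valP g)).
Definition affine_inv (f : affine) : affine :=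
  Affine (- ((val f).1^-1 * (val f).2)) (invr_neq0 (valP f)).

Lemma affine_mulA : associative affine_mul.
Proof.
by move=> f g h; apply: val_inj; rewrite /= !mulrA mulrDr addrA !mulrA.
Qed.

Lemma affine_mul1 : left_id affine_one affine_mul.
Proof. by move=> [[m x] m0]; apply: val_inj; rewrite /= !mul1r add0r. Qed.

Lemma affine_mulr1 : right_id affine_one affine_mul.
Proof. by move=> [[m x] m0]; apply: val_inj; rewrite /= mulr0 addr0 mulr1. Qed.

Lemma affine_mulV : left_inverse affine_one affine_inv affine_mul.
Proof.
by move=> [[m x] m0]; apply: val_inj; rewrite /= mulVf// addNr.
Qed.

Lemma affine_mulrV : right_inverse affine_one affine_inv affine_mul.
Proof.
by move=> [[m x] m0]; apply: val_inj; rewrite /= mulfV// mulrN mulrA mulfV// mul1r addrN.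
Qed.

HB.instance Definition _ := isGroup.Build affine
  affine_mulA affine_mul1 affine_mulr1 affine_mulV affine_mulrV.

Lemma affine_valM (f g : affine) : val (f * g)%g =
  ((val f).1 * (val g).1, (val f).2 + (val f).1 * (val g).2).
Proof. by []. Qed.

Lemma affine_mulE (f g : affine) p q : val f = p -> val g = q ->
  val (f * g)%g = (p.1 * q.1, p.2 + p.1 * q.2).
Proof. by move=> <- <-. Qed.

Lemma affine_valX0 (f : affine) n : (val f).2 = 0 ->
  val (f ^+ n)%g = ((val f).1 ^+ n, 0).
Proof.
move=> f0; elim: n => [|n IH]; first by rewrite expg0 expr0.
by rewrite expgS affine_valM IH f0 exprS /= mulr0 addr0.
Qed.

End affine_group.

Section affine_representation.
Import GRing.Theory Num.Theory.
Local Open Scope ring_scope.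

(** The equation, multiplied by t^2, is F(t) = 0. By Fox calculus, [F] divided by X + 1 is, up to a
    unit, the Alexander polynomial of the group with generators c, u and the relation of
    [affine_solution]. Since F(1) = 2, the value 1 is no root. The root -1 of [F] is simple, as
    F'(-1) = 3 - 2m is odd, so it is not a root of the quotient [H], whose degree 6 + 2m is
    positive. *)
Lemma alexander_root m : exists t : algC, [/\ t != 0, t ^+ 2 != 1 &
  1 + t ^+ (3 + m.*2) = t ^- 2 + t + t ^+ (2 + m.*2) + t ^+ (5 + m.*2)].
Proof.
pose F : {poly algC} :=
  'X^(7 + m.*2) + (- 'X^(5 + m.*2) + 'X^(4 + m.*2) + 'X^3 - 'X^2 + 1).
have signm n : (-1) ^+ (n + m.*2) = (-1) ^+ n :> algC.
  by rewrite -signr_odd oddD odd_double addbF signr_odd.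
have FE x : F.[x] = x ^+ (7 + m.*2) - x ^+ (5 + m.*2) + x ^+ (4 + m.*2) + x ^+ 3
    - x ^+ 2 + 1 by rewrite /F !(hornerD, hornerN, hornerXn, hornerC) ?addrA.
have FN1 : root F (-1).
  by rewrite /root FE !signm; apply/eqP; ring.
have /factor_theorem [H HE] := FN1.
have sF : size F = (8 + m.*2)%N.
  rewrite /F size_polyDl size_polyXn//.
  do ![rewrite (leq_ltn_trans (size_polyD _ _))// gtn_max ?size_polyN ?size_polyXn ?size_poly1; apply/andP; split] => //;
  by lia.
have F0 : F != 0 by rewrite -size_poly_eq0 sF.
have /closed_rootP [t tH] : size H != 1%N.
  have H0 : H != 0 by apply: contraNneq F0 => H0; rewrite HE H0 mul0r.
  by move: sF; rewrite HE size_Mmonic// ?monicXsubC// size_XsubC addn2 => -[->].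
have Ft : F.[t] = 0 by rewrite HE hornerM (rootP tH) mul0r.
have t0 : t != 0.
  apply: contraPneq Ft => ->; rewrite FE !exprD !expr0n/= !mul0r !subr0 !addr0 add0r.
  by apply/eqP; rewrite oner_eq0.
exists t; split=> //; last first.
  move: Ft; rewrite FE !exprD; set T := t ^+ m.*2 => Ft.
  apply/eqP; rewrite -subr_eq0 -(mulrI_eq0 _ (mulfI (expf_neq0 2 t0))).
  by apply/eqP; rewrite -[RHS]oppr0 -Ft; field.
rewrite -subr_eq0 subr_sqr_1 mulf_eq0 negb_or; apply/andP; split.
  rewrite subr_eq0; apply: contraPneq Ft => ->; rewrite FE !expr1n.
  by apply/eqP; rewrite (_ : _ + 1 = 2%:R) ?pnatr_eq0//; ring.
rewrite addr_eq0; apply: contraPneq (rootP tH) => tN1.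
have := congr1 (fun p => p^`().[-1]) HE.
rewrite derivM derivXsubC mulr1 hornerD hornerM hornerXsubC opprK addNr mulr0 add0r -tN1.
have dX n : ('X^(n.+1))^`().[-1] = (-1) ^+ n * n.+1%:R :> algC.
  by rewrite derivXn hornerMn hornerXn -mulr_natr.
rewrite (rootP tH) tN1 /F -(polyC1 algC) !(derivD, derivN, derivC).
rewrite !(hornerD, hornerN, horner0) !addSn !dX -!addSn !signm !natrD => F'0.
have /eqP : (3 = m.*2%:R :> algC) by apply/eqP; rewrite -subr_eq0 -F'0; apply/eqP; ring.
by rewrite eqr_nat => /eqP /(congr1 odd); rewrite odd_double.
Qed.

(** The multipliers satisfy the relation for every t. In the translation parts each letter u
    contributes the multiplier of the prefix before it, which gives the equation of
    [alexander_root]. The products [c * u] and [u * c] have translation parts t^-2 and 1. *)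
Lemma affine_solution m : exists c u : affine algC,
  [/\ (u * u = c * u * c ^+ m * u * c * u * c ^+ m * u * c)%g &
      (c * u * c^-1 * u^-1)%g <> 1%g].
Proof.
have [t [t0 t2 tE]] := alexander_root m.
have t20 : t ^- 2 != 0 by rewrite invr_eq0 expf_neq0.
have tu0 : t ^+ (3 + m.*2) != 0 by rewrite expf_neq0.
have [c cE] : exists c : affine algC, val c = (t ^- 2, 0) by exists (Affine 0 t20).
have [u uE] : exists u : affine algC, val u = (t ^+ (3 + m.*2), 1).
  by exists (Affine 1 tu0).
have [k kE] : exists k : affine algC, k = (c ^+ m)%g by exists (c ^+ m)%g.
have kv : val k = (t ^- m.*2, 0).
  by rewrite kE affine_valX0 cE//= exprVn -exprM mul2n.
exists c, u; rewrite -kE; split.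
  apply: val_inj; rewrite (affine_mulE uE uE).
  have /affine_mulE/(_ kv)/affine_mulE/(_ uE)/affine_mulE/(_ cE) := affine_mulE cE uE.
  move=> /affine_mulE/(_ uE)/affine_mulE/(_ kv)/affine_mulE/(_ uE)/affine_mulE/(_ cE) -> /=.
  move: tE; rewrite !exprD; set T := t ^+ m.*2 => tE.
  have T0 : T != 0 by rewrite expf_neq0.
  congr (_, _); first by field; rewrite T0 t0.
  by rewrite mulr1 tE; field; rewrite T0 t0.
move/eqP; rewrite -mulgA -invgM => /eqP/divg1_eq/(congr1 (fun f => (val f).2)).
rewrite (affine_mulE cE uE) (affine_mulE uE cE) /= mulr1 add0r mulr0 addr0 => /eqP.
by rewrite invr_eq1 (negPf t2).
Qed.

End affine_representation.
Import Order.TTheory GRing.Theory Num.Theory.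
Import numFieldNormedType.Exports.
Local Open Scope classical_set_scope.
Local Open Scope ring_scope.
Local Open Scope quotient_scope.

(** * Holonomy of locally constant transports *)

Section cousin.
Context {R : realType}.

(** The supremum m of the points x with [Q lo x] cannot lie below [hi]: a small interval around m
    leads from such a point to one beyond m. This is compactness of the interval in the form of
    Cousin's lemma, used for the constancy of ratios and, in two directions, for lifting squares. *)
Lemma cousin (lo hi : R) (Q : R -> R -> Prop) : lo <= hi ->
  (forall a b c, a <= b <= c -> Q a b -> Q b c -> Q a c) ->
  (forall x, lo <= x <= hi -> exists2 e, 0 < e & forall a b,
     x - e < a -> a <= x <= b -> b < x + e -> lo <= a -> b <= hi -> Q a b) ->
  Q lo hi.
Proof.
move=> lohi Qtrans Qloc.
pose S := [set x | lo <= x <= hi /\ Q lo x].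
have Slo : S lo.
  split; first by rewrite lexx lohi.
  have [|e e0 Qe] := Qloc lo; first by rewrite lexx lohi.
  by apply: Qe; rewrite ?lexx//; lra.
have supS : has_sup S by split; [exists lo | exists hi => x [/andP[]]].
set m := sup S.
have lom : lo <= m by apply: ub_le_sup => //; case: supS.
have mhi : m <= hi by apply: ge_sup; [exists lo | move=> x [/andP[]]].
have [|e e0 Qe] := Qloc m; first by rewrite lom mhi.
have [x Sx xm] := sup_adherent e0 supS.
have xlem : x <= m by apply: ub_le_sup => //; case: supS.
have [/andP[lox _] Qx] := Sx.
pose b := Num.min hi (m + e / 2).
have mb : m <= b by rewrite /b le_min mhi/=; lra.
have Qb : Q lo b.
  apply: Qtrans Qx _; first by rewrite lox (le_trans xlem mb).
  apply: Qe => //; first by rewrite xlem.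
    by rewrite /b gt_min; apply/orP; right; lra.
  by rewrite /b ge_min lexx.
have [hie|hie] := leP hi (m + e / 2).
  by move: Qb; rewrite /b min_l.
have : b <= m.
  apply: ub_le_sup; first by case: supS.
  by split=> //; rewrite (le_trans lom mb) /b ge_min lexx.
by rewrite /b min_r; [move=> ?; exfalso; lra | exact: ltW].
Qed.

End cousin.

Section transport.
Context {R : realType} {X : topologicalType} {G : groupType}.
(** Parallel transport to nearby points in a flat bundle whose fibres are trivialised by arbitrary
    pointwise choices. No continuity in the first argument is available, so in [T_local] the
    neighbourhood of z depends on y. *)
Variable T : X -> X -> G.
Hypothesis T1 : forall x, T x x = 1%g.
Hypothesis T_local :
  forall x, \forall y \near x, \forall z \near y, T x z = (T x y * T y z)%g.

(** A flat section over [H]. The condition is imposed only near each point and only within [A], so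
    that lifts can be restricted to closed pieces and glued. *)
Definition is_lift {Z : topologicalType} (H : Z -> X) (A : set Z) (f : Z -> G) :=
  forall p, A p -> \forall p' \near p, A p' -> f p' = (f p * T (H p) (H p'))%g.

Lemma is_lift_comp {Z W : topologicalType} (H : Z -> X) A f (k : W -> Z) B :
  continuous k -> (forall w, B w -> A (k w)) -> is_lift H A f ->
  is_lift (H \o k) B (f \o k).
Proof.
move=> ck BA lf w Bw; have h := lf _ (BA _ Bw).
near=> w' => /BA; near: w'; exact: (ck w _ h).
Unshelve. all: by end_near. Qed.

Lemma is_lift_mull {Z : topologicalType} (H : Z -> X) A f g :
  is_lift H A f -> is_lift H A (fun p => g * f p)%g.
Proof.
by move=> lf p Ap; apply: filterS (lf p Ap) => p' E /E ->; rewrite mulgA.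
Qed.

Lemma is_lift_sub {Z : topologicalType} (H : Z -> X) A B f :
  B `<=` A -> is_lift H A f -> is_lift H B f.
Proof.
by move=> BA lf p /BA Ap; apply: filterS (lf p Ap) => p' E /BA; exact: E.
Qed.

Lemma is_lift_eq {Z : topologicalType} (H H' : Z -> X) A f :
  (forall p, A p -> H p = H' p) -> is_lift H A f -> is_lift H' A f.
Proof.
move=> HH lf p Ap; apply: filterS (lf p Ap) => p' E Ap'.
by rewrite -!HH//; exact: E.
Qed.

Lemma local_lift {Z : topologicalType} (H : Z -> X) : continuous H -> forall p0,
  \forall p \near p0, \forall p' \near p,
    T (H p0) (H p') = (T (H p0) (H p) * T (H p) (H p'))%g.
Proof.
move=> cH p0; have h := T_local (H p0).
near=> p; have hp : \forall z \near H p, T (H p0) z = (T (H p0) (H p) * T (H p) z)%g.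
  by near: p; exact: (cH p0 _ h).
near=> p'; near: p'; exact: (cH p _ hp).
Unshelve. all: by end_near. Qed.

(** The transport factor cancels in f g^-1, which is therefore locally constant along [k], hence
    constant by [cousin]. *)
Lemma lift_ratio_constant (Z : topologicalType) (H : Z -> X) A B f g (k : R -> Z) lo hi :
  continuous k -> lo <= hi -> (forall x, lo <= x <= hi -> A (k x) /\ B (k x)) ->
  is_lift H A f -> is_lift H B g ->
  exists c : G, forall x, lo <= x <= hi -> f (k x) = (c * g (k x))%g.
Proof.
move=> ck lohi kAB lf lg.
exists (f (k lo) * (g (k lo))^-1)%g => x /andP[lox xhi].
pose r y := (f (k y) * (g (k y))^-1)%g.
suff rx : r x = r lo by rewrite -/(r lo) -rx /r mulgVK.
apply: (@cousin R lo x (fun a b => r b = r a)) => // [a b c _ <- ->//|y /andP[loy yx]].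
have [Ay By] : A (k y) /\ B (k y) by apply: kAB; rewrite loy (le_trans yx).
have : \forall y' \near y, lo <= y' <= hi -> r y' = r y.
  have h1 := lf _ Ay; have h2 := lg _ By.
  near=> y' => y'lh.
  have [Ay' By'] := kAB _ y'lh.
  rewrite /r (_ : f (k y') = (f (k y) * T (H (k y)) (H (k y')))%g); last first.
    by move: Ay'; near: y'; exact: (ck y _ h1).
  rewrite (_ : g (k y') = (g (k y) * T (H (k y)) (H (k y')))%g); last first.
    by move: By'; near: y'; exact: (ck y _ h2).
  by rewrite invgM mulgA mulgK.
move=> /nbhs_ballP[e /= e0 be]; exists e => // a b ya /andP[ay yb] bye loa bx.
rewrite (be a) ?(be b)//.
- by rewrite /ball /= ltr_norml; apply/andP; split; lra.
- by rewrite (le_trans loy yb) (le_trans bx xhi).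
- by rewrite /ball /= ltr_norml; apply/andP; split; lra.
- by rewrite loa (le_trans ay (le_trans yx xhi)).
Unshelve. all: by end_near. Qed.

(** A lift stays a lift when multiplied on the left by a constant, so [g] is replaced by c g. Since
    the sets are closed, near a point outside one of them only the other lift matters. *)
Lemma glue_lifts {Z : topologicalType} (H : Z -> X) A B f g (c : G) :
  closed A -> closed B -> is_lift H A f -> is_lift H B g ->
  (forall p, A p -> B p -> f p = (c * g p)%g) ->
  exists2 h, is_lift H (A `|` B) h &
    (forall p, A p -> h p = f p) /\ (forall p, B p -> h p = (c * g p)%g).
Proof.
move=> clA clB lf lg fg.
pose h p := if pselect (A p) then f p else (c * g p)%g.
have hA p : A p -> h p = f p by rewrite /h; case: pselect.
have hB p : B p -> h p = (c * g p)%g.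
  by rewrite /h; case: pselect => //= Ap Bp; rewrite fg.
have lA p : A p -> \forall p' \near p, A p' -> h p' = (h p * T (H p) (H p'))%g.
  by move=> Ap; apply: filterS (lf p Ap) => p' E Ap'; rewrite !hA// E.
have lB p : B p -> \forall p' \near p, B p' -> h p' = (h p * T (H p) (H p'))%g.
  by move=> Bp; apply: filterS (lg p Bp) => p' E Bp'; rewrite !hB// E// mulgA.
have out (C : set Z) p : closed C -> ~ C p -> \forall p' \near p, ~ C p'.
  by move=> /closed_openC oC nC; exact: (open_nbhs_nbhs (conj oC nC)).
exists h => // p ABp.
have hAp : \forall p' \near p, A p' -> h p' = (h p * T (H p) (H p'))%g.
  have [/lA//|nA] := pselect (A p).
  by apply: filterS (out _ _ clA nA) => p' nA' /nA'.
have hBp : \forall p' \near p, B p' -> h p' = (h p * T (H p) (H p'))%g.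
  have [/lB//|nB] := pselect (B p).
  by apply: filterS (out _ _ clB nB) => p' nB' /nB'.
by apply: filterS2 hAp hBp => p' hA' hB' [/hA'|/hB'].
Qed.

Definition rect (a b c d : R) : set (R * R) :=
  [set p | a <= p.1 <= b /\ c <= p.2 <= d].

Lemma closed_rect a b c d : closed (rect a b c d).
Proof.
rewrite (_ : rect a b c d = fst @^-1` `[a, b]%classic `&` snd @^-1` `[c, d]%classic).
  apply: closedI; (apply: preimage_closed => [x _|]; [|exact: itv_closed]);
  by [exact: cvg_fst | exact: cvg_snd].
by apply/seteqP; split=> p /=; rewrite /rect /= !in_itv.
Qed.

Lemma glue_rects (H : R * R -> X) A B C f g (k : R -> R * R) lo hi :
  continuous k -> lo <= hi -> closed A -> closed B ->
  (forall x, lo <= x <= hi -> A (k x) /\ B (k x)) ->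
  (forall p, A p -> B p -> exists2 x, lo <= x <= hi & k x = p) ->
  C `<=` A `|` B -> is_lift H A f -> is_lift H B g ->
  exists h, is_lift H C h.
Proof.
move=> ck lohi clA clB kAB ABk CAB lf lg.
have [c fg] := lift_ratio_constant ck lohi kAB lf lg.
have [|h lh _] := @glue_lifts _ H A B f g c clA clB lf lg.
  by move=> p Ap Bp; have [x xlh <-] := ABk p Ap Bp; exact: fg.
by exists h; exact: is_lift_sub lh.
Qed.

(** The homotopy lifting property. [cousin] is applied to heights and, inside, to widths: at a fixed
    height local lifts are joined into one over a strip of positive height, and strips are
    stacked. *)
Lemma lift_square (H : R * R -> X) : continuous H ->
  exists f, is_lift H (rect 0 1 0 1) f.
Proof.
move=> cH.
apply: (@cousin R 0 1 (fun c d => exists f, is_lift H (rect 0 1 c d) f)) => //.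
  move=> a b c /andP[ab bc] [f lf] [g lg].
  apply: (@glue_rects H _ _ _ f g (fun x => (x, b)) 0 1 _ _ _ _ _ _ _ lf lg) => //.
  - by cts.
  - exact: closed_rect.
  - exact: closed_rect.
  - by move=> x x01; split; rewrite /rect /= x01; split=> //; apply/andP; split.
  - move=> [x y] [/= x01 /andP[_ yb]] [_ /= /andP[yb' _]]; exists x => //.
    by congr (_, _); apply/eqP; rewrite eq_le yb yb'.
  - move=> [x y] [/= x01 /andP[ay yc]]; have [yb|/ltW yb] := leP y b.
      by left; split=> //=; rewrite ay.
    by right; split=> //=; rewrite yb.
move=> s _.
have [e e0 [f lf]] : exists2 e, 0 < e &
    exists f, is_lift H (rect 0 1 (s - e) (s + e)) f.
  apply: (@cousin R 0 1 (fun a b => exists2 e, 0 < e &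
    exists f, is_lift H (rect a b (s - e) (s + e)) f)) => //.
    move=> a b c /andP[ab bc] [e e0 [f lf]] [e' e0' [g lg]].
    pose d := Num.min e e'.
    have de : d <= e by rewrite /d ge_min lexx.
    have de' : d <= e' by rewrite /d ge_min lexx orbT.
    have d0 : 0 < d by rewrite /d lt_min e0.
    exists d => //.
    have sub e1 x y : d <= e1 -> rect x y (s - d) (s + d) `<=` rect x y (s - e1) (s + e1).
      move=> de1 p [? /andP[? ?]]; split=> //; apply/andP; split; lra.
    apply: (@glue_rects H _ _ _ f g (fun x => (b, x)) (s - d) (s + d) _ _ _ _ _ _ _
      (is_lift_sub (sub _ _ _ de) lf) (is_lift_sub (sub _ _ _ de') lg)) => //.
    - by cts.
    - lra.
    - exact: closed_rect.
    - exact: closed_rect.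
    - by move=> x x01; split; rewrite /rect /= x01; split=> //; apply/andP; split.
    - move=> [x y] [/= /andP[_ yb] x01] [/= /andP[yb' _] _]; exists y => //.
      by congr (_, _); apply/eqP; rewrite eq_le yb yb'.
    - move=> [x y] [/= /andP[ay yc] x01]; have [yb|/ltW yb] := leP x b.
        by left; split=> //=; rewrite ay.
      by right; split=> //=; rewrite yb.
  (* Near a point, the transport from that point is itself a lift. *)
  move=> x _; have [[U V] /= [Ux Vs] UV] := local_lift cH (x, s).
  move: Ux Vs => /nbhs_ballP[e1 /= e10 eU] /nbhs_ballP[e2 /= e20 eV].
  exists e1 => // a b xa /andP[ax xb] bxe _ _.
  exists (e2 / 2); first lra.
  exists (fun p => T (H (x, s)) (H p)) => p [/andP[ap pb] /andP[sp ps]].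
  suff : (U `*` V) p by move=> /UV; apply: filterS.
  split; [apply: eU | apply: eV]; rewrite /ball /= ltr_norml; apply/andP; split; lra.
exists e => // c d sc /andP[cs sd] dse _ _; exists f.
apply: is_lift_sub lf => p [? /andP[? ?]]; split=> //.
by apply/andP; split; lra.
Qed.

Local Notation I := (unit_interval R).
Implicit Types (p q : I -> X).

Definition unit_itv : set R := [set x | 0 <= x <= 1].

Definition path_lift p (f : R -> G) := is_lift (p \o to_itv) unit_itv f.

Definition holonomy p (h : G) := exists2 f, path_lift p f & f 0 = 1%g /\ f 1 = h.

Lemma itv_path_continuous p : continuous p -> continuous (p \o to_itv).
Proof. by move=> cp; apply: cts_comp => //; exact: to_itv_continuous. Qed.

Lemma path_lift_unique p f g : continuous p -> path_lift p f -> path_lift p g ->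
  f 0 = g 0 -> f 1 = g 1.
Proof.
move=> cp lf lg fg0.
have [c fg] : exists c : G, forall x, 0 <= x <= 1 -> f x = (c * g x)%g.
  by apply: (lift_ratio_constant (k := id) _ ler01 _ lf lg) => // x; exact: cvg_id.
move: (fg 0) (fg 1); rewrite !lexx !ler01 fg0 => /(_ erefl) + /(_ erefl) ->.
by rewrite -{1}[g 0]mul1g => /mulIg <-; rewrite mul1g.
Qed.

Lemma holonomy_cst x : holonomy (cst x) 1%g.
Proof.
exists (cst 1%g) => // t _; near=> t' => _ /=.
by rewrite T1 mulg1.
Unshelve. all: by end_near. Qed.

(** A lift over the square, normalised to 1 at a corner, restricts to a lift of each side. On the
    two sides where the homotopy is constant it is constant, so the lifts along [p] and [q] agree at
    both ends. *)
Lemma holonomy_homotopic p q h k : continuous p -> continuous q ->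
  path_homotopic p q -> holonomy p h -> holonomy q k -> h = k.
Proof.
move=> cp cq [H [cH [H0 H1] H0s H1s]] [f lf [f0 f1]] [g lg [g0 g1]].
pose K z := H (to_itv z.1, to_itv z.2).
have cK : continuous K by rewrite /K; cts.
have [F lF] := lift_square cK.
pose o : R * R := (0, 0); pose F' z := ((F o)^-1 * F z)%g.
have side (u : R -> R * R) r : continuous u ->
    (forall x, unit_itv x -> rect 0 1 0 1 (u x)) -> K \o u = r \o to_itv ->
    path_lift r (F' \o u).
  move=> cu uin ur; rewrite /path_lift -ur.
  exact: is_lift_comp cu uin (is_lift_mull _ lF).
have l0 : path_lift p (F' \o (fun x => (x, 0))).
  apply: side; [by cts | by move=> x x01; split=> //=; rewrite lexx ler01 |].
  by apply/funext => x; rewrite /K /= (to_itv_le0 (r := 0))// H0.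
have l1 : path_lift q (F' \o (fun x => (x, 1))).
  apply: side; [by cts | by move=> x x01; split=> //=; rewrite lexx ler01 |].
  by apply/funext => x; rewrite /K /= (to_itv_ge1 (r := 1))// H1.
have l2 : path_lift (cst (p zero)) (F' \o (fun x => (0, x))).
  apply: side; [by cts | by move=> x x01; split=> //=; rewrite lexx ler01 |].
  by apply/funext => x; rewrite /K /= (to_itv_le0 (r := 0))// H0s.
have l3 : path_lift (cst (p one)) (F' \o (fun x => (1, x))).
  apply: side; [by cts | by move=> x x01; split=> //=; rewrite lexx ler01 |].
  by apply/funext => x; rewrite /K /= (to_itv_ge1 (r := 1))// H1s.
have const r u : path_lift (cst r) u -> u 1 = u 0.
  move=> lu; apply: (path_lift_unique (g := cst (u 0)) _ lu) => //.
    exact: cst_continuous.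
  by move=> t _; near=> t' => _ /=; rewrite T1 mulg1.
have /= e2 := const _ _ l2; have /= e3 := const _ _ l3.
have /= e0 := path_lift_unique cp lf l0; have /= e1 := path_lift_unique cq lg l1.
have F'0 : F' (0, 0) = 1%g by exact: mulVg.
by rewrite -f1 -g1 e0 ?e1 ?e3// ?g0 ?e2 ?F'0.
Unshelve. all: by end_near. Qed.

(** A path is lifted as a homotopy that is constant in the second variable. *)
Lemma holonomy_exists p : continuous p -> exists h, holonomy p h.
Proof.
move=> cp; have cK : continuous (fun z : R * R => p (to_itv z.1)).
  by cts.
have [F lF] := lift_square cK.
pose o : R * R := (0, 0); pose e : R * R := (1, 0).
exists ((F o)^-1 * F e)%g, (fun x => (F o)^-1 * F (x, 0%R))%g.
  have := @is_lift_comp _ _ _ _ _ (fun x : R => (x, 0 : R)) unit_itv _ _ (is_lift_mull (F o)^-1 lF).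
  apply; first by cts.
  by move=> x x01; split=> //=; rewrite lexx ler01.
by rewrite mulVg.
Qed.

Lemma holonomy_cat p q h k : continuous p -> continuous q -> p one = q zero ->
  holonomy p h -> holonomy q k -> holonomy (path_cat p q) (h * k)%g.
Proof.
move=> cp cq pq [f lf [f0 f1]] [g lg [g0 g1]].
pose A : set R := [set` `[0, 2^-1]]; pose B : set R := [set` `[2^-1, 1]].
pose H := path_cat p q \o to_itv.
have AE x : A x = (0 <= x <= 2^-1) :> Prop by rewrite /A /= in_itv.
have BE x : B x = (2^-1 <= x <= 1) :> Prop by rewrite /B /= in_itv.
have HA x : A x -> p (to_itv (2 * x)) = H x.
  rewrite AE => /andP[x0 x2].
  rewrite /H /path_cat /= to_itvE; last by apply/andP; split; lra.
  by rewrite x2.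
have HB x : B x -> q (to_itv (2 * x - 1)) = H x.
  rewrite BE => /andP[x2 x1].
  rewrite /H /path_cat /= to_itvE; last by apply/andP; split; lra.
  have [x2'|//] := leP x 2^-1; have -> : x = 2^-1 by apply/eqP; rewrite eq_le x2'.
  by rewrite to_itv_le0 ?(to_itv_ge1 (r := 2 * _)) ?pq//; lra.
have lA : is_lift H A (fun x => f (2 * x)).
  apply: is_lift_eq HA _.
  apply: (is_lift_comp (k := fun x : R => 2 * x) _ _ lf); first by cts.
  by move=> x; rewrite AE => /andP[? ?]; rewrite /unit_itv /=; apply/andP; split; lra.
have lB : is_lift H B (fun x => g (2 * x - 1)).
  apply: is_lift_eq HB _.
  apply: (is_lift_comp (k := fun x : R => 2 * x - 1) _ _ lg); first by cts.
  by move=> x; rewrite BE => /andP[? ?]; rewrite /unit_itv /=; apply/andP; split; lra.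
have clA : closed A by exact: itv_closed.
have clB : closed B by exact: itv_closed.
have [|u lu [uA uB]] := @glue_lifts _ H A B _ _ h clA clB lA lB.
  move=> x; rewrite AE BE => /andP[_ x1] /andP[x2 _].
  have -> : x = 2^-1 by apply/eqP; rewrite eq_le x1.
  by rewrite mulfV ?subrr ?f1 ?g0 ?mulg1// pnatr_eq0.
exists u.
  apply: is_lift_sub lu => x /andP[x0 x1]; rewrite /setU /= AE BE x0 x1 andbT.
  exact/orP/le_total.
rewrite uA ?uB ?AE ?BE ?mulr0 ?mulr1.
- by rewrite f0 addrK g1.
- by rewrite lexx andbT; lra.
- by rewrite lexx /=; lra.
Qed.

End transport.

Section fundamental_group_holonomy.
Context {R : realType} {X : topologicalType} {G : groupType}.
Variable T : X -> X -> G.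
Hypothesis T1 : forall x, T x x = 1%g.
Hypothesis T_local :
  forall x, \forall y \near x, \forall z \near y, T x z = (T x y * T y z)%g.
Variable x0 : X.

Definition class_holonomy (a : fundamental_group R x0) (h : G) :=
  exists2 p, homotopy_class p = a & holonomy T p h.

Lemma class_holonomy_unique a h k :
  class_holonomy a h -> class_holonomy a k -> h = k.
Proof.
move=> [p <- ph] [q /esym/homotopy_classP pq qk].
apply: (holonomy_homotopic T1 T_local _ _ pq ph qk); exact: loop_continuous.
Qed.

Lemma class_holonomy1 : class_holonomy 1%g 1%g.
Proof. by exists (loop_cst R x0) => //; exact: holonomy_cst. Qed.

Lemma class_holonomyM a b h k : class_holonomy a h -> class_holonomy b k ->
  class_holonomy (a * b)%g (h * k)%g.
Proof.
move=> [p <- ph] [q <- qk]; exists (loop_cat p q); first exact: homotopy_classM.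
by apply: holonomy_cat => //; [exact: loop_continuous..|exact: loop_ends].
Qed.

(** The inverse class has some holonomy k, and h k = 1 by multiplicativity and uniqueness. *)
Lemma class_holonomyV a h : class_holonomy a h -> class_holonomy a^-1%g h^-1%g.
Proof.
move=> ah; have [k vk] : exists k, class_holonomy a^-1%g k.
  have [p pE] : exists p, homotopy_class p = (a^-1)%g :> fundamental_group R x0.
    by eexists; exact: homotopy_class_surj.
  have [k kp] := holonomy_exists T_local (@loop_continuous R X x0 p).
  by exists k, p.
have := class_holonomy_unique (class_holonomyM ah vk).
by rewrite mulgV => /(_ _ class_holonomy1)/mulg1_eq ->.
Qed.

End fundamental_group_holonomy.

(** * Braids and the pages of the braid axis *)

Section continuity_complements.
Context {R : realType} {Z : topologicalType}.
Implicit Types u v : Z -> R.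

Lemma cts_cos u : continuous u -> continuous (fun z => cos (u z)).
Proof. by move=> cu; exact: (@cts_comp _ _ _ u (@cos R) (@continuous_cos R) cu). Qed.

Lemma cts_sin u : continuous u -> continuous (fun z => sin (u z)).
Proof. by move=> cu; exact: (@cts_comp _ _ _ u (@sin R) (@continuous_sin R) cu). Qed.

Lemma cts_opp u : continuous u -> continuous (fun z => - u z).
Proof. by move=> cu z; apply: continuousN; exact: cu. Qed.

Lemma cts_sqrt u : continuous u -> continuous (fun z => Num.sqrt (u z)).
Proof. by move=> cu; exact: (@cts_comp _ _ _ u (@Num.sqrt R) (@sqrt_continuous R) cu). Qed.

Lemma cts_exp u n : continuous u -> continuous (fun z => u z ^+ n).
Proof. by move=> cu; exact: (@cts_comp _ _ _ u (fun x => x ^+ n) (@exprn_continuous R n) cu). Qed.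

Lemma cts_div u v : continuous u -> continuous v -> (forall z, v z != 0) ->
  continuous (fun z => u z / v z).
Proof.
move=> cu cv v0; apply: ctsM => // z.
by apply: (@continuousV _ _ v z (v0 z)); exact: cv.
Qed.

End continuity_complements.

Ltac cts' := repeat first [ match goal with
  | |- continuous (fun x => - @?u x) => refine (@cts_opp _ _ u _)
  | |- continuous (fun x => cos (@?u x)) => refine (@cts_cos _ _ u _)
  | |- continuous (fun x => sin (@?u x)) => refine (@cts_sin _ _ u _)
  | |- continuous (fun x => Num.sqrt (@?u x)) => refine (@cts_sqrt _ _ u _)
  | |- continuous (fun x => @?u x ^+ ?n) => refine (@cts_exp _ _ u n _)
  | |- continuous id => by move=> ?; exact: cvg_id
  | |- continuous cos => exact: continuous_cos
  | |- continuous sin => exact: continuous_sin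
  | |- continuous Num.sqrt => exact: sqrt_continuous
  | |- continuous -%R => exact: opp_continuous
  end | progress cts ].

Section strands.
Context {R : realType}.
Implicit Types (w : seq nat) (i j : nat) (t : R).

(** The strand from place i runs below the real axis and the one from i + 1 above it; they are the
    lower and the upper strand throughout. *)
Definition crossing_strand i j t : R * R :=
  if j == i then (i%:R + 2^-1 - 2^-1 * cos (pi * t), - (2^-1 * sin (pi * t)))
  else if j == i.+1 then
    (i%:R + 2^-1 + 2^-1 * cos (pi * t), 2^-1 * sin (pi * t))
  else (j%:R, 0).

Definition transpose i j : nat :=
  if j == i then i.+1 else if j == i.+1 then i else j.

(** [geometric_braid] gives only the set of occupied points; here each strand is followed
    continuously from its starting place [j]. After the first letter it goes on as the strand of the
    remaining word from [transpose i j]. *)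
Fixpoint strand w j t : R * R :=
  if w is i :: w' then
    if t <= 2^-1 then crossing_strand i j (2 * t)
    else strand w' (transpose i j) (2 * t - 1)
  else (j%:R, 0).

Definition braid_word (n : nat) w := all (fun i => (0 < i < n)%N) w.

Lemma transposeK i : involutive (transpose i).
Proof. by move=> j; rewrite /transpose; do !case: eqP => //; lia. Qed.

Lemma transpose_range n i j : (0 < i < n)%N ->
  (1 <= transpose i j <= n)%N = (1 <= j <= n)%N.
Proof. by rewrite /transpose => ?; do !case: eqP; lia. Qed.

Lemma crossing_strand0 i j : crossing_strand i j 0 = (j%:R, 0).
Proof.
rewrite /crossing_strand mulr0 cos0 sin0 mulr0 oppr0 mulr1.
case: eqP => [->|_]; first by congr (_, _); lra.
case: eqP => [->|//]; congr (_, _).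
by rewrite -(natr1 i); lra.
Qed.

Lemma crossing_strand1 i j : crossing_strand i j 1 = ((transpose i j)%:R, 0).
Proof.
rewrite /crossing_strand /transpose mulr1 cospi sinpi mulr0 oppr0.
case: eqP => _; first by congr (_, _); rewrite -(natr1 i); lra.
by case: eqP => [_|//]; congr (_, _); lra.
Qed.

Lemma strand0 w j : strand w j 0 = (j%:R, 0).
Proof. by case: w => [//|i w] /=; rewrite ifT; [rewrite mulr0 crossing_strand0 | lra]. Qed.

Lemma crossing_strand_continuous i j : continuous (crossing_strand i j).
Proof.
rewrite /crossing_strand; case: eqP => _; first by cts'.
by case: eqP => _; cts'.
Qed.

Lemma strand_continuous w j : continuous (strand w j).
Proof.
elim: w j => [|i w IH] j /=; first by cts.
apply: (@pasting_continuous R R (R * R)%type (fun t => t) (cst 2^-1)).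
- by cts.
- by cts.
- apply: (@cts_comp _ _ _ (fun t : R => 2 * t) (crossing_strand i j)); last by cts.
  exact: crossing_strand_continuous.
- apply: (@cts_comp _ _ _ (fun t : R => 2 * t - 1) (strand w (transpose i j))); last by cts.
  exact: IH.
- move=> t /= ->; rewrite mulfV ?pnatr_eq0// subrr strand0.
  by rewrite crossing_strand1.
Qed.

Lemma crossingE n i t : (0 < i < n)%N ->
  crossing n i t = [set z | exists2 j, (1 <= j <= n)%N & z = crossing_strand i j t].
Proof.
move=> i_n; apply/seteqP; split=> z /=.
  case=> [[j /and4P[j1 jn ji ji1] ->]|[->|->]].
  - by exists j; rewrite ?j1// /crossing_strand (negPf ji) (negPf ji1).
  - by exists i.+1; [lia | rewrite /crossing_strand eqxx ifF//; lia].
  - by exists i; [lia | rewrite /crossing_strand eqxx].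
move=> [j jn ->]; rewrite /crossing_strand; case: eqP => ji; first by right; right.
case: eqP => ji1; first by right; left.
by left; exists j => //; apply/and4P; split; lia.
Qed.

Lemma geometric_braidE n w t : braid_word n w ->
  geometric_braid n w t =
  [set z | exists2 j, (1 <= j <= n)%N & z = strand w j t].
Proof.
elim: w t => [|i w IH] t //= /andP[i_n wn]; case: ifP => _.
  exact: crossingE.
rewrite IH//; apply/seteqP; split=> z /= [j jn ->].
  exists (transpose i j); first by rewrite transpose_range.
  by rewrite transposeK.
by exists (transpose i j); rewrite ?transpose_range.
Qed.

Lemma geometric_braid1 n w : braid_word n w ->
  geometric_braid n w (1 : R) = geometric_braid n [::] 0.
Proof.
elim: w => [//|i w IH] /= /andP[i_n wn].
rewrite ifF; last by apply/negbTE; rewrite -ltNge; lra.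
by rewrite (_ : 2 * 1 - 1 = 1) ?IH//; lra.
Qed.

Lemma strand_ends n w j : braid_word n w -> (1 <= j <= n)%N ->
  (exists2 k, (1 <= k <= n)%N & strand w k 1 = (j%:R, 0)) /\
  (exists2 k, (1 <= k <= n)%N & strand w j 1 = (k%:R, 0)).
Proof.
move=> wn jn.
have := geometric_braid1 wn; rewrite geometric_braidE//= => E.
split.
  have : [set z : R * R | exists2 j, (1 <= j <= n)%N & z = (j%:R, 0)] (j%:R, 0).
    by exists j.
  by rewrite -E => -[k kn ->]; exists k.
have : [set z : R * R | exists2 j, (1 <= j <= n)%N & z = strand w j 1] (strand w j 1).
  by exists j.
by rewrite E => -[k kn ->]; exists k.
Qed.

End strands.

Section angles.
Context {R : realType}.
Implicit Types t : R.

(** For t <= t', the double-angle formula gives sin (pi (t' - t)) = 0, which leaves t' - t = 0 or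
    1. *)
Lemma angle_unique t t' : 0 <= t <= 1 -> 0 <= t' <= 1 ->
  cos (2 * pi * t) = cos (2 * pi * t') -> sin (2 * pi * t) = sin (2 * pi * t') ->
  [\/ t = t', t = 0 /\ t' = 1 | t = 1 /\ t' = 0].
Proof.
wlog tt : t t' / t <= t' => [W|] t01 t01' ct st.
  have [tt|/ltW tt] := leP t t'; first exact: W.
  have [->|[-> ->]|[-> ->]] := W _ _ tt t01' t01 (esym ct) (esym st).
  - by constructor 1.
  - by constructor 3.
  - by constructor 2.
have : cos (pi * (t' - t) *+ 2) = 1.
  rewrite (_ : _ *+ 2 = 2 * pi * t' - 2 * pi * t); last by rewrite mulr2n; ring.
  by rewrite cosB ct st -!expr2 cos2Dsin2.
rewrite cos_mulr2n cos2sin2 => s0.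
have {}s0 : sin (pi * (t' - t)) = 0.
  apply/eqP; rewrite -sqrf_eq0; apply/eqP; rewrite mulr2n in s0; lra.
move: t01 t01' => /andP[? ?] /andP[? ?].
have [t0|t0] := eqVneq t t'; first by constructor 1.
have [[-> ->]|t1] := pselect (t = 0 /\ t' = 1); first by constructor 2.
have : 0 < sin (pi * (t' - t)).
  apply: sin_gt0_pi; rewrite pmulr_rgt0 ?pi_gt0// gtr_pMr ?pi_gt0// subr_gt0.
  rewrite lt_neqAle t0 tt /=.
  have [] := ltP (t' - t) 1 => // tt1; exfalso; apply: t1; split; lra.
by rewrite s0 ltxx.
Qed.

Lemma angle_exists (x y : R) : exists2 t, 0 <= t <= 1 &
  (x = Num.sqrt (x ^+ 2 + y ^+ 2) * cos (2 * pi * t) /\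
   y = Num.sqrt (x ^+ 2 + y ^+ 2) * sin (2 * pi * t)).
Proof.
set q := Num.sqrt _; have q2 : q ^+ 2 = x ^+ 2 + y ^+ 2.
  by rewrite sqr_sqrtr// addr_ge0// sqr_ge0.
have q_ge0 : 0 <= q by exact: sqrtr_ge0.
have [q0|q0] := eqVneq q 0.
  exists 0; first by rewrite lexx ler01.
  have x2 := sqr_ge0 x; have y2 := sqr_ge0 y; rewrite q0 expr0n /= in q2.
  rewrite q0 !mul0r; split; apply/eqP; rewrite -sqrf_eq0; apply/eqP; lra.
have q_gt0 : 0 < q by rewrite lt_def q0.
have xq : -1 <= x / q <= 1.
  rewrite -ler_norml normrM normfV (gtr0_norm q_gt0) ler_pdivrMr// mul1r.
  by rewrite -(ger0_norm q_ge0) -ler_sqr ?nnegrE// !real_normK ?num_real// q2 lerDl sqr_ge0.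
pose a := acos (x / q); have a_ge0 : 0 <= a by exact: acos_ge0.
have a_lepi : a <= pi by exact: acos_lepi.
have ca : cos a = x / q by rewrite acosK// in_itv.
have sa : sin a = `|y| / q.
  rewrite sin_acos//.
  rewrite (_ : 1 - _ = (`|y| / q) ^+ 2).
    by rewrite sqrtr_sqr ger0_norm// divr_ge0.
  rewrite !expr_div_n real_normK ?num_real//.
  rewrite q2; field; rewrite -q2 expf_neq0//.
have pi0 := @pi_gt0 R.
have pin0 : (pi : R) != 0 by rewrite gt_eqF.
have xE : x = q * cos a by rewrite ca mulrCA mulfV ?mulr1.
have r0 : 0 <= a / (2 * pi) by rewrite divr_ge0// mulr_ge0// ltW.
have r1 : a / (2 * pi) <= 1.
  by rewrite ler_pdivrMr ?mulr_gt0// mul1r; lra.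
have rE : 2 * pi * (a / (2 * pi)) = a by rewrite mulrC divfK// mulf_neq0// pnatr_eq0.
have [y0|y0] := leP 0 y.
  exists (a / (2 * pi)); first by rewrite r0.
  rewrite rE.
  by split=> //; rewrite sa ger0_norm// mulrCA mulfV ?mulr1.
exists (1 - a / (2 * pi)); first by apply/andP; split; lra.
rewrite mulrBr mulr1 rE (_ : _ - a = - a + pi *+ 2); last by rewrite mulr2n; ring.
rewrite cosD2pi sinD2pi cosN sinN sa ltr0_norm//; split=> //.
by rewrite mulNr opprK mulrCA mulfV ?mulr1.
Qed.

End angles.

Section pages.
Context {R : realType} (n : nat) (w : seq nat).
Hypothesis wn : braid_word n w.
Implicit Types (v : R * R * R) (t : R).

Local Notation K := (@braid_closure R n w).
Local Notation X := (@S3 R `\` K : Type).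

(* Homogeneous coordinates on the page of angle t of the open book of the braid
   axis: ((a, b), q) with q > 0 stands for the point z = (a + i b) / q of that page,
   with q = 0 for a point of the axis. *)
Definition page_radius v : R := Num.sqrt (v.1.1 ^+ 2 + v.1.2 ^+ 2 + v.2 ^+ 2).

Definition page_point v t : (R * R) * (R * R) :=
  ((v.1.1 / page_radius v, v.1.2 / page_radius v),
   (v.2 * cos (2 * pi * t) / page_radius v, v.2 * sin (2 * pi * t) / page_radius v)).

Definition off_strands v t : Prop := 0 < v.2 -> forall j, (1 <= j <= n)%N ->
  ~ (v.1.1 = v.2 * (strand w j t).1 /\ v.1.2 = v.2 * (strand w j t).2).

Definition page_ok v t : Prop :=
  [/\ 0 <= t <= 1, 0 <= v.2, v != 0 & off_strands v t].

Lemma page_radius_gt0 v : v != 0 -> 0 < page_radius v.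
Proof.
case: v => [[a b] q] v0; rewrite /page_radius /= sqrtr_gt0.
rewrite lt_def !addr_ge0 ?sqr_ge0// andbT; apply: contraNneq v0 => s0.
have a2 := sqr_ge0 a; have b2 := sqr_ge0 b; have q2 := sqr_ge0 q.
have /eqP : a ^+ 2 = 0 by lra.
have /eqP : b ^+ 2 = 0 by lra.
have /eqP : q ^+ 2 = 0 by lra.
by rewrite !sqrf_eq0 => /eqP-> /eqP-> /eqP->.
Qed.

Lemma off_strands01 v : off_strands v 0 <-> off_strands v 1.
Proof.
split=> ok v0 j jn.
  by have [_ [k kn ->]] := strand_ends (R := R) wn jn; rewrite -(strand0 w k); exact: ok v0 k kn.
by have [[k kn E] _] := strand_ends (R := R) wn jn; rewrite strand0 -E; exact: ok v0 k kn.
Qed.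

(** Equality with a point of the closed braid forces equal moduli of the second coordinate, hence
    proportional homogeneous coordinates and angles equal up to the identification of 0 and 1, which
    [off_strands01] handles. *)
Lemma page_point_complement v t : page_ok v t -> (@S3 R `\` K) (page_point v t).
Proof.
move=> [t01 q0 v0 ok]; have r0 := page_radius_gt0 v0.
have rn0 : page_radius v != 0 by rewrite gt_eqF.
have r2 : page_radius v ^+ 2 = v.1.1 ^+ 2 + v.1.2 ^+ 2 + v.2 ^+ 2.
  by rewrite sqr_sqrtr// !addr_ge0 ?sqr_ge0.
have cs := cos2Dsin2 (2 * pi * t).
split.
  rewrite /S3 /= !expr_div_n !exprMn -!mulrDl -addrA -mulrDr cs mulr1 -r2.
  by rewrite mulfV// expf_neq0.
move=> [t' [z [t01' braid_z]]]; rewrite geometric_braidE// in braid_z.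
case: braid_z => j jn zE.
rewrite /solid_torus_embedding; set r := Num.sqrt _.
have r'0 : 0 < r.
  rewrite sqrtr_gt0; have := sqr_ge0 z.1; have := sqr_ge0 z.2; lra.
have r'n0 : r != 0 by rewrite gt_eqF.
have cs' := cos2Dsin2 (2 * pi * t').
case=> E1 E2 E3 E4.
have q2 : (v.2 / page_radius v) ^+ 2 = (r^-1) ^+ 2.
  have : (v.2 * cos (2 * pi * t) / page_radius v) ^+ 2 +
         (v.2 * sin (2 * pi * t) / page_radius v) ^+ 2 =
         (cos (2 * pi * t') / r) ^+ 2 + (sin (2 * pi * t') / r) ^+ 2.
    by rewrite E3 E4.
  rewrite !expr_div_n !exprMn -!mulrDl -mulrDr cs cs' mulr1 mul1r exprVn.
  by [].
have qr : v.2 / page_radius v = r^-1.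
  by apply/eqP; rewrite -(eqrXn2 (n := 2))// ?q2// ?divr_ge0// ?invr_ge0// ltW.
have qE : v.2 = page_radius v / r by rewrite -qr mulrC divfK.
have q_gt0 : 0 < v.2 by rewrite qE divr_gt0.
have ct : cos (2 * pi * t) = cos (2 * pi * t').
  move: E3; rewrite mulrAC qr mulrC => /(congr1 (fun x => x * r)).
  by rewrite !divfK.
have st : sin (2 * pi * t) = sin (2 * pi * t').
  move: E4; rewrite mulrAC qr mulrC => /(congr1 (fun x => x * r)).
  by rewrite !divfK.
have aE : v.1.1 = v.2 * z.1.
  by rewrite qE mulrAC -mulrA -E1 mulrC divfK.
have bE : v.1.2 = v.2 * z.2.
  by rewrite qE mulrAC -mulrA -E2 mulrC divfK.
have ok' : off_strands v t'.
  have [<-//|[t0 t1]|[t1 t0]] := angle_unique t01 t01' ct st.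
    by rewrite t1; apply/off_strands01; rewrite -t0.
  by rewrite t0; apply/off_strands01; rewrite -t1.
by apply: (ok' q_gt0 _ jn); rewrite -zE.
Qed.

Definition page_base : X :=
  exist _ (axis_point R) (@axis_point_complement R n w).

(** Total, with the base point as default value: loops can be written down before admissibility is
    proved, and [page01] holds for every [v]. *)
Definition page v t : X :=
  match pselect (page_ok v t) with
  | left ok => exist _ (page_point v t) (mem_set (page_point_complement ok))
  | right _ => page_base
  end.

Lemma val_page v t : page_ok v t -> \val (page v t) = page_point v t.
Proof. by rewrite /page; case: pselect. Qed.

Lemma page_junk v t : ~ page_ok v t -> page v t = page_base.
Proof. by rewrite /page; case: pselect. Qed.

Lemma page_eq v t v' t' : page_ok v t -> page_ok v' t' ->
  page_point v t = page_point v' t' -> page v t = page v' t'.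
Proof. by move=> ok ok' E; apply: val_inj; rewrite !val_page. Qed.

Lemma page01 v : page v 0 = page v 1.
Proof.
have ok01 : page_ok v 0 <-> page_ok v 1.
  split=> -[_ v2 v0 ok]; split; rewrite ?lexx ?ler01//; exact/off_strands01.
have [ok|nok] := pselect (page_ok v 0).
  apply: page_eq => //; first exact/ok01.
  rewrite /page_point mulr0 mulr1 cos0 sin0.
  by rewrite (_ : 2 * pi = pi *+ 2) ?cos2pi ?sin2pi// mulrC mulr_natr.
by rewrite !page_junk// -ok01.
Qed.

Lemma page_base_eq t : 0 <= t <= 1 -> page ((1, 0), 0) t = page_base.
Proof.
move=> t01; have v0 : ((1, 0), 0) != 0 :> R * R * R.
  by apply/eqP => -[/eqP]; rewrite oner_eq0.
apply: val_inj; rewrite val_page; last by split=> //; rewrite /off_strands ltxx.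
rewrite /page_point /page_radius /= expr1n expr0n /= !addr0 sqrtr1 invr1 !mulr1 !mul0r.
by [].
Qed.

Lemma page_continuous {Z : topologicalType} (f : Z -> R * R * R) (g : Z -> R) :
  continuous f -> continuous g -> (forall z, page_ok (f z) (g z)) ->
  continuous (fun z => page (f z) (g z)).
Proof.
move=> cf cg ok; apply: continuous_comp_initial.
rewrite (_ : _ \o _ = fun z => page_point (f z) (g z)); last first.
  by apply/funext => z; exact: val_page (ok z).
rewrite /page_point /page_radius.
have nz z : Num.sqrt ((f z).1.1 ^+ 2 + (f z).1.2 ^+ 2 + (f z).2 ^+ 2) != 0.
  by case: (ok z) => _ _ /page_radius_gt0; rewrite /page_radius => /gt_eqF ->.
by apply: cts_pair; apply: cts_pair; apply: cts_div => //; cts'.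
Qed.

End pages.

(** * Loops in the knot complement *)

Section loop_classes.
Context {R : realType} {X : topologicalType} (x0 : X).
Local Notation I := (unit_interval R).
Implicit Types f g : I -> X.

Definition is_loop f : Prop := [/\ continuous f, f zero = x0 & f one = x0].

Definition loop_of f : loop R x0 :=
  match pselect (is_loop f) with
  | left (And3 cf f0 f1) => mk_path cf f0 f1
  | right _ => loop_cst R x0
  end.

Lemma loop_ofE f : is_loop f -> (loop_of f : I -> X) = f.
Proof. by rewrite /loop_of; case: pselect => // -[]. Qed.

Definition loop_class f : fundamental_group R x0 := homotopy_class (loop_of f).

Lemma loop_class_eq f g : is_loop f -> is_loop g -> path_homotopic f g ->
  loop_class f = loop_class g.
Proof. by move=> lf lg fg; apply/homotopy_classP; rewrite !loop_ofE. Qed.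

Lemma is_loop_cat f g : is_loop f -> is_loop g -> is_loop (path_cat f g).
Proof.
move=> [cf f0 f1] [cg g0 g1]; split; rewrite ?path_cat0 ?path_cat1//.
by apply: path_cat_continuous; rewrite ?f1 ?g0.
Qed.

Lemma is_loop_rev f : is_loop f -> is_loop (path_rev f).
Proof.
move=> [cf f0 f1]; split; rewrite ?path_rev0 ?path_rev1//.
exact: path_rev_continuous.
Qed.

Lemma loop_class_cat f g : is_loop f -> is_loop g ->
  loop_class (path_cat f g) = (loop_class f * loop_class g)%g.
Proof.
move=> lf lg; rewrite -homotopy_classM; congr homotopy_class.
apply/path_eqP => t; rewrite loop_ofE; last exact: is_loop_cat.
by rewrite -{1}(loop_ofE lf) -{1}(loop_ofE lg).
Qed.

Lemma loop_class_rev f : is_loop f -> loop_class (path_rev f) = (loop_class f)^-1%g.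
Proof.
move=> lf; rewrite -homotopy_classV; congr homotopy_class.
apply/path_eqP => t; rewrite loop_ofE; last exact: is_loop_rev.
by rewrite -{1}(loop_ofE lf).
Qed.

Lemma loop_class_cst : loop_class (cst x0) = 1%g.
Proof.
rewrite -homotopy_class1; congr homotopy_class; apply/path_eqP => t.
by rewrite loop_ofE//; split => //; exact: cst_continuous.
Qed.

End loop_classes.

(** * Polygonal loops in homogeneous coordinates *)

Section polygons.
Context {R : realType}.
Local Notation I := (unit_interval R).
Local Notation V := (R * R * R)%type.
Implicit Types (u v : V) (s : R) (f g : I -> V).

(** Interpolation takes place before normalisation, so that points of the axis are treated like the
    others; from [axis_below] to a point off the axis it runs along a vertical ray of the page. *)
Definition mix s u v : V :=
  (((1 - s) * u.1.1 + s * v.1.1, (1 - s) * u.1.2 + s * v.1.2),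
   (1 - s) * u.2 + s * v.2).

Definition segment u v : I -> V := fun t => mix (of_itv t) u v.

Lemma mix0 u v : mix 0 u v = u.
Proof. by case: u => [[a b] q]; rewrite /mix subr0 !mul1r !mul0r !addr0. Qed.

Lemma mix1 u v : mix 1 u v = v.
Proof. by case: v => [[a b] q]; rewrite /mix subrr !mul1r !mul0r !add0r. Qed.

Lemma mixx s u : mix s u u = u.
Proof.
case: u => [[a b] q]; rewrite /mix /= -!mulrDl (_ : 1 - s + s = 1); last by ring.
by rewrite !mul1r.
Qed.

Lemma segment0 u v : segment u v zero = u.
Proof. by rewrite /segment of_itv0 mix0. Qed.

Lemma segment1 u v : segment u v one = v.
Proof. by rewrite /segment of_itv1 mix1. Qed.

Lemma segmentxx u : segment u u = cst u.
Proof. by apply/funext => t; exact: mixx. Qed.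

Lemma mix_continuous {Z : topologicalType} (s : Z -> R) (u v : Z -> V) :
  continuous s -> continuous u -> continuous v ->
  continuous (fun z => mix (s z) (u z) (v z)).
Proof. by move=> cs cu cv; rewrite /mix; cts'. Qed.

Lemma segment_continuous u v : continuous (segment u v).
Proof. by apply: mix_continuous; cts. Qed.

Lemma path_rev_segment u v : path_rev (segment u v) = segment v u.
Proof.
apply/funext => t; rewrite /path_rev /segment to_itvE.
  by rewrite /mix; congr (_, _, _); ring.
by have /andP[? ?] := of_itvP t; apply/andP; split; lra.
Qed.

Lemma path_rev_cat {T : topologicalType} (f g : I -> T) : f one = g zero ->
  path_rev (path_cat f g) = path_cat (path_rev g) (path_rev f).
Proof.
move=> fg; apply/funext => t; have /andP[t0 t1] := of_itvP t.
rewrite /path_rev /path_cat to_itvE; last by apply/andP; split; lra.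
have [t2|t2] := leP (of_itv t) 2^-1; have [t2'|t2'] := leP (1 - of_itv t) 2^-1.
- rewrite to_itv_ge1; last lra.
  by rewrite to_itvE; [rewrite fg (to_itv_le0 (r := 1 - _))//; lra | apply/andP; split; lra].
- rewrite (to_itvE (r := 2 * of_itv t)); last by apply/andP; split; lra.
  by congr (g (to_itv _)); ring.
- rewrite (to_itvE (r := 2 * of_itv t - 1)); last by apply/andP; split; lra.
  by congr (f (to_itv _)); ring.
- by clear fg; exfalso; lra.
Qed.

Lemma path_cat_cst {T : topologicalType} (x : T) : path_cat (cst x) (cst x) = cst x :> (I -> T).
Proof. by apply/funext => t; rewrite /path_cat; case: ifP. Qed.

Definition convex (P : set V) : Prop := forall s u v, 0 <= s <= 1 ->
  P u -> P v -> P (mix s u v).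

(** The straight-line homotopy stays in [P]. For polygons with matching sides it is enough that each
    pair of sides lies in a convex part of [P], which reduces homotopies to linear inequalities at
    the vertices. *)
Definition pairwise_mix (P : V -> Prop) f g : Prop :=
  forall t s, 0 <= s <= 1 -> P (mix s (f t) (g t)).

Lemma pairwise_mix_cat P f f' g g' : pairwise_mix P f g -> pairwise_mix P f' g' ->
  pairwise_mix P (path_cat f f') (path_cat g g').
Proof.
by move=> fg fg' t s s01; rewrite /path_cat; case: ifP => _; [exact: fg|exact: fg'].
Qed.

Lemma pairwise_mix_segment P Q u v u' v' : convex Q -> Q `<=` P ->
  Q u -> Q v -> Q u' -> Q v' -> pairwise_mix P (segment u v) (segment u' v').
Proof.
move=> cQ QP Qu Qv Qu' Qv' t s s01; apply: (QP); apply: (cQ) => //;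
by apply: (cQ) => //; exact: of_itvP.
Qed.

Lemma pairwise_mixl P f g : pairwise_mix P f g -> forall t, P (f t).
Proof. by move=> fg t; rewrite -(mix0 (f t) (g t)); apply: fg; rewrite lexx ler01. Qed.

(* The base point, and the points -i and i of the axis at infinity. *)
Definition axis_base : V := ((1, 0), 0).
Definition axis_below : V := ((0, -1), 0).
Definition axis_above : V := ((0, 1), 0).

Definition gap_loop (c : R) : I -> V :=
  path_cat (path_cat (segment axis_base axis_below) (segment axis_below ((c, 0), 1)))
           (path_cat (segment ((c, 0), 1) axis_above) (segment axis_above axis_base)).

(* Encircles from below the point (x, y) of the page. *)
Definition lasso (x y : R) : I -> V :=
  path_cat
    (path_cat (path_cat (segment axis_base axis_below)
                        (segment axis_below ((x + 2^-1, y), 1)))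
              (path_cat (segment ((x + 2^-1, y), 1) ((x + 2^-1, y + 2^-1), 1))
                        (segment ((x + 2^-1, y + 2^-1), 1) ((x, y + 2^-1), 1))))
    (path_cat (path_cat (segment ((x, y + 2^-1), 1) ((x - 2^-1, y + 2^-1), 1))
                        (segment ((x - 2^-1, y + 2^-1), 1) ((x - 2^-1, y), 1)))
              (path_cat (segment ((x - 2^-1, y), 1) axis_below)
                        (segment axis_below axis_base))).

Lemma gap_loop_ends c : gap_loop c zero = axis_base /\ gap_loop c one = axis_base.
Proof. by rewrite /gap_loop !path_cat0 !path_cat1 segment0 segment1. Qed.

Lemma lasso_ends x y : lasso x y zero = axis_base /\ lasso x y one = axis_base.
Proof. by rewrite /lasso !path_cat0 !path_cat1 segment0 segment1. Qed.

Lemma gap_loop_continuous c : continuous (gap_loop c).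
Proof.
by do !apply: path_cat_continuous;
  rewrite ?path_cat0 ?path_cat1 ?segment0 ?segment1//; exact: segment_continuous.
Qed.

Lemma path_rev_gap_loop c : path_rev (gap_loop c) =
  path_cat (path_cat (segment axis_base axis_above) (segment axis_above ((c, 0), 1)))
           (path_cat (segment ((c, 0), 1) axis_below) (segment axis_below axis_base)).
Proof.
by rewrite !path_rev_cat ?path_rev_segment// ?path_cat0 ?path_cat1 ?segment0 ?segment1.
Qed.

Definition continuous_family {Z : topologicalType} (f : Z -> I -> V) : Prop :=
  continuous (fun z : Z * I => f z.1 z.2).

Lemma path_cat_family {Z : topologicalType} (f g : Z -> I -> V) :
  continuous_family f -> continuous_family g -> (forall z, f z one = g z zero) ->
  continuous_family (fun z => path_cat (f z) (g z)).
Proof.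
move=> cf cg fg; rewrite /continuous_family /path_cat.
apply: pasting_continuous.
- by cts.
- by cts.
- apply: (@cts_comp _ _ _ (fun z : Z * I => (z.1, to_itv (2 * of_itv z.2)))
    (fun z : Z * I => f z.1 z.2)) => //.
  by cts.
- apply: (@cts_comp _ _ _ (fun z : Z * I => (z.1, to_itv (2 * of_itv z.2 - 1)))
    (fun z : Z * I => g z.1 z.2)) => //.
  by cts.
- move=> z -> /=; rewrite to_itv_ge1; last lra.
  by rewrite to_itv_le0; [rewrite fg|lra].
Qed.

Lemma segment_family {Z : topologicalType} (u v : Z -> V) :
  continuous u -> continuous v -> continuous_family (fun z => segment (u z) (v z)).
Proof.
move=> cu cv; apply: mix_continuous; first by cts.
- by apply: (@cts_comp _ _ _ fst u) => //; exact: cts_fst.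
- by apply: (@cts_comp _ _ _ fst v) => //; exact: cts_fst.
Qed.

Lemma lasso_family {Z : topologicalType} (x y : Z -> R) :
  continuous x -> continuous y -> continuous_family (fun z => lasso (x z) (y z)).
Proof.
move=> cx cy; rewrite /lasso.
apply: path_cat_family; [|..|by move=> z; rewrite !(path_cat0, path_cat1, segment0, segment1)];
apply: path_cat_family; try by move=> z; rewrite !(path_cat0, path_cat1, segment0, segment1).
all: apply: path_cat_family; try by move=> z; rewrite !(path_cat0, path_cat1, segment0, segment1).
all: by apply: segment_family; cts.
Qed.

End polygons.

Section page_loops.
Context {R : realType} (n : nat) (w : seq nat).
Hypothesis wn : braid_word n w.
Local Notation I := (unit_interval R).
Local Notation V := (R * R * R)%type.
Local Notation pg := (page (R := R) wn).
Local Notation x0 := (page_base (R := R) n w).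
Local Notation ok := (page_ok (R := R) n w).
Implicit Types (f g : I -> V) (t : R).

Definition page_class f t : fundamental_group R x0 := loop_class x0 (fun s => pg (f s) t).

Lemma is_loop_page f t : 0 <= t <= 1 -> continuous f -> f zero = axis_base ->
  f one = axis_base -> (forall s, ok (f s) t) -> is_loop x0 (fun s => pg (f s) t).
Proof.
move=> t01 cf f0 f1 okf; split; rewrite ?f0 ?f1 ?page_base_eq//.
by apply: page_continuous => //; cts.
Qed.

Lemma page_class_cat f g t : 0 <= t <= 1 -> continuous f -> continuous g ->
  f zero = axis_base -> f one = axis_base -> g zero = axis_base -> g one = axis_base ->
  (forall s, ok (f s) t) -> (forall s, ok (g s) t) ->
  page_class (path_cat f g) t = (page_class f t * page_class g t)%g.
Proof.
move=> t01 cf cg f0 f1 g0 g1 okf okg.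
rewrite -loop_class_cat; [|exact: is_loop_page..].
by congr loop_class; apply/funext => s; rewrite /path_cat; case: ifP.
Qed.

Lemma page_class_rev f t : 0 <= t <= 1 -> continuous f ->
  f zero = axis_base -> f one = axis_base -> (forall s, ok (f s) t) ->
  page_class (path_rev f) t = (page_class f t)^-1%g.
Proof. by move=> *; rewrite -loop_class_rev//; exact: is_loop_page. Qed.

(** The page may move with the homotopy parameter; this is how a loop is carried through a
    crossing. *)
Lemma page_class_homotopy (F : I -> I -> V) (t : I -> R) :
  continuous_family F -> continuous t -> (forall s, 0 <= t s <= 1) ->
  (forall s, F s zero = axis_base) -> (forall s, F s one = axis_base) ->
  (forall s u, ok (F s u) (t s)) ->
  page_class (F zero) (t zero) = page_class (F one) (t one).
Proof.
move=> cF ct t01 F0 F1 okF.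
have cFs s : continuous (F s).
  apply: (@cts_comp _ _ _ (fun u => (s, u)) (fun z : I * I => F z.1 z.2)) => //.
  by cts.
apply: loop_class_eq; try exact: is_loop_page.
exists (fun z => pg (F z.2 z.1) (t z.2)); split=> //.
- apply: page_continuous => //.
    apply: (@cts_comp _ _ _ (fun u => (u.2, u.1)) (fun z : I * I => F z.1 z.2)) => //.
    by cts.
  by apply: (@cts_comp _ _ _ snd t) => //; exact: cts_snd.
- by move=> s; rewrite !F0 !page_base_eq.
- by move=> s; rewrite !F1 !page_base_eq.
Qed.

Lemma page_class_mix f g t : 0 <= t <= 1 -> continuous f -> continuous g ->
  f zero = axis_base -> f one = axis_base -> g zero = axis_base -> g one = axis_base ->
  pairwise_mix (ok^~ t) f g -> page_class f t = page_class g t.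
Proof.
move=> t01 cf cg f0 f1 g0 g1 fg.
pose F (s u : I) := mix (of_itv s) (f u) (g u).
have F0 : F zero = f by apply/funext => u; rewrite /F of_itv0 mix0.
have F1 : F one = g by apply/funext => u; rewrite /F of_itv1 mix1.
rewrite -F0 -F1; apply: (page_class_homotopy (t := cst t)) => //.
- apply: mix_continuous; first by cts.
    by apply: (@cts_comp _ _ _ snd f) => //; exact: cts_snd.
  by apply: (@cts_comp _ _ _ snd g) => //; exact: cts_snd.
- exact: cst_continuous.
- by move=> s; rewrite /F f0 g0 mixx.
- by move=> s; rewrite /F f1 g1 mixx.
- by move=> s u; apply: fg; exact: of_itvP.
Qed.

End page_loops.

Section half_spaces.
Context {R : realType}.
Local Notation V := (R * R * R)%type.

Definition linform (x y z : R) (v : V) : R := x * v.1.1 + y * v.1.2 + z * v.2.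

Lemma linform_mix x y z s u v : linform x y z (mix s u v) =
  (1 - s) * linform x y z u + s * linform x y z v.
Proof. by rewrite /linform /mix /=; ring. Qed.

Lemma convexI (P Q : set V) : convex P -> convex Q -> convex (P `&` Q).
Proof.
by move=> cP cQ s u v s01 [Pu Qu] [Pv Qv]; split; [exact: cP|exact: cQ].
Qed.

Lemma convex_eq0 x y z : convex [set v | linform x y z v = 0].
Proof. by move=> s u v s01 /= u0 v0; rewrite linform_mix u0 v0 !mulr0 addr0. Qed.

Lemma convex_ge0 x y z : convex [set v | 0 <= linform x y z v].
Proof.
move=> s u v /andP[s0 s1] /= u0 v0; rewrite linform_mix.
by rewrite addr_ge0// mulr_ge0// subr_ge0.
Qed.

Lemma convex_gt0 x y z : convex [set v | 0 < linform x y z v].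
Proof.
move=> s u v /andP[s0 s1] /= u0 v0; rewrite linform_mix.
have [->|sn1] := eqVneq s 1; first by rewrite subrr mul0r mul1r add0r.
by rewrite ltr_pwDl ?mulr_gt0 ?mulr_ge0 ?(ltW v0)// subr_gt0 lt_neqAle sn1.
Qed.

End half_spaces.

Ltac convexity := repeat first
  [ apply: convexI | exact: convex_eq0 | exact: convex_ge0 | exact: convex_gt0 ].

Ltac in_half_spaces := repeat split; rewrite /linform /=; lra.

(** * Gap loops and lassos while the strands are at rest *)

Section gap_relations.
Context {R : realType} (n : nat) (w : seq nat).
Hypothesis wn : braid_word n w.
Local Notation I := (unit_interval R).
Local Notation V := (R * R * R)%type.
Local Notation ok := (page_ok (R := R) n w).
Implicit Types (t c : R).

Definition at_rest t : Prop := 0 <= t <= 1 /\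
  forall j, (1 <= j <= n)%N -> exists2 k, (1 <= k <= n)%N & strand w j t = (k%:R, 0).

Definition gap k : R := k%:R + 2^-1.

Lemma gap_neq k j : gap k != j%:R.
Proof.
apply/eqP => E.
have : (k.*2.+1)%:R = j.*2%:R :> R.
  by rewrite -addn1 natrD -!mul2n !natrM -E /gap; lra.
by move/eqP; rewrite eqr_nat => /eqP/(congr1 odd); rewrite /= !odd_double.
Qed.

Lemma rest_ok t (v : V) : at_rest t -> 0 <= v.2 -> v != 0 ->
  (0 < v.2 -> v.1.2 = 0 -> forall k, (1 <= k <= n)%N -> v.1.1 <> v.2 * k%:R) -> ok v t.
Proof.
move=> [t01 rest] v2 v0 H; split=> // q0 j jn [].
have [k kn ->] := rest j jn; rewrite mulr0 => aE bE.
exact: H q0 bE k kn aE.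
Qed.

(** One of several convex regions of admissible points in which sides of loops are moved. The strict
    inequality keeps out the origin, which represents no point; here it leaves an arc of the axis
    through the base point and -i. *)
Definition axis_set : set V := [set v | linform 0 0 1 v = 0] `&` [set v | 0 < linform 1 (-1) 0 v].

Lemma axis_set_ok t : 0 <= t <= 1 -> axis_set `<=` (ok^~ t).
Proof.
move=> t01 [[a b] q]; rewrite /axis_set /linform /= => -[/= q0 ab].
have {}q0 : q = 0 by lra.
subst q; split=> //; last by rewrite /off_strands ltxx.
by apply/eqP => -[a0 b0]; move: ab; rewrite a0 b0; lra.
Qed.

Definition below_set c : set V := [set v | linform 1 0 (- c) v = 0] `&`
  [set v | 0 <= linform 0 0 1 v] `&` [set v | 0 < linform 0 (-1) 1 v].

Definition above_set c : set V := [set v | linform 1 0 (- c) v = 0] `&`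
  [set v | 0 <= linform 0 0 1 v] `&` [set v | 0 < linform 0 1 1 v].

Lemma below_set_ok t k : at_rest t -> below_set (gap k) `<=` (ok^~ t).
Proof.
move=> rest [[a b] q]; rewrite /below_set /linform /= => -[[/= aE q0] bq].
apply: rest_ok => //=; first lra.
  by apply/eqP => -[a0 b0 q0']; move: bq; rewrite b0 q0'; lra.
move=> q_gt0 b0 j _ aE'; have /eqP := gap_neq k j; apply.
by apply: (mulfI (lt0r_neq0 q_gt0)); rewrite -aE'; lra.
Qed.

Lemma above_set_ok t k : at_rest t -> above_set (gap k) `<=` (ok^~ t).
Proof.
move=> rest [[a b] q]; rewrite /above_set /linform /= => -[[/= aE q0] bq].
apply: rest_ok => //=; first lra.
  by apply/eqP => -[a0 b0 q0']; move: bq; rewrite b0 q0'; lra.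
move=> q_gt0 b0 j _ aE'; have /eqP := gap_neq k j; apply.
by apply: (mulfI (lt0r_neq0 q_gt0)); rewrite -aE'; lra.
Qed.

(** Points at height at least 1/2, out of reach of strands at rest, together with an arc of the axis
    through the base point and i. *)
Definition upper_set : set V := [set v | 0 <= linform 0 0 1 v] `&`
  [set v | 0 <= linform 0 2 (-1) v] `&` [set v | 0 < linform 1 1 0 v].

Lemma upper_set_ok t : at_rest t -> upper_set `<=` (ok^~ t).
Proof.
move=> rest [[a b] q]; rewrite /upper_set /linform /= => -[[/= q0 bq] ab].
apply: rest_ok => //=; first lra.
  by apply/eqP => -[a0 b0 q0']; move: ab; rewrite a0 b0; lra.
by move=> q_gt0 b0; exfalso; lra.
Qed.

Definition right_below_set : set V := [set v | 0 <= linform 0 0 1 v] `&`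
  [set v | 0 <= linform 1 0 (- gap n) v] `&` [set v | 0 < linform 1 (-1) 0 v].

Definition right_above_set : set V := [set v | 0 <= linform 0 0 1 v] `&`
  [set v | 0 <= linform 1 0 (- gap n) v] `&` [set v | 0 < linform 1 1 0 v].

Lemma right_side (a q : R) k : 0 < q -> (k <= n)%N -> 0 <= a - gap n * q -> a <> q * k%:R.
Proof.
rewrite /gap => q0; rewrite -(ler_nat R) => kn aq aE; nra.
Qed.

Lemma right_below_set_ok t : at_rest t -> right_below_set `<=` (ok^~ t).
Proof.
move=> rest [[a b] q]; rewrite /right_below_set /linform /= => -[[/= q0 aq] ab].
apply: rest_ok => //=; first lra.
  by apply/eqP => -[a0 b0 q0']; move: ab; rewrite a0 b0; lra.
move=> q_gt0 b0 k /andP[_ kn]; apply: right_side => //; lra.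
Qed.

Lemma right_above_set_ok t : at_rest t -> right_above_set `<=` (ok^~ t).
Proof.
move=> rest [[a b] q]; rewrite /right_above_set /linform /= => -[[/= q0 aq] ab].
apply: rest_ok => //=; first lra.
  by apply/eqP => -[a0 b0 q0']; move: ab; rewrite a0 b0; lra.
move=> q_gt0 b0 k /andP[_ kn]; apply: right_side => //; lra.
Qed.

Lemma gap_loop_rest t k : at_rest t -> pairwise_mix (ok^~ t) (gap_loop (gap k)) (gap_loop (gap k)).
Proof.
move=> rest; have t01 := rest.1.
apply: pairwise_mix_cat; apply: pairwise_mix_cat.
- by apply: (pairwise_mix_segment _ (axis_set_ok t01)); [convexity|in_half_spaces..].
- by apply: (pairwise_mix_segment _ (@below_set_ok t k rest)); [convexity|in_half_spaces..].
- by apply: (pairwise_mix_segment _ (@above_set_ok t k rest)); [convexity|in_half_spaces..].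
- by apply: (pairwise_mix_segment _ (upper_set_ok rest)); [convexity|in_half_spaces..].
Qed.

(** To the right of all strands the loop shrinks to the base point, its lower and upper halves in
    two convex regions that both contain this point. *)
Lemma gap_loop_last t : at_rest t -> page_class wn (gap_loop (gap n)) t = 1%g.
Proof.
move=> rest; have t01 := rest.1.
have [f0 f1] := @gap_loop_ends R (gap n).
rewrite (@page_class_mix _ _ _ wn _ (cst axis_base))//.
- by rewrite /page_class (_ : (fun=> _) = cst (page_base n w)) ?loop_class_cst//;
  apply/funext => s; rewrite page_base_eq.
- exact: gap_loop_continuous.
- exact: cst_continuous.
rewrite -path_cat_cst -[X in path_cat X X]path_cat_cst -segmentxx.
have g0 : 0 < gap n by rewrite /gap; have := ler0n R n; lra.
apply: pairwise_mix_cat; apply: pairwise_mix_cat.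
- by apply: (pairwise_mix_segment _ (right_below_set_ok rest)); [convexity|in_half_spaces..].
- by apply: (pairwise_mix_segment _ (right_below_set_ok rest)); [convexity|in_half_spaces..].
- by apply: (pairwise_mix_segment _ (right_above_set_ok rest)); [convexity|in_half_spaces..].
- by apply: (pairwise_mix_segment _ (right_above_set_ok rest)); [convexity|in_half_spaces..].
Qed.

(** Both loops have eight sides, matched one by one. The visit of the product to the base point
    between its two factors is pulled down to the vertex (k, 1/2) of the lasso within
    [upper_set]. *)
Lemma lasso_rest t k : at_rest t -> (0 < k)%N ->
  page_class wn (lasso k%:R 0) t =
  (page_class wn (gap_loop (gap k)) t * (page_class wn (gap_loop (gap k.-1)) t)^-1)%g.
Proof.
move=> rest k0; have t01 := rest.1.
have k1 : 1 <= k%:R :> R by rewrite ler1n.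
have gk : gap k.-1 = k%:R - 2^-1.
  by rewrite /gap -subn1 natrB//; lra.
have okg k' := pairwise_mixl (gap_loop_rest k' rest).
have [f0 f1] := @gap_loop_ends R (gap k).
have [g0 g1] := @gap_loop_ends R (gap k.-1).
have [l0 l1] := @lasso_ends R k%:R 0.
have cgl := @gap_loop_continuous R.
rewrite -page_class_rev// -page_class_cat ?path_rev0 ?path_rev1//; last 2 first.
  exact: path_rev_continuous.
  by move=> s; exact: okg.
apply: page_class_mix => //; rewrite ?path_cat0 ?path_cat1 ?path_rev1//.
- have := @lasso_family R R (cst k%:R) (cst 0) (@cst_continuous _ _ _) (@cst_continuous _ _ _).
  move=> cl; apply: (@cts_comp _ _ _ (fun u => (0 : R, u)) (fun z : R * I => lasso k%:R 0 z.2)) => //.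
  by cts.
- apply: path_cat_continuous => //; last by rewrite path_rev0 f1 g1.
  exact: path_rev_continuous.
rewrite path_rev_gap_loop; apply: pairwise_mix_cat; apply: pairwise_mix_cat; apply: pairwise_mix_cat.
- by apply: (pairwise_mix_segment _ (axis_set_ok t01)); [convexity|in_half_spaces..].
- by apply: (pairwise_mix_segment _ (@below_set_ok t k rest)); rewrite /gap; [convexity|in_half_spaces..].
- by apply: (pairwise_mix_segment _ (@above_set_ok t k rest)); rewrite /gap; [convexity|in_half_spaces..].
- by apply: (pairwise_mix_segment _ (upper_set_ok rest)); rewrite /gap; [convexity|in_half_spaces..].
- by apply: (pairwise_mix_segment _ (upper_set_ok rest)); [convexity|in_half_spaces..].
- by apply: (pairwise_mix_segment _ (@above_set_ok t k.-1 rest)); rewrite gk; [convexity|in_half_spaces..].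
- by apply: (pairwise_mix_segment _ (@below_set_ok t k.-1 rest)); rewrite gk; [convexity|in_half_spaces..].
- by apply: (pairwise_mix_segment _ (axis_set_ok t01)); [convexity|in_half_spaces..].
Qed.

End gap_relations.

(** * Carrying loops through a crossing *)

Section crossing_relations.
Context {R : realType} (n : nat) (w : seq nat).
Hypothesis wn : braid_word n w.
Local Notation I := (unit_interval R).
Local Notation V := (R * R * R)%type.
Local Notation ok := (page_ok (R := R) n w).
Local Notation gap := (@gap R).
Local Notation gap_class k t := (page_class wn (gap_loop (gap k)) t).
Implicit Types (t c : R).

Lemma page_ok_intro t (v : V) : 0 <= t <= 1 -> 0 <= v.2 -> v != 0 ->
  (0 < v.2 -> forall j x y, (1 <= j <= n)%N -> strand w j t = (x, y) ->
     v.1.1 = v.2 * x -> v.1.2 = v.2 * y -> False) -> ok v t.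
Proof.
move=> t01 v2 v0 H; split=> // q0 j jn [aE bE].
by apply: (H q0 j _ _ jn _ aE bE); exact: surjective_pairing.
Qed.

Lemma column_ok t c : 0 <= t <= 1 ->
  (forall j x y, (1 <= j <= n)%N -> strand w j t = (x, y) -> x <> c) ->
  below_set c `<=` (ok^~ t) /\ above_set c `<=` (ok^~ t).
Proof.
move=> t01 H; split=> -[[a b] q]; rewrite /below_set /above_set /linform /= => -[[/= aE q0] bq].
  apply: page_ok_intro => //=; first lra.
    by apply/eqP => -[a0 b0 q0']; move: bq; rewrite b0 q0'; lra.
  move=> q_gt0 j x y jn jE aE' _; apply: (H _ _ _ jn jE).
  by apply: (mulfI (lt0r_neq0 q_gt0)); rewrite -aE'; lra.
apply: page_ok_intro => //=; first lra.
  by apply/eqP => -[a0 b0 q0']; move: bq; rewrite b0 q0'; lra.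
move=> q_gt0 j x y jn jE aE' _; apply: (H _ _ _ jn jE).
by apply: (mulfI (lt0r_neq0 q_gt0)); rewrite -aE'; lra.
Qed.

Definition axis_set' : set V := [set v | linform 0 0 1 v = 0] `&` [set v | 0 < linform 1 1 0 v].

Lemma axis_set'_ok t : 0 <= t <= 1 -> axis_set' `<=` (ok^~ t).
Proof.
move=> t01 [[a b] q]; rewrite /axis_set' /linform /= => -[/= q0 ab].
have {}q0 : q = 0 by lra.
subst q; apply: page_ok_intro => //=; rewrite ?ltxx//.
by apply/eqP => -[a0 b0]; move: ab; rewrite a0 b0; lra.
Qed.

Lemma gap_loop_column t c : 0 <= t <= 1 ->
  (forall j x y, (1 <= j <= n)%N -> strand w j t = (x, y) -> x <> c) ->
  forall s, ok (gap_loop c s) t.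
Proof.
move=> t01 H; apply: (@pairwise_mixl _ (ok^~ t) _ (gap_loop c)).
have [lo hi] := column_ok t01 H.
apply: pairwise_mix_cat; apply: pairwise_mix_cat.
- by apply: (pairwise_mix_segment _ (axis_set_ok _ _ t01)); [convexity|in_half_spaces..].
- by apply: (pairwise_mix_segment _ lo); [convexity|in_half_spaces..].
- by apply: (pairwise_mix_segment _ hi); [convexity|in_half_spaces..].
- by apply: (pairwise_mix_segment _ (axis_set'_ok t01)); [convexity|in_half_spaces..].
Qed.

Definition time_mix (t0 t1 s : R) : R := (1 - s) * t0 + s * t1.

Lemma time_mix01 t0 t1 s : 0 <= t0 <= 1 -> 0 <= t1 <= 1 -> 0 <= s <= 1 ->
  0 <= time_mix t0 t1 s <= 1.
Proof.
rewrite /time_mix => /andP[? ?] /andP[? ?] /andP[? ?]; apply/andP; split; nra.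
Qed.

Lemma time_mix_zero t0 t1 : time_mix t0 t1 (of_itv zero) = t0.
Proof. by rewrite /time_mix of_itv0 subr0 mul1r mul0r addr0. Qed.

Lemma time_mix_one t0 t1 : time_mix t0 t1 (of_itv one) = t1.
Proof. by rewrite /time_mix of_itv1 subrr mul1r mul0r add0r. Qed.

Lemma gap_class_constant t0 t1 k : 0 <= t0 <= 1 -> 0 <= t1 <= 1 ->
  (forall s j x y, 0 <= s <= 1 -> (1 <= j <= n)%N ->
     strand w j (time_mix t0 t1 s) = (x, y) -> x <> gap k) ->
  gap_class k t0 = gap_class k t1.
Proof.
move=> t01 t11 H.
have := @page_class_homotopy R n w wn (fun=> gap_loop (gap k))
  (fun s : I => time_mix t0 t1 (of_itv s)).
rewrite /= time_mix_zero time_mix_one; apply.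
- apply: (@cts_comp _ _ _ snd (gap_loop (gap k))); last exact: cts_snd.
  exact: gap_loop_continuous.
- by rewrite /time_mix; cts'.
- by move=> s; apply: time_mix01 => //; exact: of_itvP.
- by move=> s; have [] := gap_loop_ends (gap k).
- by move=> s; have [] := gap_loop_ends (gap k).
move=> s u; apply: gap_loop_column.
  by apply: time_mix01 => //; exact: of_itvP.
by move=> j x y jn; apply: H => //; exact: of_itvP.
Qed.

(** The strands of [w] are matched with those of sigma_i only up to renumbering, since earlier
    letters have permuted them. *)
Definition crossing_stage i t0 t1 : Prop :=
  forall s j, 0 <= s <= 1 -> (1 <= j <= n)%N ->
    exists2 k, (1 <= k <= n)%N & strand w j (time_mix t0 t1 s) = crossing_strand i k s.

Lemma stage_rest i t0 t1 : 0 <= t0 <= 1 -> 0 <= t1 <= 1 -> (0 < i < n)%N ->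
  crossing_stage i t0 t1 -> at_rest n w t0 /\ at_rest n w t1.
Proof.
move=> t01 t11 i_n H; split; split=> // j jn.
  have [|k kn] := H 0 j _ jn; first by rewrite lexx ler01.
  rewrite /time_mix subr0 mul1r mul0r addr0 crossing_strand0 => ->.
  by exists k.
have [|k kn] := H 1 j _ jn; first by rewrite lexx ler01.
rewrite /time_mix subrr mul1r mul0r add0r crossing_strand1 => ->.
by exists (transpose i k); rewrite ?transpose_range.
Qed.

(** The crossing strands stay over [i, i + 1], so only the i-th gap can be closed. *)
Lemma crossing_column i j k s x y : k != i -> crossing_strand i j s = (x, y) -> x <> gap k.
Proof.
move=> ki; rewrite /crossing_strand.
have c1 := cos_geN1 (pi * s); have c2 := cos_le1 (pi * s).
have ki' : gap k < i%:R \/ i%:R + 1 < gap k.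
  case: (ltngtP k i) ki => // [ki _|ik _].
    left; have : k%:R + 1 <= i%:R :> R by rewrite natr1 ler_nat.
    by rewrite /gap; lra.
  right; have : i%:R + 1 <= k%:R :> R by rewrite natr1 ler_nat.
  by rewrite /gap; lra.
case: eqP => _; first by move=> [<- _]; lra.
case: eqP => _; first by move=> [<- _]; lra.
by move=> [<- _] /esym/eqP; apply/negP/gap_neq.
Qed.

(* The box around the lower strand never meets another strand: the two crossing
   strands stay at distance 1. *)
Lemma lasso_stage_ok i t s : (0 < i < n)%N -> 0 <= t <= 1 -> 0 <= s <= 1 ->
  (forall j, (1 <= j <= n)%N ->
     exists2 k, (1 <= k <= n)%N & strand w j t = crossing_strand i k s) ->
  let x := i%:R + 2^-1 - 2^-1 * cos (pi * s) in let y := - (2^-1 * sin (pi * s)) in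
  forall u, ok (lasso x y u) t.
Proof.
move=> i_n t01 /andP[s0 s1] H x y.
have c1 := cos_geN1 (pi * s); have c2 := cos_le1 (pi * s).
have sp : 0 <= sin (pi * s).
  apply: sin_ge0_pi; rewrite mulr_ge0 ?pi_ge0//=.
  by rewrite ger_pMr ?pi_gt0.
have cs := cos2Dsin2 (pi * s).
have side j px py : (1 <= j <= n)%N -> strand w j t = (px, py) ->
    (py <= y + 2^-1 -> px <> x + 2^-1 /\ px <> x - 2^-1) /\
    (py = y + 2^-1 -> x - 2^-1 <= px <= x + 2^-1 -> False).
  move=> jn; have [k kn ->] := H j jn; rewrite /crossing_strand.
  case: eqP => [_ [<- <-]|ki].
    by rewrite -/x -/y; split; [move=> _; split; lra | lra].
  (* Seen from the lower strand, the upper one is at the point (C, S) of the unit circle, with S >=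
     0. If |C| = 1/2 then S > 1/2, and if S = 1/2 then |C| > 1/2; this is why the half-width and the
     height of the box are 1/2. *)
  case: eqP => [_ [<- <-]|ki1].
    rewrite /x /y; move: (cos _) (sin _) c1 c2 sp cs => C S c1 c2 sp cs.
    split; first by move=> ?; split => ?; nra.
    by move=> ? /andP[? ?]; nra.
  move=> [<- <-].
  have : k%:R <= i%:R - 1 :> R \/ i%:R + 2 <= k%:R :> R.
    case: (ltngtP k i) => // [lt_ki|lt_ik].
      left; have : k%:R + 1 <= i%:R :> R by rewrite natr1 ler_nat.
      lra.
    right; have : (i.+2)%:R <= k%:R :> R by rewrite ler_nat; lia.
    by rewrite -addn2 natrD.
  by rewrite /x /y => kE; split; [move=> _; split; lra | move=> _ /andP[? ?]; lra].
apply: (@pairwise_mixl _ (ok^~ t) _ (lasso x y)).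
have y0 : y <= 0 by rewrite /y; lra.
pose column c : set V := [set v | linform 1 0 (- c) v = 0] `&`
  [set v | 0 <= linform 0 0 1 v] `&` [set v | 0 < linform 0 (-1) 1 v] `&`
  [set v | 0 <= linform 0 (-1) (y + 2^-1) v].
pose top : set V := [set v | 0 < linform 0 0 1 v] `&`
  [set v | linform 0 1 (- (y + 2^-1)) v = 0] `&`
  [set v | 0 <= linform 1 0 (- (x - 2^-1)) v] `&`
  [set v | 0 <= linform (-1) 0 (x + 2^-1) v].
have col c : c = x + 2^-1 \/ c = x - 2^-1 -> column c `<=` (ok^~ t).
  move=> cx [[a b] q]; rewrite /column /linform /= => -[[[/= aE q0] bq] by'].
  apply: page_ok_intro => //=; first lra.
    by apply/eqP => -[a0 b0 q0']; move: bq; rewrite b0 q0'; lra.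
  move=> q_gt0 j px py jn jE aE' bE.
  have pc : px = c by apply: (mulfI (lt0r_neq0 q_gt0)); rewrite -aE'; lra.
  have py' : py <= y + 2^-1 by rewrite -(ler_pM2l q_gt0) -bE; lra.
  by have [/(_ py') [n1 n2] _] := side j px py jn jE; case: cx => cx; [apply: n1|apply: n2]; rewrite pc.
have topok : top `<=` (ok^~ t).
  move=> [[a b] q]; rewrite /top /linform /= => -[[[/= q0 bE'] a1] a2].
  apply: page_ok_intro => //=; first lra.
    by apply/eqP => -[a0 b0 q0']; move: q0; rewrite q0'; lra.
  move=> q_gt0 j px py jn jE aE bE.
  have [_] := side j px py jn jE; apply.
    by apply: (mulfI (lt0r_neq0 q_gt0)); rewrite -bE; lra.
  by rewrite -(ler_pM2l q_gt0) -[px <= _](ler_pM2l q_gt0) -aE; apply/andP; split; lra.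
have colr := col _ (or_introl erefl); have coll := col _ (or_intror erefl).
clear H side cs sp c1 c2 s0 s1 col i_n; clearbody x y.
apply: pairwise_mix_cat; apply: pairwise_mix_cat; apply: pairwise_mix_cat.
- by apply: (pairwise_mix_segment _ (axis_set_ok _ _ t01)); [convexity|in_half_spaces..].
- by apply: (pairwise_mix_segment _ colr); [convexity|in_half_spaces..].
- by apply: (pairwise_mix_segment _ colr); [convexity|in_half_spaces..].
- by apply: (pairwise_mix_segment _ topok); [convexity|in_half_spaces..].
- by apply: (pairwise_mix_segment _ topok); [convexity|in_half_spaces..].
- by apply: (pairwise_mix_segment _ coll); [convexity|in_half_spaces..].
- by apply: (pairwise_mix_segment _ coll); [convexity|in_half_spaces..].
- by apply: (pairwise_mix_segment _ (axis_set_ok _ _ t01)); [convexity|in_half_spaces..].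
Qed.

Lemma lasso_class_stage i t0 t1 : 0 <= t0 <= 1 -> 0 <= t1 <= 1 -> (0 < i < n)%N ->
  crossing_stage i t0 t1 ->
  page_class wn (lasso i%:R 0) t0 = page_class wn (lasso i.+1%:R 0) t1.
Proof.
move=> t01 t11 i_n H.
pose x (s : I) : R := i%:R + 2^-1 - 2^-1 * cos (pi * of_itv s).
pose y (s : I) : R := - (2^-1 * sin (pi * of_itv s)).
have cx : continuous x by rewrite /x; cts'.
have cy : continuous y by rewrite /y; cts'.
have x0 : x zero = i%:R by rewrite /x of_itv0 mulr0 cos0; lra.
have x1 : x one = i.+1%:R by rewrite /x of_itv1 mulr1 cospi -(natr1 i); lra.
have y0 : y zero = 0 by rewrite /y of_itv0 mulr0 sin0 mulr0 oppr0.
have y1 : y one = 0 by rewrite /y of_itv1 mulr1 sinpi mulr0 oppr0.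
have := @page_class_homotopy R n w wn (fun s => lasso (x s) (y s))
  (fun s : I => time_mix t0 t1 (of_itv s)).
rewrite /= x0 x1 y0 y1 time_mix_zero time_mix_one; apply.
- exact: lasso_family.
- by rewrite /time_mix; cts'.
- by move=> s; apply: time_mix01 => //; exact: of_itvP.
- by move=> s; have [] := lasso_ends (x s) (y s).
- by move=> s; have [] := lasso_ends (x s) (y s).
move=> s; apply: lasso_stage_ok => //; first by apply: time_mix01 => //; exact: of_itvP.
- exact: of_itvP.
- by move=> j jn; apply: H => //; exact: of_itvP.
Qed.

Lemma gap_class_stage i t0 t1 k : 0 <= t0 <= 1 -> 0 <= t1 <= 1 -> (0 < i < n)%N ->
  crossing_stage i t0 t1 ->
  gap_class k t0 = artin i (fun j => gap_class j t1) k.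
Proof.
move=> t01 t11 i_n H; have [rest0 rest1] := stage_rest t01 t11 i_n H.
have other k' : k' != i -> gap_class k' t0 = gap_class k' t1.
  move=> ki; apply: gap_class_constant => // s j x y s01 jn.
  have [k'' _ ->] := H s j s01 jn; exact: crossing_column.
rewrite /artin; case: eqP => [->|/eqP]; last exact: other.
have := lasso_class_stage t01 t11 i_n H.
rewrite !lasso_rest//; last by case/andP: i_n.
rewrite (other i.-1); last by move: i_n; clear; case: i => // i _; rewrite /= neq_ltn ltnSn.
by move=> /(congr1 (fun g => g * gap_class i.-1 t1)%g); rewrite mulgVK.
Qed.

(** Each letter takes half of the remaining time, so a suffix of the word fills a final interval
    [1 - r, 1], run through affinely; [r] is halved with each letter. *)
Definition final_stage r w' : Prop :=
  forall t j, 0 <= t <= 1 -> (1 <= j <= n)%N ->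
    exists2 k, (1 <= k <= n)%N & strand w j (1 - (1 - t) * r) = strand w' k t.

Lemma gap_class_artin_word r w' k : 0 < r <= 1 -> braid_word n w' ->
  final_stage r w' ->
  gap_class k (1 - r) = artin_word w' (fun j => gap_class j 1) k.
Proof.
have one01 : 0 <= (1 : R) <= 1 by rewrite lexx ler01.
elim: w' r k => [|i w' IH] r k /andP[r0 r1] wn' H.
  apply: gap_class_constant => //; first by apply/andP; split; lra.
  move=> s j x y s01 jn.
  rewrite (_ : time_mix _ _ _ = 1 - (1 - s) * r); last by rewrite /time_mix; ring.
  have [k' k'n ->] := H s j s01 jn.
  by move=> /= [<- _] /esym/eqP; apply/negP/gap_neq.
case/andP: wn' => i_n wn'.
have H' : final_stage (r / 2) w'.
  move=> t j /andP[t0 t1] jn.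
  have [|k' k'n] := H ((1 + t) / 2) j _ jn; first by apply/andP; split; lra.
  rewrite (_ : 1 - (1 - (1 + t) / 2) * r = 1 - (1 - t) * (r / 2)); last by field.
  move=> -> /=; exists (transpose i k'); first by rewrite transpose_range.
  (* At t = 0 the time is the junction, which [strand] still assigns to the first letter. *)
  have [t2|t2] := leP ((1 + t) / 2) 2^-1; last by congr strand; field.
  have -> : t = 0 by lra.
  by rewrite addr0 mul1r mulfV// crossing_strand1 strand0.
rewrite (@gap_class_stage i (1 - r) (1 - r / 2))//.
- rewrite /artin_word /= -/(artin_word _ _) /artin.
  rewrite !IH//; apply/andP; split; lra.
- by apply/andP; split; lra.
- by apply/andP; split; lra.
move=> s j /andP[s0 s1] jn.
have [|k' k'n] := H (s / 2) j _ jn; first by apply/andP; split; lra.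
rewrite (_ : 1 - _ * r = time_mix (1 - r) (1 - r / 2) s); last by rewrite /time_mix; field.
move=> -> /=; rewrite ifT; last lra.
by exists k' => //; congr crossing_strand; field.
Qed.

Definition gap_element k : fundamental_group R (page_base n w) := gap_class k 0.

Lemma gap_element_artin k : artin_word w gap_element k = gap_element k.
Proof.
rewrite /gap_element; have -> : (fun j => gap_class j 0) = (fun j => gap_class j 1).
  apply/funext => j; rewrite /page_class; congr loop_class.
  by apply/funext => s; exact: page01.
rewrite -(@gap_class_artin_word 1)//.
- by rewrite subrr /page_class; congr loop_class; apply/funext => s; exact: page01.
- by rewrite ltr01 lexx.
- by move=> t j t01 jn; exists j => //; congr strand; ring.
Qed.

Lemma gap_element_last : gap_element n = 1%g.
Proof.
apply: gap_loop_last; split; first by rewrite lexx ler01.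
by move=> j jn; exists j => //; exact: strand0.
Qed.

End crossing_relations.

(** * The local system *)

Section local_conditions.
Context {R : realType} {Z : topologicalType}.

Lemma near_lt (f g : Z -> R) (z0 : Z) : continuous f -> continuous g -> f z0 < g z0 ->
  \forall z \near z0, f z < g z.
Proof.
move=> cf cg fg; have c : continuous (fun z => g z - f z) by exact: ctsB.
have h : nbhs (g z0 - f z0) [set y | 0 < y].
  by apply: open_nbhs_nbhs; split; [exact: open_gt | rewrite /= subr_gt0].
near=> z; rewrite -subr_gt0; near: z; exact: (c z0 _ h).
Unshelve. all: by end_near. Qed.

Lemma near_neq (f g : Z -> R) (z0 : Z) : continuous f -> continuous g -> f z0 != g z0 ->
  \forall z \near z0, f z != g z.
Proof.
move=> cf cg; rewrite neq_lt => /orP[] fg.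
  by apply: filterS (near_lt cf cg fg) => z /lt_eqF ->.
by apply: filterS (near_lt cg cf fg) => z /gt_eqF ->.
Qed.

Lemma near_ltr_const (f g : Z -> R) (z0 : Z) : continuous f -> continuous g -> f z0 != g z0 ->
  \forall z \near z0, (f z < g z) = (f z0 < g z0).
Proof.
move=> cf cg; rewrite neq_lt => /orP[] fg.
  by apply: filterS (near_lt cf cg fg) => z ->; rewrite fg.
apply: filterS (near_lt cg cf fg) => z h.
by rewrite !ltNge !ltW.
Qed.

Lemma near_range (n : nat) (P : nat -> Z -> Prop) (z0 : Z) :
  (forall j, (1 <= j <= n)%N -> \forall z \near z0, P j z) ->
  \forall z \near z0, forall j, (1 <= j <= n)%N -> P j z.
Proof.
elim: n => [|n IH] H; first by near=> z => j; lia.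
have h1 : \forall z \near z0, forall j, (1 <= j <= n)%N -> P j z.
  by apply: IH => j jn; apply: H; lia.
have h2 := H n.+1; rewrite ltnSn /= in h2.
apply: filterS2 h1 (h2 isT) => z h1 h2' j jn.
have [->//|jn'] := eqVneq j n.+1; apply: h1; lia.
Unshelve. all: by end_near. Qed.

End local_conditions.

(** * Charts of the pages and their transition functions *)

Section charts.
Context {R : realType} {G : groupType} (n : nat) (D : nat -> G).
Local Notation V := (R * R * R)%type.
Implicit Types (w : seq nat) (v : V) (t : R).

(** The tuple at time t that becomes [D] at time 1. In a crossing sigma_i it switches at the middle,
    when the i-th gap is closed: the one entry that changes is then read at no point. *)
Fixpoint level w t : nat -> G :=
  if w is i :: w' then
    if t <= 2^-1 then
      if 2 * t < 2^-1 then artin_word w D else artin_word w' D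
    else level w' (2 * t - 1)
  else D.

Definition strands_left w v t : nat :=
  (\sum_(1 <= j < n.+1) (v.2 * (strand w j t).1 < v.1.1)%R)%N.

Definition chartA w v t : Prop := forall j, (1 <= j <= n)%N ->
  ~ (v.1.1 = v.2 * (strand w j t).1 /\ v.2 * (strand w j t).2 <= v.1.2).

Definition chartB w v t : Prop := forall j, (1 <= j <= n)%N ->
  ~ (v.1.1 = v.2 * (strand w j t).1 /\ v.1.2 <= v.2 * (strand w j t).2).

(** The width keeps every strand other than the crossing pair on a fixed side. The height, strictly
    between the pair, makes the chart empty at both ends of the crossing. *)
Fixpoint chartC w v t : Prop :=
  if w is i :: w' then
    if t <= 2^-1 then
      `|v.1.1 - v.2 * (i%:R + 2^-1)| < v.2 /\
      `|v.1.2| < v.2 * (2^-1 * sin (pi * (2 * t)))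
    else chartC w' v (2 * t - 1)
  else False.

(** A passage from below to above through the k-th gap, k being the number of strands to the left,
    receives the current value of y_k. *)
Definition transAB w v t : G := level w t (strands_left w v t).

(** Normalised to 1 on the left of the lower strand; on its right the lasso of that strand enters,
    y_(i+1) y_i^-1 in the values after the crossing. This forces [transCB] to be y_(i-1) or y_i
    according to the side of the upper strand. *)
Fixpoint transAC w v t : G :=
  if w is i :: w' then
    if t <= 2^-1 then
      if v.2 * (crossing_strand i i (2 * t)).1 < v.1.1 then
        (artin_word w' D i.+1 * (artin_word w' D i)^-1)%g
      else 1%g
    else transAC w' v (2 * t - 1)
  else 1%g.

Fixpoint transCB w v t : G :=
  if w is i :: w' then
    if t <= 2^-1 then
      if v.1.1 < v.2 * (crossing_strand i i.+1 (2 * t)).1 then artin_word w' D i.-1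
      else artin_word w' D i
    else transCB w' v (2 * t - 1)
  else 1%g.

Lemma crossing_strand_lower i s : crossing_strand i i s =
  (i%:R + 2^-1 - 2^-1 * cos (pi * s), - (2^-1 * sin (pi * s))) :> R * R.
Proof. by rewrite /crossing_strand eqxx. Qed.

Lemma crossing_strand_upper i s : crossing_strand i i.+1 s =
  (i%:R + 2^-1 + 2^-1 * cos (pi * s), 2^-1 * sin (pi * s)) :> R * R.
Proof. by rewrite /crossing_strand eqxx ifF//; lia. Qed.

Lemma crossing_strand_other i j s : j != i -> j != i.+1 ->
  crossing_strand i j s = (j%:R, 0) :> R * R.
Proof. by rewrite /crossing_strand => /negPf -> /negPf ->. Qed.

Lemma sin_pi_ge0 (s : R) : 0 <= s <= 1 -> 0 <= sin (pi * s).
Proof.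
move=> /andP[s0 s1]; apply: sin_ge0_pi; rewrite mulr_ge0 ?pi_ge0//=.
by rewrite ger_pMr ?pi_gt0.
Qed.

(** Strands outside the crossing pair are at height 0 on integer columns away from [i, i + 1]. Two
    strands with a common column and different heights are thus the crossing pair at its alignment,
    and the point lies between them. *)
Lemma crossing_between w v t j k : 0 <= t <= 1 -> 0 <= v.2 ->
  v.1.1 = v.2 * (strand w j t).1 -> v.1.1 = v.2 * (strand w k t).1 ->
  v.2 * (strand w j t).2 < v.1.2 -> v.1.2 < v.2 * (strand w k t).2 ->
  chartC w v t.
Proof.
elim: w t j k => [|i w IH] t j k /= /andP[t0 t1] q0.
  by rewrite mulr0 => _ _ b0 b0'; have := lt_trans b0 b0'; rewrite ltxx.
case: (leP t 2^-1) => t2 aj ak bj bk; last first.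
  by apply: (IH _ (transpose i j) (transpose i k)) => //; apply/andP; split; lra.
have s01 : 0 <= 2 * t <= 1 by apply/andP; split; lra.
have S0 := sin_pi_ge0 s01.
have c1 := cos_geN1 (pi * (2 * t)); have c2 := cos_le1 (pi * (2 * t)).
have q_gt0 : 0 < v.2.
  by rewrite lt_def q0 andbT; apply/eqP => q0'; move: bj bk; rewrite q0' !mul0r => h1 h2; have := lt_trans h1 h2; rewrite ltxx.
have xx : (crossing_strand i j (2 * t)).1 = (crossing_strand i k (2 * t)).1.
  by apply: (mulfI (lt0r_neq0 q_gt0)); rewrite -aj.
have yy : (crossing_strand i j (2 * t)).2 < (crossing_strand i k (2 * t)).2.
  by rewrite -(ltr_pM2l q_gt0) (lt_trans bj).
move: xx yy aj ak bj bk.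
have other l : l != i -> l != i.+1 -> l%:R + 1 <= i%:R :> R \/ i%:R + 2 <= l%:R :> R.
  move=> li li1; case: (ltngtP l i) li => // h _.
    by left; rewrite natr1 ler_nat.
  by right; rewrite -natrD ler_nat addn2 ltn_neqAle eq_sym li1.
move: S0 c1 c2; set S := sin _; set C := cos _ => S0 c1 c2.
have [->|ji] := eqVneq j i.
  have [->|ki] := eqVneq k i; first by move=> _; rewrite ltxx.
  have [->|ki1] := eqVneq k i.+1.
    rewrite crossing_strand_lower crossing_strand_upper /= -/C -/S.
    move=> xx _ aj _ bj bk.
    have C0 : C = 0 by lra.
    rewrite aj C0; split; first by rewrite mulr0 subr0 subrr normr0.
    by rewrite ltr_norml -mulrN bj bk.
  rewrite crossing_strand_lower (crossing_strand_other _ ki ki1) /= -/C => xx.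
  by have := other k ki ki1; lra.
have [->|ji1] := eqVneq j i.+1.
  have [->|ki] := eqVneq k i.
    rewrite crossing_strand_lower crossing_strand_upper /= -/C -/S => _ yy.
    by exfalso; lra.
  have [->|ki1] := eqVneq k i.+1; first by move=> _; rewrite ltxx.
  rewrite crossing_strand_upper (crossing_strand_other _ ki ki1) /= -/C => xx.
  by have := other k ki ki1; lra.
rewrite (crossing_strand_other _ ji ji1) /=.
have [->|ki] := eqVneq k i.
  rewrite crossing_strand_lower /= -/C => xx.
  by have := other j ji ji1; lra.
have [->|ki1] := eqVneq k i.+1.
  rewrite crossing_strand_upper /= -/C => xx.
  by have := other j ji ji1; lra.
by rewrite crossing_strand_other//= ltxx.
Qed.

Lemma charts_cover w v t : page_ok n w v t -> [\/ chartA w v t, chartB w v t | chartC w v t].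
Proof.
move=> [t01 q0 v0 off].
have [cA|nA] := pselect (chartA w v t); first by constructor 1.
have [cB|nB] := pselect (chartB w v t); first by constructor 2.
constructor 3.
have [j jn [aj bj]] : exists2 j, (1 <= j <= n)%N &
    v.1.1 = v.2 * (strand w j t).1 /\ v.2 * (strand w j t).2 <= v.1.2.
  apply: contrapT => H; apply: nA => j jn Hj; apply: H; by exists j.
have [k kn [ak bk]] : exists2 j, (1 <= j <= n)%N &
    v.1.1 = v.2 * (strand w j t).1 /\ v.1.2 <= v.2 * (strand w j t).2.
  apply: contrapT => H; apply: nB => k kn Hk; apply: H; by exists k.
have q_gt0 : 0 < v.2.
  rewrite lt_def q0 andbT; apply: contraNneq v0 => q0'; apply/eqP.
  move: aj bj bk; rewrite q0' !mul0r => a0 b1 b2.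
  case: v q0' a0 b1 b2 {off q0 nA nB ak} => [[a b] q] /= -> -> b1 b2.
  by congr (_, _, _); apply/eqP; rewrite eq_le b1 b2.
apply: (@crossing_between w v t j k) => //.
  rewrite lt_neqAle bj andbT; apply/eqP => E.
  by apply: (off q_gt0 j jn); rewrite -E.
rewrite lt_neqAle bk andbT; apply/eqP => E.
by apply: (off q_gt0 k kn); rewrite -E.
Qed.

Local Notation Z := (V * R)%type.

Let cts_a : continuous (fun z : Z => z.1.1.1). Proof. by cts. Qed.
Let cts_b : continuous (fun z : Z => z.1.1.2). Proof. by cts. Qed.
Let cts_q : continuous (fun z : Z => z.1.2). Proof. by cts. Qed.
Let cts_t : continuous (fun z : Z => z.2). Proof. by cts. Qed.

Let cts_strand w j : continuous (fun z : Z => strand w j z.2).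
Proof. by apply: (@cts_comp _ _ _ snd (strand w j)) => //; exact: strand_continuous. Qed.

Let cts_qx w j : continuous (fun z : Z => z.1.2 * (strand w j z.2).1).
Proof.
apply: ctsM => //; apply: (@cts_comp _ _ _ (fun z : Z => strand w j z.2) fst) => //.
exact: cts_fst.
Qed.

Let cts_qy w j : continuous (fun z : Z => z.1.2 * (strand w j z.2).2).
Proof.
apply: ctsM => //; apply: (@cts_comp _ _ _ (fun z : Z => strand w j z.2) snd) => //.
exact: cts_snd.
Qed.

Let cts_pair_affine (c d : R) : continuous (fun z : Z => (z.1, c * z.2 - d)).
Proof. by cts. Qed.

Lemma chartA_open w (z0 : Z) : chartA w z0.1 z0.2 -> \forall z \near z0, chartA w z.1 z.2.
Proof.
move=> H; apply: near_range => j jn.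
have [aE|aE] := eqVneq z0.1.1.1 (z0.1.2 * (strand w j z0.2).1).
  have lt : z0.1.1.2 < z0.1.2 * (strand w j z0.2).2.
    by rewrite ltNge; apply/negP => le; apply: (H j jn).
  have h := near_lt cts_b (@cts_qy w j) lt.
  near=> z => -[_]; apply/negP; rewrite -ltNge; near: z; exact: h.
have h := near_neq cts_a (@cts_qx w j) aE.
near=> z => -[/eqP + _]; apply/negP; near: z; exact: h.
Unshelve. all: by end_near. Qed.

Lemma chartB_open w (z0 : Z) : chartB w z0.1 z0.2 -> \forall z \near z0, chartB w z.1 z.2.
Proof.
move=> H; apply: near_range => j jn.
have [aE|aE] := eqVneq z0.1.1.1 (z0.1.2 * (strand w j z0.2).1).
  have lt : z0.1.2 * (strand w j z0.2).2 < z0.1.1.2.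
    by rewrite ltNge; apply/negP => le; apply: (H j jn).
  have h := near_lt (@cts_qy w j) cts_b lt.
  near=> z => -[_]; apply/negP; rewrite -ltNge; near: z; exact: h.
have h := near_neq cts_a (@cts_qx w j) aE.
near=> z => -[/eqP + _]; apply/negP; near: z; exact: h.
Unshelve. all: by end_near. Qed.

Let near_time_lt (z0 : Z) (c : R) : z0.2 < c -> \forall z \near z0, z.2 < c.
Proof. by move=> h; exact: (near_lt (f := fun z : Z => z.2) (g := cst c) cts_t (@cst_continuous _ _ c)). Qed.

Let near_time_gt (z0 : Z) (c : R) : c < z0.2 -> \forall z \near z0, c < z.2.
Proof. by move=> h; exact: (near_lt (f := cst c) (g := fun z : Z => z.2) (@cst_continuous _ _ c) cts_t). Qed.

Let near_shift (z0 : Z) (P : Z -> Prop) :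
  (\forall z \near (z0.1, 2 * z0.2 - 1), P z) ->
  \forall z \near z0, P (z.1, 2 * z.2 - 1).
Proof. by move=> h; exact: (@cts_pair_affine 2 1 z0 _ h). Qed.

Let cts_norm (f : Z -> R) : continuous f -> continuous (fun z => `|f z|).
Proof. by move=> cf; apply: (@cts_comp _ _ _ f Num.norm) => //; exact: norm_continuous. Qed.

Lemma chartC_open w (z0 : Z) : chartC w z0.1 z0.2 -> \forall z \near z0, chartC w z.1 z.2.
Proof.
elim: w z0 => [//|i w IH] z0 /=; case: (ltgtP z0.2 2^-1) => [t2|t2|->].
- move=> [h1 h2].
  have c1 : continuous (fun z : Z => `|z.1.1.1 - z.1.2 * (i%:R + 2^-1)|).
    by apply: cts_norm; cts.
  have c2 : continuous (fun z : Z => z.1.2 * (2^-1 * sin (pi * (2 * z.2)))).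
    by cts'.
  near=> z; rewrite ifT.
    split; near: z; first exact: (near_lt c1 cts_q).
    exact: (near_lt (cts_norm cts_b) c2).
  by apply: ltW; near: z; exact: near_time_lt.
- move=> /(IH (z0.1, 2 * z0.2 - 1))/near_shift h.
  near=> z; rewrite ifF; first by near: z.
  by apply/negbTE; rewrite -ltNge; near: z; exact: near_time_gt.
- by move=> [_]; rewrite mulfV// mulr1 sinpi !mulr0 ltNge normr_ge0.
Unshelve. all: by end_near. Qed.

Definition off_columns w v t := forall j, (1 <= j <= n)%N -> v.1.1 != v.2 * (strand w j t).1.

Lemma chartAB_off w v t : chartA w v t -> chartB w v t -> off_columns w v t.
Proof.
move=> cA cB j jn; apply/eqP => aE.
by have [le|/ltW le] := leP (v.2 * (strand w j t).2) v.1.2; [apply: (cA j jn)|apply: (cB j jn)].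
Qed.

Lemma strands_left_near w (z0 : Z) : off_columns w z0.1 z0.2 ->
  \forall z \near z0, strands_left w z.1 z.2 = strands_left w z0.1 z0.2.
Proof.
move=> off.
have h : \forall z \near z0, forall j, (1 <= j <= n)%N ->
    (z.1.2 * (strand w j z.2).1 < z.1.1.1) = (z0.1.2 * (strand w j z0.2).1 < z0.1.1.1).
  apply: near_range => j jn; apply: (near_ltr_const (@cts_qx w j) cts_a).
  by rewrite eq_sym off.
near=> z; rewrite /strands_left !big_nat; apply: eq_bigr => j jn.
by congr nat_of_bool; move: j jn; near: z.
Unshelve. all: by end_near. Qed.

Lemma sum_split_pair i (F : nat -> nat) : (0 < i < n)%N ->
  \sum_(1 <= j < n.+1) F j =
  (\sum_(1 <= j < i) F j + (F i + F i.+1) + \sum_(i.+2 <= j < n.+1) F j)%N.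
Proof.
move=> /andP[i0 i_n]; rewrite (@big_cat_nat _ _ _ i)//=; last by lia.
rewrite -!addnA; congr (_ + _)%N; rewrite big_ltn; last by lia.
by congr (_ + _)%N; rewrite big_ltn.
Qed.

Lemma strands_left_cons i w v t : (0 < i < n)%N -> 2^-1 < t ->
  strands_left (i :: w) v t = strands_left w v (2 * t - 1).
Proof.
move=> i_n t2; rewrite /strands_left /= leNgt t2 /= !(sum_split_pair _ i_n).
have -> : transpose i i = i.+1 by rewrite /transpose eqxx.
have -> : transpose i i.+1 = i by rewrite /transpose eqxx ifF//; lia.
congr (_ + _ + _)%N; last 1 first.
- by rewrite !big_nat; apply: eq_bigr => j jn; rewrite /transpose !ifF//; apply/eqP; lia.
- by rewrite !big_nat; apply: eq_bigr => j jn; rewrite /transpose !ifF//; apply/eqP; lia.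
- exact: addnC.
Qed.

Lemma off_columns_cons i w v t : (0 < i < n)%N -> 2^-1 < t ->
  off_columns (i :: w) v t -> off_columns w v (2 * t - 1).
Proof.
move=> i_n t2 off j jn; have := off (transpose i j).
by rewrite transpose_range// => /(_ jn); rewrite /= leNgt t2 /= transposeK.
Qed.

Lemma level0 w : level w 0 = artin_word w D.
Proof. by case: w => //= i w; rewrite !ifT//; lra. Qed.

Lemma level1 w : level w 1 = D.
Proof.
elim: w => //= i w IH; rewrite ifF; last by apply/negbTE; rewrite -ltNge; lra.
by rewrite (_ : 2 * 1 - 1 = 1)//; lra.
Qed.

Lemma artin_word_side w k : braid_word n w -> k = 0%N \/ k = n -> artin_word w D k = D k.
Proof.
elim: w => //= i w IH /andP[i_n wn] k0n.
by rewrite /artin_word /= -/(artin_word w D) /artin ifF ?IH//; apply/eqP; lia.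
Qed.

Lemma level_side w t k : braid_word n w -> k = 0%N \/ k = n -> level w t k = D k.
Proof.
move=> wn k0n; elim: w t wn => //= i w IH t /[dup] wn /andP[_ wn'].
case: ifP => _; last exact: IH.
by case: ifP => _; [exact: (@artin_word_side (i :: w))|exact: artin_word_side].
Qed.

Let near_ltc (t0 c : R) : t0 < c -> \forall t \near t0, t < c.
Proof. by move=> h; apply: (near_lt (f := id) (g := cst c)) => //; [move=> ?; exact: cvg_id|exact: cst_continuous]. Qed.

Let near_gtc (t0 c : R) : c < t0 -> \forall t \near t0, c < t.
Proof. by move=> h; apply: (near_lt (f := cst c) (g := id)) => //; [exact: cst_continuous|move=> ?; exact: cvg_id]. Qed.

Lemma level_near0 w : \forall t \near (0 : R), level w t = artin_word w D.
Proof.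
case: w => [|i w]; first by near=> t.
have c : (0 : R) < 4^-1 by lra.
apply: filterS (near_ltc c) => t t4 /=; rewrite !ifT//; lra.
Unshelve. all: by end_near. Qed.

Lemma strands_left_side w v t : v.2 = 0 -> v.1.1 != 0 ->
  strands_left w v t = 0%N \/ strands_left w v t = n.
Proof.
move=> q0 a0; rewrite /strands_left; under eq_bigr do rewrite q0 mul0r.
by rewrite sum_nat_const_nat subn1 /=; case: (0 < _); rewrite ?muln0 ?muln1; [right|left].
Qed.

(** At this moment the crossing strands share a column, so both or neither are on the left: the
    count is at most i - 1 or at least i + 1. *)
Lemma strands_left_mid i w v t : (0 < i < n)%N -> 2 * t = 2^-1 -> 0 <= v.2 ->
  off_columns (i :: w) v t -> strands_left (i :: w) v t <> i.
Proof.
move=> i_n t4 q0 off.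
have t2 : t <= 2^-1 by lra.
have C0 : cos (pi * (2 * t)) = 0 by rewrite t4 cos_pihalf.
have [q0'|qn0] := eqVneq v.2 0.
  have a0 : v.1.1 != 0 by have := off 1%N; rewrite q0' mul0r; apply; lia.
  by have := @strands_left_side (i :: w) v t q0' a0; lia.
have q_gt0 : 0 < v.2 by rewrite lt_def qn0.
rewrite /strands_left (sum_split_pair _ i_n) /= t2 crossing_strand_lower crossing_strand_upper /=.
rewrite C0 mulr0 subr0 addr0.
have am : v.1.1 != v.2 * (i%:R + 2^-1).
  have := off i; rewrite /= t2 crossing_strand_lower /= C0 mulr0 subr0; apply; lia.
have sub0 : (\sum_(1 <= j < i) (v.2 * (crossing_strand i j (2 * t)).1 < v.1.1)%R <= i.-1)%N.
  rewrite -[leqRHS]muln1 -subn1 -sum_nat_const_nat; apply: leq_sum => j _.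
  by case: (_ < _).
case: (ltgtP v.1.1 (v.2 * (i%:R + 2^-1))) am => // lt_a _.
  rewrite (_ : \sum_(i.+2 <= j < n.+1) _ = 0%N); first by lia.
  rewrite big_nat big1// => j /andP[ij _]; rewrite crossing_strand_other/=; [|lia..].
  have ij' : i%:R + 2 <= j%:R :> R by rewrite -natrD ler_nat; lia.
  have : v.2 * (i%:R + 2) <= v.2 * j%:R by rewrite ler_pM2l.
  by move=> h; rewrite ltNge (_ : _ <= _)//; lra.
rewrite (_ : \sum_(1 <= j < i) _ = i.-1); first by lia.
rewrite -[RHS]muln1 -subn1 -sum_nat_const_nat !big_nat.
apply: eq_bigr => j /andP[_ ji]; rewrite crossing_strand_other/=; [|lia..].
have ij' : j%:R + 1 <= i%:R :> R by rewrite natr1 ler_nat.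
have : v.2 * (j%:R + 1) <= v.2 * i%:R by rewrite ler_pM2l.
by move=> h; rewrite (_ : _ < _)//; lra.
Qed.

(** Two times need care: the middle of a crossing, where only the entry i jumps and
    [strands_left_mid] rules it out, and the junction, where both sides read the image of [D] under
    the remaining word. *)
Lemma level_near w v t0 : braid_word n w -> 0 <= v.2 -> off_columns w v t0 ->
  \forall t \near t0, level w t (strands_left w v t0) = level w t0 (strands_left w v t0).
Proof.
move=> + q0; elim: w t0 => [|i w IH] t0; first by move=> *; near=> t.
move=> /= /[dup] wn /andP[i_n wn'] off.
case: (ltgtP t0 2^-1) => [t2|t2|t2].
- have [t4|t4|t4] := ltgtP (2 * t0) 2^-1.
  + have t4' : t0 < 4^-1 by lra.
    by apply: filterS (near_ltc t4') => t h; rewrite !ifT//; lra.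
  + have t4' : 4^-1 < t0 by lra.
    apply: filterS2 (near_ltc t2) (near_gtc t4') => t h1 h2.
    by rewrite ifT ?ifF//; [apply/negbTE; rewrite -leNgt|]; lra.
  + have kn : strands_left (i :: w) v t0 <> i by exact: strands_left_mid.
    apply: filterS (near_ltc t2) => t h1; rewrite ifT; last exact: ltW.
    rewrite /artin_word /= -/(artin_word w D) /artin.
    by case: ifP => //; rewrite ifF//; apply/eqP.
- rewrite strands_left_cons//.
  have h := IH _ wn' (off_columns_cons i_n t2 off).
  have c : continuous (fun t : R => 2 * t - 1) by cts.
  near=> t; rewrite ifF; last by apply/negbTE; rewrite -ltNge; near: t; exact: near_gtc.
  by near: t; exact: (c t0 _ h).
have c : continuous (fun t : R => 2 * t - 1) by cts.
have h : \forall t \near t0, level w (2 * t - 1) = artin_word w D.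
  have := level_near0 w; rewrite (_ : 0 = 2 * t0 - 1); last by rewrite t2; lra.
  exact: c.
have t4' : 4^-1 < t0 by lra.
apply: filterS2 h (near_gtc t4') => t h1 h2.
rewrite h1 (_ : (2 * t0 < 2^-1) = false); last by apply/negbTE; rewrite -leNgt; lra.
rewrite (_ : (2 * t < 2^-1) = false); last by apply/negbTE; rewrite -leNgt; lra.
by case: ifP.
Unshelve. all: by end_near. Qed.

Lemma transAB_near w (z0 : Z) : braid_word n w -> 0 <= z0.1.2 -> off_columns w z0.1 z0.2 ->
  \forall z \near z0, transAB w z.1 z.2 = transAB w z0.1 z0.2.
Proof.
move=> wn q0 off; rewrite /transAB.
have h1 := strands_left_near off; have h2 := level_near wn q0 off.
near=> z; rewrite (_ : strands_left w z.1 z.2 = strands_left w z0.1 z0.2); last by near: z.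
near: z; exact: (cts_t h2).
Unshelve. all: by end_near. Qed.

Lemma chartC_gt0 w v t : chartC w v t -> 0 < v.2.
Proof.
elim: w t => //= i w IH t; case: ifP => _; last exact: IH.
by move=> [h _]; exact: le_lt_trans h.
Qed.

Lemma chartC0 w v : ~ chartC w v 0.
Proof.
case: w => [//|i w] /=; rewrite ifT; last by lra.
by move=> [_]; rewrite !mulr0 sin0 !mulr0 ltNge normr_ge0.
Qed.

Lemma chartC1 w v : ~ chartC w v 1.
Proof.
elim: w => //= i w IH; rewrite ifF; last by apply/negbTE; rewrite -ltNge; lra.
by rewrite (_ : 2 * 1 - 1 = 1)//; lra.
Qed.

Let near_timeC (z0 : Z) (P : Z -> Prop) : z0.2 < 2^-1 ->
  (\forall z \near z0, P z) -> \forall z \near z0, z.2 <= 2^-1 /\ P z.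
Proof.
move=> h hP; apply: filterS2 (near_time_lt h) hP => z h1 h2; split=> //.
exact: ltW.
Qed.

Lemma chartA_cons i w v t : (0 < i < n)%N -> 2^-1 < t ->
  chartA (i :: w) v t -> chartA w v (2 * t - 1).
Proof.
move=> i_n t2 cA j jn; have := cA (transpose i j).
by rewrite transpose_range// => /(_ jn); rewrite /= leNgt t2 /= transposeK.
Qed.

Lemma chartB_cons i w v t : (0 < i < n)%N -> 2^-1 < t ->
  chartB (i :: w) v t -> chartB w v (2 * t - 1).
Proof.
move=> i_n t2 cB j jn; have := cB (transpose i j).
by rewrite transpose_range// => /(_ jn); rewrite /= leNgt t2 /= transposeK.
Qed.

Lemma chartC_time i w v : ~ chartC (i :: w) v 2^-1.
Proof.
rewrite /= lexx => -[_]; rewrite mulfV ?pnatr_eq0// mulr1 sinpi !mulr0.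
by rewrite ltNge normr_ge0.
Qed.

Let off_lower i v t S : (0 < i < n)%N -> t <= 2^-1 -> chartA (i :: S) v t ->
  chartC (i :: S) v t -> v.2 * (crossing_strand i i (2 * t)).1 != v.1.1.
Proof.
move=> i_n t2 cA /=; rewrite t2 => -[_]; rewrite ltr_norml => /andP[h _].
apply/eqP => aE; apply: (cA i); first by lia.
by rewrite /= t2 crossing_strand_lower -aE crossing_strand_lower /= mulrN ltW.
Qed.

Let off_upper i v t S : (0 < i < n)%N -> t <= 2^-1 -> chartB (i :: S) v t ->
  chartC (i :: S) v t -> v.1.1 != v.2 * (crossing_strand i i.+1 (2 * t)).1.
Proof.
move=> i_n t2 cB /=; rewrite t2 => -[_]; rewrite ltr_norml => /andP[_ h].
apply/eqP => aE; apply: (cB i.+1); first by lia.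
by rewrite /= t2 -aE crossing_strand_upper /= ltW.
Qed.

Let cts_crossing i j : continuous (fun z : Z => z.1.2 * (crossing_strand i j (2 * z.2)).1).
Proof.
apply: ctsM => //.
apply: (@cts_comp _ _ _ (fun z : Z => crossing_strand i j (2 * z.2)) fst); first exact: cts_fst.
apply: (@cts_comp _ _ _ (fun z : Z => 2 * z.2) (crossing_strand i j)); last by cts.
exact: crossing_strand_continuous.
Qed.

Lemma transAC_near w (z0 : Z) : braid_word n w -> chartA w z0.1 z0.2 -> chartC w z0.1 z0.2 ->
  \forall z \near z0, transAC w z.1 z.2 = transAC w z0.1 z0.2.
Proof.
elim: w z0 => [|i w IH] z0; first by move=> _ _ _; near=> z.
move=> /andP[i_n wn] cA cC; have [t2|t2|t2] := ltgtP z0.2 2^-1.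
- have h := near_ltr_const (@cts_crossing i i) cts_a (off_lower i_n (ltW t2) cA cC).
  have h' := near_timeC t2 h.
  by apply: filterS h' => z [h1 h2] /=; rewrite h1 ltW// h2.
- have := IH (z0.1, 2 * z0.2 - 1) wn (chartA_cons i_n t2 cA).
  rewrite /= leNgt t2 /= in cC; move=> /(_ cC)/near_shift h.
  apply: filterS2 h (near_time_gt t2) => z h1 h2 /=.
  by rewrite leNgt h2 leNgt t2.
- by move: cC; rewrite t2 => /chartC_time.
Unshelve. all: by end_near. Qed.

Lemma transCB_near w (z0 : Z) : braid_word n w -> chartB w z0.1 z0.2 -> chartC w z0.1 z0.2 ->
  \forall z \near z0, transCB w z.1 z.2 = transCB w z0.1 z0.2.
Proof.
elim: w z0 => [|i w IH] z0; first by move=> _ _ _; near=> z.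
move=> /andP[i_n wn] cB cC; have [t2|t2|t2] := ltgtP z0.2 2^-1.
- have h := near_ltr_const cts_a (@cts_crossing i i.+1) (off_upper i_n (ltW t2) cB cC).
  have h' := near_timeC t2 h.
  by apply: filterS h' => z [h1 h2] /=; rewrite h1 ltW// h2.
- have := IH (z0.1, 2 * z0.2 - 1) wn (chartB_cons i_n t2 cB).
  rewrite /= leNgt t2 /= in cC; move=> /(_ cC)/near_shift h.
  apply: filterS2 h (near_time_gt t2) => z h1 h2 /=.
  by rewrite leNgt h2 leNgt t2.
- by move: cC; rewrite t2 => /chartC_time.
Unshelve. all: by end_near. Qed.

Lemma strands_left_box i w v t : (0 < i < n)%N -> t <= 2^-1 ->
  `|v.1.1 - v.2 * (i%:R + 2^-1)| < v.2 ->
  strands_left (i :: w) v t = (i.-1 +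
    ((v.2 * (crossing_strand i i (2 * t)).1 < v.1.1)%R +
     (v.2 * (crossing_strand i i.+1 (2 * t)).1 < v.1.1)%R))%N.
Proof.
move=> i_n t2 h; have q_gt0 : 0 < v.2 by exact: le_lt_trans h.
move: h; rewrite ltr_norml => /andP[h1 h2].
rewrite /strands_left (sum_split_pair _ i_n) /= t2.
rewrite [X in (_ + _ + X)%N](_ : _ = 0%N) ?addn0.
  congr (_ + _)%N; rewrite -[RHS]muln1 -subn1 -sum_nat_const_nat !big_nat.
  apply: eq_bigr => j /andP[_ ji]; rewrite crossing_strand_other/=; [|lia..].
  have ij' : j%:R + 1 <= i%:R :> R by rewrite natr1 ler_nat.
  have : v.2 * (j%:R + 1) <= v.2 * i%:R by rewrite ler_pM2l.
  by move=> h; rewrite (_ : _ < _)//; lra.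
rewrite big_nat big1// => j /andP[ij _]; rewrite crossing_strand_other/=; [|lia..].
have ij' : i%:R + 2 <= j%:R :> R by rewrite -natrD ler_nat; lia.
have : v.2 * (i%:R + 2) <= v.2 * j%:R by rewrite ler_pM2l.
by move=> h; rewrite ltNge (_ : _ <= _)//; lra.
Qed.

Lemma cos_pi_half_lt (s : R) : 0 <= s <= 1 -> (s < 2^-1 -> 0 < cos (pi * s)) /\
  (2^-1 <= s -> cos (pi * s) <= 0).
Proof.
move=> /andP[s0 s1]; have pi0 := @pi_gt0 R.
have ch : cos (pi * 2^-1) = 0 :> R by rewrite cos_pihalf.
have mem (x : R) : 0 <= x -> x <= 1 -> pi * x \in `[0, pi].
  move=> x0 x1; rewrite in_itv /= mulr_ge0 ?pi_ge0//=.
  by rewrite ger_pMr ?pi_gt0.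
split=> h.
  by rewrite -ch ltr_cos ?mem ?ltr_pM2l//; lra.
by rewrite -ch leNgt ltr_cos ?mem ?ltr_pM2l// -?leNgt//; lra.
Qed.

(** Left of both crossing strands the value is y_(i-1), right of both y_(i+1). Between them, right
    of the lower strand is possible only in the first half, where the product y_(i+1) y_i^-1 y_(i-1)
    is the Artin image; left of it only in the second half, where the value is y_i. *)
Lemma charts_cocycle w v t : braid_word n w -> 0 <= t <= 1 ->
  chartA w v t -> chartB w v t -> chartC w v t ->
  transAB w v t = (transAC w v t * transCB w v t)%g.
Proof.
move=> + + + + cC; have q_gt0 := chartC_gt0 cC; move: cC.
rewrite /transAB; elim: w t => [//|i w IH] t cC /andP[i_n wn] /andP[t0 t1] cA cB.
have [t2|t2] := leP t 2^-1; last first.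
  rewrite strands_left_cons//= leNgt t2 /=; apply: IH => //.
  - by move: cC; rewrite /= leNgt t2.
  - by apply/andP; split; lra.
  - exact: chartA_cons cA.
  - exact: chartB_cons cB.
have offF := off_lower i_n t2 cA cC; have offB := off_upper i_n t2 cB cC.
move: cC; rewrite /= t2 => -[box _].
rewrite strands_left_box//.
have s01 : 0 <= 2 * t <= 1 by apply/andP; split; lra.
have [cos_before cos_after] := cos_pi_half_lt s01.
set D' := artin_word w D.
have other k : k != i -> (if 2 * t < 2^-1 then artin_word (i :: w) D else D') k = D' k.
  by move=> ki; case: ifP => // _; rewrite /artin_word /= /artin ifN_eq.
rewrite -/(artin_word (i :: w) D).
have i1 : i.-1.+1 = i by case/andP: i_n => i0 _; exact: prednK.
have [Fa|Fa] := ltP (v.2 * (crossing_strand i i (2 * t)).1) v.1.1;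
have [Ba|Ba] := ltP (v.2 * (crossing_strand i i.+1 (2 * t)).1) v.1.1 => /=.
- rewrite (_ : (v.1.1 < _) = false); last by apply/negbTE; rewrite -leNgt ltW.
  have -> : (i.-1 + (true + true))%N = i.+1 by rewrite addnA !addn1 i1.
  rewrite other ?mulgVK//.
  by rewrite neq_ltn ltnSn orbT.
- rewrite (_ : v.1.1 < _); last by rewrite lt_neqAle offB.
  have -> : (i.-1 + (true + false))%N = i by rewrite addn0 addn1 i1.
  have -> : 2 * t < 2^-1.
    rewrite ltNge; apply/negP => /cos_after C0.
    have := lt_le_trans Fa Ba; rewrite crossing_strand_lower crossing_strand_upper /=.
    by rewrite ltr_pM2l//; lra.
  by rewrite /artin_word /= /artin eqxx.
- rewrite (_ : (v.1.1 < _) = false); last by apply/negbTE; rewrite -leNgt ltW.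
  have -> : (i.-1 + (false + true))%N = i by rewrite add0n addn1 i1.
  rewrite mul1g.
  case: ifP => // /cos_before C0; exfalso.
  have := lt_le_trans Ba Fa; rewrite crossing_strand_lower crossing_strand_upper /=.
  by rewrite ltr_pM2l//; lra.
- rewrite (_ : v.1.1 < _); last by rewrite lt_neqAle offB.
  have -> : (i.-1 + (false + false))%N = i.-1 by rewrite !addn0.
  by rewrite mul1g other// -{2}i1 neq_ltn ltnSn.
Qed.

Hypothesis n_gt0 : (0 < n)%N.

Lemma chartA_axis w v t t' : v.2 = 0 -> chartA w v t -> chartA w v t'.
Proof. by move=> q0 cA j jn; have := cA j jn; rewrite q0 !mul0r. Qed.

Lemma chartB_axis w v t t' : v.2 = 0 -> chartB w v t -> chartB w v t'.
Proof. by move=> q0 cB j jn; have := cB j jn; rewrite q0 !mul0r. Qed.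

(** On the axis all strands are on the same side, and Artin moves never change the entries 0 and
    [n]; the result is independent of the angle, which is arbitrary there. *)
Lemma transAB_axis w v t : braid_word n w -> v.2 = 0 -> v.1.1 != 0 ->
  transAB w v t = if 0 < v.1.1 then D n else D 0%N.
Proof.
move=> wn q0 a0; rewrite /transAB level_side//; last exact: strands_left_side.
rewrite /strands_left; under eq_bigr do rewrite q0 mul0r.
rewrite sum_nat_const_nat subn1 /=.
by case: (0 < _); rewrite ?muln0 ?muln1.
Qed.

Lemma chart_ends w (P : R * R -> Prop) : braid_word n w ->
  (forall j, (1 <= j <= n)%N -> P (strand w j 0)) <->
  (forall j, (1 <= j <= n)%N -> P (strand w j 1)).
Proof.
move=> wn; split=> H j jn.
  by have [_ [k kn ->]] := strand_ends (R := R) wn jn; rewrite -(strand0 w k); exact: H.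
by have [[k kn E] _] := strand_ends (R := R) wn jn; rewrite strand0 -E; exact: H.
Qed.

Lemma chartA_ends w v : braid_word n w -> chartA w v 0 <-> chartA w v 1.
Proof.
by move=> wn; exact: (chart_ends (fun p => ~ (v.1.1 = v.2 * p.1 /\ v.2 * p.2 <= v.1.2)) wn).
Qed.

Lemma chartB_ends w v : braid_word n w -> chartB w v 0 <-> chartB w v 1.
Proof.
by move=> wn; exact: (chart_ends (fun p => ~ (v.1.1 = v.2 * p.1 /\ v.1.2 <= v.2 * p.2)) wn).
Qed.

Lemma strands_left_ends w v : braid_word n w -> strands_left w v 1 = strands_left w v 0.
Proof.
have E0 w' : strands_left w' v 0 = strands_left [::] v 0.
  by rewrite /strands_left !big_nat; apply: eq_bigr => j _; rewrite strand0.
rewrite E0; elim: w => [//|i w IH] /= /andP[i_n wn].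
rewrite strands_left_cons//; last by lra.
by rewrite (_ : 2 * 1 - 1 = 1) ?IH//; lra.
Qed.

Lemma strands_left_le w v t : (strands_left w v t <= n)%N.
Proof.
apply: (@leq_trans (\sum_(1 <= j < n.+1) 1)%N).
  by apply: leq_sum => j _; case: (_ < _).
by rewrite sum_nat_const_nat subn1 muln1.
Qed.

(** Gluing of the pages of angles 0 and 1: the former reads the image of [D] under the word, the
    latter [D] itself. *)
Lemma transAB_ends w v : braid_word n w ->
  (forall k, (k <= n)%N -> artin_word w D k = D k) ->
  transAB w v 0 = transAB w v 1.
Proof.
move=> wn DE; rewrite /transAB strands_left_ends// level0 level1.
by apply: DE; exact: strands_left_le.
Qed.

End charts.

(** * The transport on the knot complement *)

Section transport_of_complement.
Context {R : realType} {G : groupType} (n : nat) (w : seq nat) (D : nat -> G).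
Hypothesis wn : braid_word n w.
Hypothesis n_gt0 : (0 < n)%N.
Hypothesis DE : forall k, (k <= n)%N -> artin_word w D k = D k.

Local Notation V := (R * R * R)%type.
Local Notation Z := (V * R)%type.
Local Notation K := (@braid_closure R n w).
Local Notation X := (@S3 R `\` K : Type).
Implicit Types (v : V) (t : R) (x y : X).

Let coord_val x : (R * R) * (R * R) := \val x.

Let coord_val_continuous : continuous coord_val.
Proof. exact: initial_continuous. Qed.

Definition page_coord x : V :=
  (((coord_val x).1.1, (coord_val x).1.2),
   Num.sqrt ((coord_val x).2.1 ^+ 2 + (coord_val x).2.2 ^+ 2)).

(* All of [0, 1] when x lies on the axis. *)
Definition page_angle x t : Prop := [/\ 0 <= t <= 1,
  (coord_val x).2.1 = (page_coord x).2 * cos (2 * pi * t) &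
  (coord_val x).2.2 = (page_coord x).2 * sin (2 * pi * t)].

Lemma page_coord_continuous : continuous page_coord.
Proof. by rewrite /page_coord; cts'. Qed.

Lemma page_angle_exists x : exists t, page_angle x t.
Proof.
by have [t t01 [h1 h2]] := angle_exists (coord_val x).2.1 (coord_val x).2.2; exists t.
Qed.

Lemma page_angle_cases x t t' : page_angle x t -> page_angle x t' ->
  t = t' \/ (t = 0 /\ t' = 1) \/ (t = 1 /\ t' = 0) \/ (page_coord x).2 = 0.
Proof.
move=> [t01 c s] [t01' c' s']; have [->|q0] := eqVneq (page_coord x).2 0.
  by do 3!right.
have ct : cos (2 * pi * t) = cos (2 * pi * t') by apply: (mulfI q0); rewrite -c.
have st : sin (2 * pi * t) = sin (2 * pi * t') by apply: (mulfI q0); rewrite -s.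
by case: (angle_unique t01 t01' ct st) => [->|?|?]; [left|right; left|right; right; left].
Qed.

Lemma page_coord_ok x t : page_angle x t -> page_ok n w (page_coord x) t.
Proof.
move=> [t01 c s]; have : (@S3 R `\` K) (coord_val x).
  by have := valP x; rewrite inE.
move=> [Sx nK]; have q0 : 0 <= (page_coord x).2 by exact: sqrtr_ge0.
have cs := cos2Dsin2 (2 * pi * t).
have q2 : (page_coord x).2 ^+ 2 = (coord_val x).2.1 ^+ 2 + (coord_val x).2.2 ^+ 2.
  by rewrite sqr_sqrtr// addr_ge0// sqr_ge0.
have N1 : (page_coord x).1.1 ^+ 2 + (page_coord x).1.2 ^+ 2 + (page_coord x).2 ^+ 2 = 1.
  by rewrite q2 addrA; exact: Sx.
split=> //.
  apply/eqP => v0; move: N1; rewrite v0 /= expr0n /= !addr0 => /eqP.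
  by rewrite eq_sym oner_eq0.
move=> q_gt0 j jn [aE bE]; apply: nK.
exists t, (strand w j t); split=> //.
  by rewrite geometric_braidE//; exists j.
rewrite /solid_torus_embedding; set r := Num.sqrt _.
have qr : (page_coord x).2 = r^-1.
  have r2 : r ^+ 2 = 1 + (strand w j t).1 ^+ 2 + (strand w j t).2 ^+ 2.
    by rewrite sqr_sqrtr// !addr_ge0 ?sqr_ge0.
  apply/eqP; rewrite -(eqrXn2 (n := 2))// ?invr_ge0 ?sqrtr_ge0// exprVn r2.
  have r20 : 1 + (strand w j t).1 ^+ 2 + (strand w j t).2 ^+ 2 != 0.
    by rewrite gt_eqF// !ltr_pwDl ?sqr_ge0.
  apply/eqP/(mulIf r20); rewrite mulVf// -[RHS]N1 aE bE; ring.
have E1 : (coord_val x).1.1 = (strand w j t).1 / r by rewrite -qr mulrC -aE.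
have E2 : (coord_val x).1.2 = (strand w j t).2 / r by rewrite -qr mulrC -bE.
have E3 : (coord_val x).2.1 = cos (2 * pi * t) / r by rewrite -qr mulrC -c.
have E4 : (coord_val x).2.2 = sin (2 * pi * t) / r by rewrite -qr mulrC -s.
by rewrite /= -E1 -E2 -E3 -E4 -!surjective_pairing.
Qed.

(** A tube-lemma argument standing in for a continuous angle: at a time that is no angle of [x0] one
    of the defining equations fails, also nearby, and compactness of [0, 1] makes the neighbourhood
    of [x0] uniform in t. *)
Lemma near_page_angle x0 (Q : Z -> Prop) :
  (forall t, page_angle x0 t -> \forall z \near (page_coord x0, t), Q z) ->
  \forall x \near x0, forall t, page_angle x t -> Q (page_coord x, t).
Proof.
move=> H.
have cpt : near_covering `[0 : R, 1]%classic.
  exact/compact_near_coveringP/segment_compact.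
have cv : continuous (fun z : R * X => coord_val z.2).
  apply: (@cts_comp _ _ _ snd coord_val); last exact: cts_snd.
  exact: coord_val_continuous.
have cq : continuous (fun z : R * X => (page_coord z.2).2).
  by rewrite /page_coord; cts'.
have := cpt X (nbhs x0) (fun x t => page_angle x t -> Q (page_coord x, t)) _.
have h : forall t0 : R, `[0, 1]%classic t0 ->
    \forall t \near t0 & x \near x0, page_angle x t -> Q (page_coord x, t).
  move=> t0; rewrite /= in_itv /= => t001.
  have [pa|npa] := pselect (page_angle x0 t0).
    have hQ := H t0 pa.
    have c : continuous (fun z : R * X => (page_coord z.2, z.1)).
      apply: cts_pair; last exact: cts_fst.
      apply: (@cts_comp _ _ _ snd page_coord); last exact: cts_snd.
      exact: page_coord_continuous.
    have h : \forall z \near (t0, x0), Q (page_coord z.2, z.1).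
      exact: (c (t0, x0) _ hQ).
    by apply: filterS h => -[t x].
  have [e1|e1] := eqVneq (coord_val x0).2.1 ((page_coord x0).2 * cos (2 * pi * t0)).
    have [e2|e2] := eqVneq (coord_val x0).2.2 ((page_coord x0).2 * sin (2 * pi * t0)).
      by exfalso; apply: npa.
    have h : \forall z \near (t0, x0), (coord_val z.2).2.2 != (page_coord z.2).2 * sin (2 * pi * z.1).
      apply: (near_neq (f := fun z : R * X => (coord_val z.2).2.2)
        (g := fun z => (page_coord z.2).2 * sin (2 * pi * z.1)) (z0 := (t0, x0))) => //; first by cts.
      by apply: ctsM => //; cts'.
    by apply: filterS h => -[t x] /= /eqP ne [_ _].
  have h : \forall z \near (t0, x0), (coord_val z.2).2.1 != (page_coord z.2).2 * cos (2 * pi * z.1).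
    apply: (near_neq (f := fun z : R * X => (coord_val z.2).2.1)
        (g := fun z => (page_coord z.2).2 * cos (2 * pi * z.1)) (z0 := (t0, x0))) => //; first by cts.
      by apply: ctsM => //; cts'.
  by apply: filterS h => -[t x] /= /eqP ne [_ ? _].
move=> /(_ _ h); apply: filterS => x Hx t pa.
by apply: Hx => //; case: pa; rewrite /= in_itv.
Qed.

Inductive chart := ChartA | ChartB | ChartC.

Definition in_chart (c : chart) v t : Prop :=
  match c with
  | ChartA => chartA n w v t
  | ChartB => chartB n w v t
  | ChartC => chartC w v t
  end.

Definition trans (c d : chart) v t : G :=
  match c, d with
  | ChartA, ChartB => transAB n D w v t
  | ChartB, ChartA => (transAB n D w v t)^-1%g
  | ChartA, ChartC => transAC D w v t
  | ChartC, ChartA => (transAC D w v t)^-1%g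
  | ChartC, ChartB => transCB D w v t
  | ChartB, ChartC => (transCB D w v t)^-1%g
  | _, _ => 1%g
  end.

Lemma in_chart_near c (z0 : Z) : in_chart c z0.1 z0.2 -> \forall z \near z0, in_chart c z.1 z.2.
Proof.
by case: c; [exact: chartA_open|exact: chartB_open|exact: chartC_open].
Qed.

Lemma trans_near c d (z0 : Z) : 0 <= z0.1.2 -> in_chart c z0.1 z0.2 -> in_chart d z0.1 z0.2 ->
  \forall z \near z0, trans c d z.1 z.2 = trans c d z0.1 z0.2.
Proof.
move=> q0; case: c; case: d => /= hc hd; try by near=> z.
- exact: (transAB_near _ wn q0 (chartAB_off hc hd)).
- exact: (transAC_near _ wn hc hd).
- have h := transAB_near D wn q0 (chartAB_off hd hc).
  by near=> z; congr (_^-1)%g; near: z.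
- have h := transCB_near D wn hc hd.
  by near=> z; congr (_^-1)%g; near: z.
- have h := transAC_near D wn hd hc.
  by near=> z; congr (_^-1)%g; near: z.
- exact: (transCB_near _ wn hd hc).
Unshelve. all: by end_near. Qed.

Lemma trans_cocycle c d e v t : 0 <= t <= 1 ->
  in_chart c v t -> in_chart d v t -> in_chart e v t ->
  trans c e v t = (trans c d v t * trans d e v t)%g.
Proof.
move=> t01; have E := @charts_cocycle R G n D w v t wn t01.
case: c; case: d; case: e => /= h1 h2 h3;
rewrite ?mul1g ?mulg1 ?mulgV ?mulVg ?mulKg//;
rewrite ?E//; group_word.
Qed.

(** An ambiguous angle is either one of 0 and 1 or belongs to a point of the axis. Chart C avoids
    both situations; A and B are insensitive to the choice in both. *)
Lemma in_chart_angle c x t t' : page_angle x t -> page_angle x t' ->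
  in_chart c (page_coord x) t -> in_chart c (page_coord x) t'.
Proof.
move=> pt pt'; case: (page_angle_cases pt pt') => [->//|[[-> ->]|[[-> ->]|q0]]].
- case: c => /=; [by move/chartA_ends; apply|by move/chartB_ends; apply|by move/chartC0].
- case: c => /= h; [exact/chartA_ends|exact/chartB_ends|by move/chartC1: h].
- case: c => /=; [exact: chartA_axis|exact: chartB_axis|].
  by move/chartC_gt0; rewrite q0 ltxx.
Qed.

Lemma trans_angle c d x t t' : page_angle x t -> page_angle x t' ->
  in_chart c (page_coord x) t -> in_chart d (page_coord x) t ->
  trans c d (page_coord x) t = trans c d (page_coord x) t'.
Proof.
move=> pt pt'; case: (page_angle_cases pt pt') => [->//|h].
have noC : ~ chartC w (page_coord x) t.
  move=> hC; case: h => [[t0 _]|[[t1 _]|q0]].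
  - by move: hC; rewrite t0 => /chartC0.
  - by move: hC; rewrite t1 => /chartC1.
  - by move/chartC_gt0: hC; rewrite q0 ltxx.
have AB : chartA n w (page_coord x) t -> chartB n w (page_coord x) t ->
    transAB n D w (page_coord x) t = transAB n D w (page_coord x) t'.
  move=> hA hB; case: h => [[-> ->]|[[-> ->]|q0]].
  - exact: transAB_ends.
  - exact/esym/transAB_ends.
  - have a0 : (page_coord x).1.1 != 0.
      by have := chartAB_off hA hB (j := 1%N); rewrite q0 mul0r; apply; lia.
    by rewrite !transAB_axis.
by case: c; case: d => //= hc hd; rewrite AB.
Qed.

Definition angle_of x : R := xget 0 [set t | page_angle x t].

Lemma angle_ofP x : page_angle x (angle_of x).
Proof.
rewrite /angle_of; case: xgetP => [t _ //|H].
by have [t pt] := page_angle_exists x; case: (H t).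
Qed.

(** A takes precedence, so that [chart_transport D ChartA] is trivial on all of chart A. *)
Definition chart_at x : chart :=
  if pselect (chartA n w (page_coord x) (angle_of x)) then ChartA
  else if pselect (chartB n w (page_coord x) (angle_of x)) then ChartB else ChartC.

Lemma chart_atP x t : page_angle x t -> in_chart (chart_at x) (page_coord x) t.
Proof.
move=> pt; apply: (in_chart_angle (angle_ofP x) pt).
rewrite /chart_at; case: pselect => //= nA; case: pselect => //= nB.
by case: (charts_cover (page_coord_ok (angle_ofP x))).
Qed.

Definition chart_transport (c : chart) y : G :=
  trans c (chart_at y) (page_coord y) (angle_of y).

(** The transition, evaluated at [y], from the chart chosen at [x] to the one chosen at [y];
    meaningful for [y] near [x], where the chart of [x] still applies. *)
Definition transport x y : G := chart_transport (chart_at x) y.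

Lemma transport1 x : transport x x = 1%g.
Proof. by rewrite /transport /chart_transport; case: chart_at. Qed.

Definition point_in_chart c x : Prop := in_chart c (page_coord x) (angle_of x).

Lemma near_chart c x : point_in_chart c x -> \forall y \near x, point_in_chart c y.
Proof.
move=> hc; have : \forall y \near x, forall t, page_angle y t -> in_chart c (page_coord y) t.
  apply: (near_page_angle (Q := fun z => in_chart c z.1 z.2)) => t pt.
  by apply: in_chart_near; exact: in_chart_angle (angle_ofP x) pt hc.
by apply: filterS => y; apply; exact: angle_ofP.
Qed.

(** Near [x] the transition from [c] to the chart of [x] is constant, and the cocycle identity at y
    splits off the transition to the chart of y. *)
Lemma near_chart_transport c x : point_in_chart c x -> \forall y \near x,
  chart_transport c y = (chart_transport c x * transport x y)%g.
Proof.
move=> hc; have hd := chart_atP (angle_ofP x).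
have h1 := near_chart hc; have h2 := near_chart hd.
have h3 : \forall y \near x, forall t, page_angle y t ->
    trans c (chart_at x) (page_coord y) t = chart_transport c x.
  apply: (near_page_angle (Q := fun z => trans c (chart_at x) z.1 z.2 = chart_transport c x)) => t pt.
  rewrite /chart_transport (trans_angle (angle_ofP x) pt hc hd).
  apply: (trans_near (z0 := (page_coord x, t))); first exact: sqrtr_ge0.
    exact: in_chart_angle (angle_ofP x) pt hc.
  exact: in_chart_angle (angle_ofP x) pt hd.
near=> y; have E : trans c (chart_at x) (page_coord y) (angle_of y) = chart_transport c x.
  have : forall t, page_angle y t ->
      trans c (chart_at x) (page_coord y) t = chart_transport c x by near: y.
  by apply; exact: angle_ofP.
rewrite -E; apply: trans_cocycle.
- by case: (angle_ofP y).
- by near: y.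
- by near: y.
- exact: chart_atP (angle_ofP y).
Unshelve. all: by end_near. Qed.

Lemma transport_local x : \forall y \near x, \forall z \near y,
  transport x z = (transport x y * transport y z)%g.
Proof.
have h := near_chart (chart_atP (angle_ofP x)).
by apply: filterS h => y hy; exact: near_chart_transport.
Qed.

End transport_of_complement.

(** * Holonomy of the gap loops *)

Section gap_holonomy.
Context {R : realType} {G : groupType} (n : nat) (w : seq nat) (D : nat -> G).
Hypothesis wn : braid_word n w.
Hypothesis n_gt0 : (0 < n)%N.
Hypothesis DE : forall k, (k <= n)%N -> artin_word w D k = D k.
Local Notation I := (unit_interval R).
Local Notation V := (R * R * R)%type.
Local Notation X := (@S3 R `\` @braid_closure R n w : Type).
Local Notation T := (transport (R := R) (n := n) (w := w) D).
Implicit Types (v : V) (c : R).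

(** Within one chart the local system is trivial; only the comparison with the charts chosen at the
    two ends contributes. *)
Lemma holonomy_chart ch (p : I -> X) : continuous p ->
  (forall s, point_in_chart ch (p s)) ->
  holonomy T p ((chart_transport D ch (p zero))^-1 * chart_transport D ch (p one))%g.
Proof.
move=> cp pch; pose f u := chart_transport D ch (p (to_itv u)).
exists (fun u => (f 0)^-1 * f u)%g; last first.
  by rewrite /f mulVg to_itv_le0 ?(to_itv_ge1 (r := 1)).
move=> u _; have c := itv_path_continuous cp.
have h := near_chart_transport wn n_gt0 DE (pch (to_itv u)).
near=> u' => _; rewrite -mulgA; congr (_ * _)%g.
by near: u'; exact: (c u _ h).
Unshelve. all: by end_near. Qed.

(** A point of the sphere remembers its homogeneous coordinates only up to a positive factor, the
    normalisation of [page_point]. *)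
Definition vscale (l : R) v : V := ((l * v.1.1, l * v.1.2), l * v.2).

Lemma in_chart_scale ch l v t : 0 < l -> ch <> ChartC ->
  in_chart n w ch v t -> in_chart n w ch (vscale l v) t.
Proof.
move=> l0; case: ch => //= _ H j jn; have := H j jn => + [aE bE]; apply.
  split; first by apply: (mulfI (lt0r_neq0 l0)); rewrite mulrA.
  by rewrite -(ler_pM2l l0) mulrA.
split; first by apply: (mulfI (lt0r_neq0 l0)); rewrite mulrA.
by rewrite -(ler_pM2l l0) mulrA.
Qed.

Lemma strands_left_scale l v t : 0 < l ->
  strands_left n w (vscale l v) t = strands_left n w v t.
Proof.
by move=> l0; apply: eq_bigr => j _; rewrite /= -mulrA ltr_pM2l.
Qed.

Lemma page_coord_page v t : page_ok n w v t ->
  page_coord (page wn v t) = vscale (page_radius v)^-1 v.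
Proof.
move=> ok; have [t01 q0 v0 _] := ok.
have r0 := page_radius_gt0 v0.
rewrite /page_coord (val_page wn ok) /page_point /vscale /=.
congr (_, _, _); rewrite ?[_^-1 * _]mulrC//.
rewrite !expr_div_n !exprMn -mulrDl -mulrDr cos2Dsin2 mulr1 -expr_div_n sqrtr_sqr.
by rewrite ger0_norm// divr_ge0// ltW.
Qed.

Lemma page_angle_page v t : page_ok n w v t -> page_angle (page wn v t) t.
Proof.
move=> ok; have [t01 q0 v0 _] := ok.
rewrite /page_angle page_coord_page// (val_page wn ok) /page_point /vscale /=.
by split=> //; rewrite mulrAC [_ / _]mulrC.
Qed.

Lemma point_in_chart_page ch v t : page_ok n w v t -> ch <> ChartC ->
  in_chart n w ch v t -> point_in_chart ch (page wn v t).
Proof.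
move=> ok nC h; rewrite /point_in_chart.
apply: (in_chart_angle wn (page_angle_page ok) (angle_ofP _)).
rewrite page_coord_page//; apply: in_chart_scale => //.
by rewrite invr_gt0 page_radius_gt0//; case: ok.
Qed.

Lemma chart_transport_A (x : X) : point_in_chart ChartA x -> chart_transport D ChartA x = 1%g.
Proof.
by rewrite /chart_transport /chart_at /point_in_chart /=; case: pselect.
Qed.

Lemma chart_transport_B v t : page_ok n w v t ->
  chartA n w v t -> chartB n w v t ->
  chart_transport D ChartB (page wn v t) = ((transAB n D w v t)^-1)%g.
Proof.
move=> ok hA hB; have pA := point_in_chart_page ok (ch := ChartA) _ hA.
have pB := point_in_chart_page ok (ch := ChartB) _ hB.
have {}pA : point_in_chart ChartA (page wn v t) by exact: pA.
have {}pB : point_in_chart ChartB (page wn v t) by exact: pB.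
have -> : chart_transport D ChartB (page wn v t) =
    trans n w D ChartB ChartA (page_coord (page wn v t)) (angle_of (page wn v t)).
  move: pA; rewrite /chart_transport /chart_at /point_in_chart /=.
  by case: pselect.
rewrite (trans_angle wn n_gt0 DE (angle_ofP _) (page_angle_page ok) pB pA).
congr (_^-1)%g; rewrite /transAB page_coord_page// strands_left_scale//.
by rewrite invr_gt0 page_radius_gt0//; case: ok.
Qed.

Lemma rest0 : at_rest (R := R) n w 0.
Proof.
split; first by rewrite lexx ler01.
by move=> j jn; exists j => //; exact: strand0.
Qed.

Lemma rest_charts v : 0 <= v.2 ->
  (forall k, (1 <= k <= n)%N -> v.1.1 = v.2 * k%:R -> v.1.2 < 0) -> chartA n w v 0.
Proof.
move=> q0 H j jn; rewrite strand0 mulr0 => -[aE b0].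
by have := H j jn aE; rewrite ltNge b0.
Qed.

Lemma rest_chartsB v : 0 <= v.2 ->
  (forall k, (1 <= k <= n)%N -> v.1.1 = v.2 * k%:R -> 0 < v.1.2) -> chartB n w v 0.
Proof.
move=> q0 H j jn; rewrite strand0 mulr0 => -[aE b0].
by have := H j jn aE; rewrite ltNge b0.
Qed.

Lemma gap_column k j (q : R) : gap k * q = q * j%:R -> q = 0.
Proof.
rewrite mulrC => E; apply/eqP; apply: contraTT (gap_neq (R := R) k j) => q0.
by rewrite negbK; apply/eqP; exact: (mulfI q0).
Qed.

Let axis_chartA : @axis_set R `<=` (chartA n w ^~ 0).
Proof.
move=> [[a b] q]; rewrite /axis_set /linform /= => -[/= q0 ab].
apply: rest_charts => /=; first lra.
have qz : q = 0 by lra.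
by move=> k _; rewrite qz mul0r => a0; lra.
Qed.

Let axis_chartB : @axis_set' R `<=` (chartB n w ^~ 0).
Proof.
move=> [[a b] q]; rewrite /axis_set' /linform /= => -[/= q0 ab].
apply: rest_chartsB => /=; first lra.
have qz : q = 0 by lra.
by move=> k _; rewrite qz mul0r => a0; lra.
Qed.

Let below_chartA k : below_set (gap (R := R) k) `<=` (chartA n w ^~ 0).
Proof.
move=> [[a b] q]; rewrite /below_set /linform /= => -[[/= aE q0] bq].
apply: rest_charts => //=; first lra.
move=> j _ aE'; have q00 : q = 0 by apply: (@gap_column k j); lra.
lra.
Qed.

Let above_chartB k : above_set (gap (R := R) k) `<=` (chartB n w ^~ 0).
Proof.
move=> [[a b] q]; rewrite /above_set /linform /= => -[[/= aE q0] bq].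
apply: rest_chartsB => //=; first lra.
move=> j _ aE'; have q00 : q = 0 by apply: (@gap_column k j); lra.
lra.
Qed.

Lemma gap_strands_left k : (k <= n)%N -> strands_left n w ((gap (R := R) k, 0), 1) 0 = k.
Proof.
move=> kn; rewrite /strands_left; under eq_bigr do rewrite strand0 /= mul1r.
rewrite (@big_cat_nat _ _ _ k.+1)//=.
rewrite [X in (_ + X)%N]big_nat [X in (_ + X)%N]big1 ?addn0; last first.
  move=> j /andP[kj _]; have : k%:R + 1 <= j%:R :> R by rewrite natr1 ler_nat.
  by move=> h; rewrite ltNge /gap (_ : _ <= _)//; lra.
rewrite -[RHS]muln1 -[X in _ = (X * _)%N](subn1 k.+1) -sum_nat_const_nat !big_nat.
apply: eq_bigr => j /andP[_ jk]; have : j%:R <= k%:R :> R by rewrite ler_nat -ltnS.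
by move=> h; rewrite /gap (_ : _ < _)//; lra.
Qed.

(** The lower half lies in chart A and has trivial holonomy. The upper half lies in chart B and
    contributes D_k at the k-th gap and D_n^-1 at the base point, which is to the right of all
    strands. *)
Lemma gap_element_holonomy k : (k <= n)%N ->
  class_holonomy T (gap_element wn k) (D k * (D n)^-1)%g.
Proof.
move=> kn; have z01 : 0 <= (0 : R) <= 1 by rewrite lexx ler01.
pose c := gap (R := R) k.
pose f1 : I -> V := path_cat (segment axis_base axis_below) (segment axis_below ((c, 0), 1)).
pose f2 : I -> V := path_cat (segment ((c, 0), 1) axis_above) (segment axis_above axis_base).
have okf s : page_ok n w (gap_loop c s) 0 := pairwise_mixl (gap_loop_rest k rest0) s.
have ok1 s : page_ok n w (f1 s) 0.
  have a2 : 0 <= 2^-1 * of_itv s <= 1.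
    by have /andP[? ?] := of_itvP s; apply/andP; split; lra.
  have := okf (to_itv (2^-1 * of_itv s)); rewrite /gap_loop {1}/path_cat.
  rewrite to_itvE// ifT; last by have /andP[? ?] := of_itvP s; lra.
  by rewrite (_ : 2 * (2^-1 * of_itv s) = of_itv s) ?of_itvK//; lra.
have ok2 s : page_ok n w (f2 s) 0.
  have [s0|s0] := eqVneq (of_itv s) 0.
    have -> : s = zero by apply: of_itv_inj; rewrite of_itv0.
    by rewrite /f2 path_cat0 segment0; have := ok1 one; rewrite /f1 path_cat1 segment1.
  have /andP[s0' s1] := of_itvP s; have sp : 0 < of_itv s by rewrite lt_def s0.
  have := okf (to_itv (2^-1 + 2^-1 * of_itv s)); rewrite /gap_loop {1}/path_cat.
  rewrite to_itvE; last by apply/andP; split; lra.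
  rewrite ifF; last by apply/negbTE; rewrite -ltNge; lra.
  by rewrite (_ : 2 * (2^-1 + 2^-1 * of_itv s) - 1 = of_itv s) ?of_itvK//; lra.
have below := @below_chartA k; have above := @above_chartB k.
rewrite -/c in below above.
have A1 s : chartA n w (f1 s) 0.
  apply: (@pairwise_mixl _ (chartA n w ^~ 0) _ f1).
  apply: pairwise_mix_cat.
  - by apply: (pairwise_mix_segment _ axis_chartA); [convexity|in_half_spaces..].
  - by apply: (pairwise_mix_segment _ below); [convexity|in_half_spaces..].
have B2 s : chartB n w (f2 s) 0.
  apply: (@pairwise_mixl _ (chartB n w ^~ 0) _ f2).
  apply: pairwise_mix_cat.
  - by apply: (pairwise_mix_segment _ above); [convexity|in_half_spaces..].
  - by apply: (pairwise_mix_segment _ axis_chartB); [convexity|in_half_spaces..].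
have cf1 : continuous f1.
  by apply: path_cat_continuous; rewrite ?segment0 ?segment1//; exact: segment_continuous.
have cf2 : continuous f2.
  by apply: path_cat_continuous; rewrite ?segment0 ?segment1//; exact: segment_continuous.
pose p1 s := page wn (f1 s) 0; pose p2 s := page wn (f2 s) 0.
have cp1 : continuous p1 by apply: page_continuous => //; cts.
have cp2 : continuous p2 by apply: page_continuous => //; cts.
have f10 : f1 zero = axis_base by rewrite /f1 path_cat0 segment0.
have f11 : f1 one = ((c, 0), 1) by rewrite /f1 path_cat1 segment1.
have f20 : f2 zero = ((c, 0), 1) by rewrite /f2 path_cat0 segment0.
have f21 : f2 one = axis_base by rewrite /f2 path_cat1 segment1.
have h1 : holonomy T p1 1%g.
  have pA s : point_in_chart ChartA (p1 s).
    by apply: (point_in_chart_page (ok1 s)) => //; exact: A1.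
  by have := holonomy_chart cp1 pA; rewrite !chart_transport_A// mulVg.
have h2 : holonomy T p2 (D k * (D n)^-1)%g.
  have pB s : point_in_chart ChartB (p2 s).
    by apply: (point_in_chart_page (ok2 s)) => //; exact: B2.
  have := holonomy_chart cp2 pB; rewrite /p2 f20 f21.
  rewrite chart_transport_B; last 3 first.
  - by rewrite -f11.
  - by rewrite -f11.
  - by rewrite -f20.
  rewrite chart_transport_B; last 3 first.
  - by rewrite -f10.
  - by rewrite -f10.
  - by rewrite -f21.
  rewrite invgK (@transAB_axis _ _ _ _ _ axis_base)//; last exact: oner_neq0.
  rewrite /axis_base /= ltr01.
  by rewrite /transAB gap_strands_left// level0 DE.
have loop12 : path_cat p1 p2 = fun s => page wn (gap_loop c s) 0.
  apply/funext => s; rewrite /gap_loop -/f1 -/f2 /path_cat.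
  by case: ifP.
exists (loop_of (page_base n w) (path_cat p1 p2)).
  by rewrite loop12.
rewrite loop_ofE.
  rewrite -[X in holonomy _ _ X]mul1g; apply: holonomy_cat => //.
  by rewrite /p1 /p2 f11 f20.
rewrite loop12; have [g0 g1] := @gap_loop_ends R c.
by apply: is_loop_page => //; exact: gap_loop_continuous.
Qed.

End gap_holonomy.

Lemma twisted_torus_braid_word s : braid_word 5 (twisted_torus_word 5 3 s).
Proof. by rewrite /braid_word /twisted_torus_word all_cat /= all_nseq orbT. Qed.

Theorem theorem4p4 (R : realType) (s : nat) :
  exists g : twisted_torus_knot_group R 5 3 s, generalized_torsion g.
Proof.
have wn := twisted_torus_braid_word s; set w := twisted_torus_word 5 3 s in wn.
suff : exists g : fundamental_group R (page_base (R := R) 5 w), generalized_torsion g.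
  by [].
pose y := gap_element (R := R) wn.
have := twisted_torus_relation (y := y) (gap_element_last wn)
  (fun k _ => gap_element_artin wn k).
cbv zeta.
set c := (y 2 * (y 0%N)^-1)%g; set u := (y 2 * c ^- s.+1)%g => rel.
exists (c * u * c^-1 * u^-1)%g; apply: (positive_relation_torsion rel).
have [c' [u' [rel' cu']]] := affine_solution s.+1.
pose D := twisted_torus_solution c' u' s.
have DE k : (k <= 5)%N -> artin_word w D k = D k.
  by move=> k5; apply: twisted_torus_solutionP.
have T1 := transport1 (R := R) (n := 5) (w := w) D.
have Tl := transport_local (R := R) wn (isT : (0 < 5)%N) DE.
(* The last entry of [D] is 1, so the holonomy of y_k is exactly D_k. *)
have hol k : (k <= 5)%N -> class_holonomy (transport (R := R) (n := 5) (w := w) D) (y k) (D k).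
  move=> k5; have := gap_element_holonomy wn isT DE k5.
  by rewrite (_ : D 5 = 1%g) // invg1 mulg1.
have hM := @class_holonomyM R _ _ (transport (R := R) (n := 5) (w := w) D) (page_base 5 w).
have hV (a : fundamental_group R (page_base (R := R) 5 w)) h :
    class_holonomy (transport D) a h -> class_holonomy (transport D) a^-1%g h^-1%g.
  exact: class_holonomyV.
have hc : class_holonomy (transport (R := R) (n := 5) (w := w) D) c c'.
  have := hM _ _ _ _ (hol 2 isT) (hV _ _ (hol 0%N isT)).
  rewrite (_ : D 2 * (D 0%N)^-1 = c')%g//.
  by rewrite /D /twisted_torus_solution /= invgM invgK mulVKg.
have hX m : class_holonomy (transport (R := R) (n := 5) (w := w) D) (c ^+ m)%g (c' ^+ m)%g.
  elim: m => [|m IH]; first exact: class_holonomy1.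
  by rewrite !expgS; exact: hM.
have hu : class_holonomy (transport (R := R) (n := 5) (w := w) D) u u'.
  have := hM _ _ _ _ (hol 2 isT) (hV _ _ (hX s.+1)).
  by rewrite (_ : D 2 * (c' ^- s.+1) = u')%g// /D /twisted_torus_solution /= mulgK.
(* If the commutator were trivial, uniqueness of the holonomy would make the commutator of [c'] and
   [u'] trivial. *)
move=> g1; apply: cu'.
have := hM _ _ _ _ (hM _ _ _ _ (hM _ _ _ _ hc hu) (hV _ _ hc)) (hV _ _ hu).
rewrite g1 => hg; exact: (class_holonomy_unique T1 Tl hg (class_holonomy1 T1 _)).
Qed.
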